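(* Let $\varphi\in\mathcal{S}(\mathfrak{A})$ be a locally faithful even state on the Fermion algebra $\mathfrak{A}$. Then the following assertions are equivalent: (i) $\varphi$ is a Markov state; (ii) for each $t\in\mathbb{R}$ and $k<n<j_+$, $w_{k,n}(t)\in\mathfrak{A}_{[n,n+1],+}$, where $w_{k,n}(t):=D_{[k,n+1]}^{it}D_{[k,n]}^{-it}$. Moreover, if $I=\mathbb{Z}$, $\mathfrak{A}_{\{n\}}=\mathbb{M}_{2^d}(\mathbb{C})$ for each $n\in\mathbb{Z}$, and $\varphi$ is translation invariant, the previous assertions are also equivalent to (iii) $S(\varphi_{[0,n+1]})-S(\varphi_{[0,n]})=S(\varphi_{[0,1]})-S(\varphi_{\{0\}})$ for all $n\ge1$.
   Context: Fermion algebra. $I$ is a countable totally ordered set order isomorphic to $\mathbb{Z}$, $\mathbb{Z}_-$, $\mathbb{Z}_+$ or a finite interval; $j_-$, $j_+$ are its smallest and greatest elements if they exist (otherwise $j_-=-\infty$, $j_+=+\infty$). For $j\in I$, $\mathfrak{A}_{\{j\}}\cong\mathbb{M}_{2^{d_j}}(\mathbb{C})$ is generated by $d_j$ annihilators $a_{j,1},\dots,a_{j,d_j}$ and their adjoints, all generators (also on different sites) satisfying the canonical anticommutation relations $\{a_{j,i}^*,a_{k,h}\}=\delta_{jk}\delta_{ih}1$, $\{a_{j,i},a_{k,h}\}=0$. For $\Lambda\subset I$, $\mathfrak{A}_\Lambda$ is the $C^*$-algebra generated by $\mathfrak{A}_{\{j\}}$, $j\in\Lambda$; $\mathfrak{A}=\mathfrak{A}_I$;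 $[k,n]=\{l\in I:k\le l\le n\}$, $n]=\{l\in I:l\le n\}$, $\mathfrak{A}_{j_--1]}=\mathbb{C}1$, $\varphi_\Lambda=\varphi|_{\mathfrak{A}_\Lambda}$. $\Theta$ is the parity automorphism $\Theta(a_{j,i})=-a_{j,i}$; even maps are those commuting with $\Theta$, even states the $\Theta$-invariant ones; $\mathfrak{A}_{\Lambda,+}=\{a\in\mathfrak{A}_\Lambda:\Theta(a)=a\}$. A state is locally faithful if $\varphi_\Lambda$ is faithful for all finite $\Lambda$. When $I=\mathbb{Z}$ and $d_j=d$ for all $j$, the shift $\alpha$ is the automorphism with $\alpha(a_{j,i})=a_{j+1,i}$, and $\varphi$ is translation invariant if $\varphi\circ\alpha=\varphi$. Markov states. A quasi conditional expectation with respect to unital $C^*$-algebras $\mathfrak{C}\subset\mathfrak{B}\subset\mathfrak{D}$ is a completely positive unital map $E:\mathfrak{D}\to\mathfrak{B}$ with $E(ca)=cE(a)$ for $c\in\mathfrak{C}$, $a\in\mathfrak{D}$. An even state $\varphi$ is a Markov state if for each $n<j_+$ there is an even quasi conditional expectation $E_n$ with respect to $\mathfrak{A}_{n-1]}\subset\mathfrak{A}_{n]}\subset\mathfrak{A}_{n+1]}$ with $\varphi_{n]}\circ E_n=\varphi_{n+1]}$ and $E_n(\mathfrak{A}_{[n,n+1]})\subset\mathfrak{A}_{\{n\}}$. $D_{[k,l]}\in\mathfrak{A}_{[k,l]}$ is the adjusted density matrix of $\varphi_{[k,l]}$: the unique positive element with $\varphi_{[k,l]}=\tau(\,\cdot\,D_{[k,l]})$,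 $\tau$ the normalized trace. $S(\cdot)$ is the von Neumann entropy. *)

(* Defs.v *)
From HB Require Import structures.
From mathcomp Require Import all_boot all_order all_algebra.
From mathcomp Require Import all_classical all_reals all_analysis.
From mathcomp Require Import complex.
Set Implicit Arguments.
Unset Strict Implicit.
Unset Printing Implicit Defensive.
Import Order.TTheory GRing.Theory Num.Theory.
Local Open Scope classical_set_scope.
Local Open Scope ring_scope.
Local Open Scope complex_scope.

(* Unital C*-algebras over the complex numbers R[i]. The norm is part of the
   mixin because Hierarchy Builder accepts no structure that inherits from both
   [completeNormedModType] and [algType] (a join below [numDomainType] is
   missing in the libraries). *)
HB.mixin Record isCstarAlgebra (R : realType) A of GRing.Algebra R[i] A := {
  star : A -> A ;
  starK : involutive star ;
  starD : forall x y, star (x + y) = star x + star y ;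
  starZ : forall (c : R[i]) x, star (c *: x) = c^* *: star x ;
  starM : forall x y, star (x * y) = star y * star x ;
  cnorm : A -> R ;
  cnorm0_eq0 : forall x, cnorm x = 0 -> x = 0 ;
  ler_cnormD : forall x y, cnorm (x + y) <= cnorm x + cnorm y ;
  cnormZ : forall (c : R[i]) x, (cnorm (c *: x))%:C = `|c| * (cnorm x)%:C ;
  ler_cnormM : forall x y, cnorm (x * y) <= cnorm x * cnorm y ;
  cstar_identity : forall x, cnorm (star x * x) = cnorm x ^+ 2 ;
  cnorm_complete : forall u : nat -> A,
    (forall e, 0 < e -> exists N, forall m n,
       (N <= m)%N -> (N <= n)%N -> cnorm (u m - u n) < e) ->
    exists x, forall e, 0 < e -> exists N, forall n,
       (N <= n)%N -> cnorm (u n - x) < e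
}.

#[short(type="cstarAlgType")]
HB.structure Definition CstarAlgebra (R : realType) :=
  {A of isCstarAlgebra R A & GRing.Algebra R[i] A}.

Section CstarAlgebraTheory.
Variables (R : realType) (A : cstarAlgType R).
Implicit Types (B C D : set A) (x y : A) (phi : {scalar A}).

Definition cstar_closed B := forall x,
  (forall e : R, 0 < e -> exists2 y, B y & cnorm (x - y) < e) -> B x.

Record cstar_subalgebra B : Prop := CstarSubalgebra {
  csub1 : B 1 ;
  csubD : forall x y, B x -> B y -> B (x + y) ;
  csubZ : forall (c : R[i]) x, B x -> B (c *: x) ;
  csubM : forall x y, B x -> B y -> B (x * y) ;
  csub_star : forall x, B x -> B (star x) ;
  csub_closed : cstar_closed B
}.

(* Always contains the unit; in particular [cstar_generated set0] is C1. *)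
Definition cstar_generated (S : set A) : set A := smallest cstar_subalgebra S.

Definition cpositive x := exists y, x = star y * y.

Definition cinvertible x := exists y, x * y = 1 /\ y * x = 1.

Definition spectrum x : set R[i] := [set z | ~ cinvertible (x - z%:A)].

(* The continuous functional calculus of a self-adjoint x: f(x) is the limit of
   p_n(x) for any polynomials p_n converging to f uniformly on the (real)
   spectrum of x. *)
Definition is_cfc (f : R -> R[i]) x y := forall e : R, 0 < e ->
  exists2 p : {poly R[i]},
    forall s : R, spectrum x s%:C -> `|p.[s%:C] - f s| <= e%:C
  & cnorm (horner_alg x p - y) <= e.

Definition cfc (f : R -> R[i]) x : A := xget 0 [set y | is_cfc f x y].

(* x^{it} for x positive and invertible, since s^{it} = exp(i t ln s) *)
Definition cpow_it x (t : R) : A :=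
  cfc (fun s => cos (t * ln s) +i* sin (t * ln s)) x.

Definition state phi :=
  (forall x, 0 <= phi (star x * x)) /\ phi 1 = 1.

Definition faithful_on B phi :=
  forall x, B x -> phi (star x * x) = 0 -> x = 0.

Record tracial_state B (tau : A -> R[i]) : Prop := TracialState {
  trace_linear : forall (c : R[i]) x y, B x -> B y ->
    tau (c *: x + y) = c * tau x + tau y ;
  trace_ge0 : forall x, B x -> 0 <= tau (star x * x) ;
  trace1 : tau 1 = 1 ;
  traceC : forall x y, B x -> B y -> tau (x * y) = tau (y * x)
}.

(* On a full matrix algebra, the normalized trace is the only tracial state.
   Only the values on B matter. *)
Definition normalized_trace B : A -> R[i] :=
  xget (fun=> 0) [set tau | tracial_state B tau].

Definition is_adjusted_density phi B x :=
  [/\ B x, cpositive x & forall y, B y -> phi y = normalized_trace B (y * x)].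

Definition adjusted_density phi B : A :=
  xget 0 [set x | is_adjusted_density phi B x].

(* B is meant to be isomorphic to the algebra of m x m matrices: its trace is
   then Tr = m tau, the density matrix of phi with respect to Tr is rho = D / m,
   and the entropy is - Tr(rho ln rho). Note that s * ln s is 0 at s = 0. *)
Definition vn_entropy (m : nat) phi B : R :=
  let rho := (m%:R : R[i])^-1 *: adjusted_density phi B in
  - complex.Re (m%:R * normalized_trace B (cfc (fun s => (s * ln s)%:C) rho)).

(* Maps defined on a subalgebra D are represented by functions on A, of which
   only the restriction to D matters. *)

Definition star_mx n (X : 'M[A]_n) : 'M[A]_n := (map_mx star X)^T.

Definition mx_over n (B : set A) (X : 'M[A]_n) := forall i j, B (X i j).

Definition mx_positive n (B : set A) (X : 'M[A]_n) :=
  exists2 Y : 'M[A]_n, mx_over B Y & X = star_mx Y *m Y.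

Definition linear_on D (E : A -> A) := forall (c : R[i]) x y,
  D x -> D y -> E (c *: x + y) = c *: E x + E y.

Definition completely_positive D B (E : A -> A) :=
  forall n (X : 'M[A]_n), mx_positive D X -> mx_positive B (map_mx E X).

Record quasi_conditional_expectation C B D (E : A -> A) : Prop :=
  QuasiConditionalExpectation {
    qce_linear : linear_on D E ;
    qce_codom : forall x, D x -> B (E x) ;
    qce_cp : completely_positive D B E ;
    qce_unital : E 1 = 1 ;
    qce_mull : forall c x, C c -> D x -> E (c * x) = c * E x
  }.

Definition star_automorphism (f : {lrmorphism A -> A}) :=
  bijective f /\ forall x, f (star x) = star (f x).

Definition even_map (Theta : A -> A) D (E : A -> A) :=
  forall x, D x -> E (Theta x) = Theta (E x).

Definition invariant_state (f : A -> A) phi := forall x, phi (f x) = phi x.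

(* The index set is a nonempty interval I of integers; the annihilator a_{j,i}
   is [a j i], with i ranging over 'I_(d j). The values at j outside I are
   irrelevant. *)
Variables (I : set int) (d : int -> nat) (a : forall j : int, 'I_(d j) -> A).

Definition canonical_anticommutation :=
  forall j k, I j -> I k -> forall (i : 'I_(d j)) (h : 'I_(d k)),
    star (a i) * a h + a h * star (a i)
      = ((j == k) && (i == h :> nat))%:R
    /\ a i * a h + a h * a i = 0.

Definition generators (L : set int) : set A :=
  [set x | exists2 j, L j & exists i : 'I_(d j), x = a i].

(* the algebra of a region L, for L included in I *)
Definition loc (L : set int) : set A := cstar_generated (generators L).

Definition fermion_algebra := canonical_anticommutation /\ loc I = setT.

Definition seg (k n : int) : set int := [set l | I l /\ k <= l <= n].

Definition upto (n : int) : set int := [set l | I l /\ l <= n].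

(* n < j_+, covering also the convention j_+ = +oo *)
Definition below_top (n : int) := I n /\ exists2 m, I m & n < m.

Definition parity (Theta : {lrmorphism A -> A}) :=
  star_automorphism Theta /\
  forall j, I j -> forall i : 'I_(d j), Theta (a i) = - a i.

Definition even_part (Theta : A -> A) B : set A := [set x | B x /\ Theta x = x].

Definition locally_faithful phi := forall L : set int,
  finite_set L -> L `<=` I -> faithful_on (loc L) phi.

Definition markov_state (Theta : A -> A) phi :=
  [/\ state phi, invariant_state Theta phi &
    forall n, below_top n -> exists E : A -> A,
      [/\ quasi_conditional_expectation
            (loc (upto (n - 1))) (loc (upto n)) (loc (upto (n + 1))) E,
          even_map Theta (loc (upto (n + 1))) E,
          forall x, loc (upto (n + 1)) x -> phi (E x) = phi x &
          forall x, loc (seg n (n + 1)) x -> loc [set n] (E x)]].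

(* D_{[k,l]} *)
Definition density phi (k l : int) : A := adjusted_density phi (loc (seg k l)).

(* w_{k,n}(t) *)
Definition cocycle phi (k n : int) (t : R) : A :=
  cpow_it (density phi k (n + 1)) t * cpow_it (density phi k n) (- t).

(* S(phi_{[k,l]}): the algebra of [k,l] is the algebra of matrices of size
   2 ^ N, N being the number of annihilators located in [k,l]. *)
Definition local_entropy phi (k l : int) : R :=
  let N := (\big[addn/0%N]_(j \in seg k l) d j)%N in
  vn_entropy (2 ^ N) phi (loc (seg k l)).

(* meaningful when I is the set of all integers and d is constant *)
Definition site_shift (alpha : {lrmorphism A -> A}) :=
  star_automorphism alpha /\
  forall j (i : 'I_(d j)) (i' : 'I_(d (j + 1))),
    i = i' :> nat -> alpha (a i) = a i'.

End CstarAlgebraTheory.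

(* Main.v *)
From HB Require Import structures.
Require Import Defs.
From mathcomp Require Import all_boot all_order all_algebra.
From mathcomp Require Import all_classical all_reals all_analysis.
From mathcomp Require Import complex ring lra zify.
Import Order.TTheory GRing.Theory Num.Theory.
Local Open Scope classical_set_scope.
Local Open Scope ring_scope.
Set Implicit Arguments.
Unset Strict Implicit.
Unset Printing Implicit Defensive.

(** Let D_L be the density of phi on a finite region L. For two sites n, n + 1
    and a site k to their left, the proof compares the four densities of
    M = [k, n + 1], N = [k, n], [n, n + 1] and {n}.

    The algebra of a finite region is generated by Majorana operators, that is,
    by anticommuting self-adjoint unitaries that are odd for Theta. Forgetting a
    generator g is the projection u + v g |-> u onto the algebra of the other
    generators. It is also the map x |-> (x + g Theta(x) g) / 2, hence positive
    and a module map; iterating it gives the conditional expectations onto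
    smaller regions and, in the end, the normalized trace (tau, tau_unique). The spectral theorem (spectral_theorem) for these
    finite-dimensional algebras then replaces the functional calculus by finite
    sums over eigenprojections (cfc_fcalc).

    The second tool is a calculus for pairs of densities: ratio_calc sends f to
    the sum of f(r / m) p_r(D) q p_m(D') over the eigenvalues. Only finitely many
    ratios occur, so every f is a combination of powers r^j, of phases r^(it),
    or of resolvents 1 / (r + t) with t > 0, and an assertion that is linear in f
    passes from one of these families to all functions (spanning_ratio).

    From (i) to (ii). The expectation E_n fixes the algebra of [k, n - 1].
    Combined with the Schwarz inequality for E_n and its invariance for phi, this
    shows that a fixed point q satisfies D_M^-1 q D_M = D_N^-1 q D_N
    (fixed_point_modular), and the same for all powers, hence for the phases. So
    the cocycle D_M^(it) D_N^(-it) commutes with the algebra of [k, n - 1]; as it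
    is even, it belongs to the algebra of [n, n + 1] (markov_cocycle).

    From (ii) to (i). If all the cocycles lie in the algebra of [n, n + 1], so do
    the products w_j = D_M^j D_N^-j. Forgetting the left region in
    D_M w_j = w_(j+1) D_N shows by induction that w_j is formed in the same way
    from the densities of [n, n + 1] and {n} (ratio_localization). In particular
    w = D_[n,n+1]^(1/2) D_{n}^(-1/2) also equals D_M^(1/2) D_N^(-1/2), whatever k,
    so that w D_N (star w) = D_M. Therefore x |-> (star w) x w followed by
    forgetting the site n + 1 preserves phi (markov_expectation_phi), and it is
    the Markov expectation. It is completely positive because forgetting a
    generator turns the square of a matrix into a sum of two squares, and a sum
    of squares of matrices over the algebra of a half-line is again a square
    (sum_of_squares_is_square): this follows by approximation from finite
    regions, as the square root is norm continuous.

    For (iii), the entropy is, up to a constant that depends on the dimension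
    only, - phi(ln D). With f = ln, the equality of the two ratio calculi equates
    the increments of the entropy (ratio_local_entropy). For the converse, let
    x_t and y_t be the resolvents of z |-> D_[n,n+1] z D_M^-1 and of
    z |-> D_{n} z D_N^-1, applied to 1. Then z = x_t - y_t satisfies
    t phi(star z * z) <= F(t), where F(t) is the real part of
    phi(x_t) - phi(y_t) (resolvent_gap). The function F is the derivative of a
    combination of logarithms that vanishes at 0 when the increments of the
    entropy agree, and that tends to 0 at infinity; being nonnegative, F is 0
    (resolvent_sum_eq0). Hence x_t = y_t for all t > 0, the two ratio calculi
    agree for every f, and the cocycle of (M, N) is that of [n, n + 1] and {n}
    (entropy_cocycle). Translation invariance identifies the increment at n with
    the increment at 0. *)

(** * Functional calculus on finitely many real nodes *)

Section FunctionalCalculus.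
Local Open Scope complex_scope.
Variables (R : realType) (W : algType R[i]).
Implicit Types (x y q : W) (s : seq R) (l m : R) (p : {poly R[i]}) (f g : R -> R[i]).

Lemma horner_algZ x (c : R[i]) p : horner_alg x (c *: p) = c *: horner_alg x p.
Proof. by rewrite -mul_polyC rmorphM /= horner_algC mulr_algl. Qed.

Definition node_poly s : {poly R[i]} := \prod_(l <- s) ('X - (l%:C)%:P).

(** The list s only has to contain the eigenvalues of x: several elements can
    thus be given the same list. *)
Definition annihilates s x := uniq s /\ horner_alg x (node_poly s) = 0.

Definition lagrange_basis s l : {poly R[i]} :=
  \prod_(m <- s | m != l) (((l - m)^-1)%:C *: ('X - (m%:C)%:P)).

Definition eigenproj s l x : W := horner_alg x (lagrange_basis s l).

Definition fcalc s f x : W := \sum_(l <- s) f l *: eigenproj s l x.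

Lemma lagrangeE s l m : uniq s -> l \in s -> m \in s ->
  (lagrange_basis s l).[m%:C] = (l == m)%:R.
Proof.
move=> us ls ms; rewrite /lagrange_basis horner_prod.
case: eqVneq => [<-|lm] /=.
  rewrite big1_seq // => k /andP[kl _].
  rewrite hornerZ hornerXsubC -raddfB -rmorphM /= mulVf ?subr_eq0 1?eq_sym //.
rewrite (big_rem m) //= eq_sym lm hornerZ hornerXsubC subrr mulr0 mul0r //.
Qed.

Lemma horner_alg_eq s x p r : annihilates s x ->
  (forall l, l \in s -> p.[l%:C] = r.[l%:C]) -> horner_alg x p = horner_alg x r.
Proof.
move=> [us ann] h; apply/eqP; rewrite -subr_eq0 -raddfB /=; apply/eqP.
have: node_poly s %| p - r.
  rewrite /node_poly -(big_map (fun l => l%:C) predT (fun z => 'X - z%:P)).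
  apply: uniq_roots_dvdp.
    by apply/allP => _ /mapP[l ls ->]; rewrite /root hornerD hornerN h ?subrr.
  by rewrite uniq_rootsE map_inj_uniq //; exact: (@complexI R).
case/dvdpP => k ->.
by rewrite rmorphM /= ann mulr0.
Qed.

Lemma horner_alg_fcalc s x p : annihilates s x ->
  horner_alg x p = fcalc s (fun l => p.[l%:C]) x.
Proof.
move=> ann; have [us _] := ann.
rewrite /fcalc /eigenproj.
under eq_bigr do rewrite -horner_algZ.
rewrite -raddf_sum; apply: (horner_alg_eq ann) => l ls.
rewrite horner_sum (big_rem l) //= hornerZ lagrangeE // eqxx mulr1.
rewrite big1_seq ?addr0 // => m /andP[_]; rewrite mem_rem_uniq // inE => /andP[ml ms].
by rewrite hornerZ lagrangeE // (negPf ml) mulr0.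
Qed.

Lemma fcalc_id s x : annihilates s x -> fcalc s (fun l => l%:C) x = x.
Proof.
move=> ann; rewrite -[RHS]horner_algX (horner_alg_fcalc _ ann).
by apply: eq_bigr => l _; rewrite hornerX.
Qed.

Lemma fcalc1 s x : annihilates s x -> fcalc s (fun=> 1) x = 1.
Proof.
move=> ann; rewrite -[RHS]scale1r -(horner_algC x) (horner_alg_fcalc _ ann).
by apply: eq_bigr => l _; rewrite hornerC.
Qed.

Lemma eq_fcalc s f g x : {in s, f =1 g} -> fcalc s f x = fcalc s g x.
Proof. by move=> fg; apply: eq_big_seq => l /fg ->. Qed.

Definition fpoly s f : {poly R[i]} := \sum_(l <- s) f l *: lagrange_basis s l.

Lemma fpolyE s f l : uniq s -> l \in s -> (fpoly s f).[l%:C] = f l.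
Proof.
move=> us ls.
rewrite horner_sum (big_rem l) //= hornerZ lagrangeE // eqxx mulr1.
rewrite big1_seq ?addr0 // => m /andP[_]; rewrite mem_rem_uniq // inE => /andP[ml ms].
by rewrite hornerZ lagrangeE // (negPf ml) mulr0.
Qed.

Lemma fcalc_fpoly s f x : fcalc s f x = horner_alg x (fpoly s f).
Proof.
rewrite /fpoly raddf_sum; apply: eq_bigr => l _.
by rewrite -horner_algZ.
Qed.

Lemma fcalcM s f g x : annihilates s x ->
  fcalc s f x * fcalc s g x = fcalc s (fun l => f l * g l) x.
Proof.
move=> ann; have [us _] := ann.
rewrite !fcalc_fpoly -rmorphM; apply: (horner_alg_eq ann) => l ls.
by rewrite hornerM !fpolyE.
Qed.

Lemma fcalcD s f g x : fcalc s f x + fcalc s g x = fcalc s (fun l => f l + g l) x.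
Proof. by rewrite -big_split; apply: eq_bigr => l _; rewrite scalerDl. Qed.

Lemma fcalcZ s (c : R[i]) f x : c *: fcalc s f x = fcalc s (fun l => c * f l) x.
Proof. by rewrite scaler_sumr; apply: eq_bigr => l _; rewrite scalerA. Qed.

Lemma mul_eigenproj s l x : annihilates s x -> l \in s ->
  x * eigenproj s l x = l%:C *: eigenproj s l x.
Proof.
move=> ann ls; have [us _] := ann.
rewrite -{1}(horner_algX x) -rmorphM -horner_algZ; apply: (horner_alg_eq ann) => k ks.
rewrite hornerM hornerX hornerZ !lagrangeE //; case: (eqVneq l k) => [->|_] //.
by rewrite !mulr0.
Qed.

Lemma annihilates_sub s s' x : uniq s' -> {subset s <= s'} ->
  annihilates s x -> annihilates s' x.
Proof.
move=> us' ss' [us ann]; split=> //.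
have: node_poly s %| node_poly s'.
  rewrite /node_poly -(big_map (fun l => l%:C) predT (fun z => 'X - z%:P)).
  apply: uniq_roots_dvdp.
    apply/allP => _ /mapP[l ls ->]; rewrite /root horner_prod.
    by rewrite (big_rem l) ?ss' //= hornerXsubC subrr mul0r.
  by rewrite uniq_rootsE map_inj_uniq //; exact: (@complexI R).
by case/dvdpP => k ->; rewrite rmorphM /= ann mulr0.
Qed.

(** For positive invertible x and y this is f(T)(q), where T is the operator z
    |-> x z y^-1; with x and y two densities, T is a relative modular
    operator. *)
Definition ratio_calc s f x q y : W :=
  \sum_(l <- s) \sum_(m <- s) f (l / m) *: (eigenproj s l x * q * eigenproj s m y).

Lemma ratio_calcE s f g h x q y :
    {in s &, forall l m, f (l / m) = g l * h m} ->
  ratio_calc s f x q y = fcalc s g x * q * fcalc s h y.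
Proof.
move=> fgh; rewrite mulr_suml mulr_suml; apply: eq_big_seq => l ls.
rewrite mulr_sumr; apply: eq_big_seq => m ms.
by rewrite fgh // -!scalerAl -scalerAr scalerA.
Qed.

Lemma eq_ratio_calc s f g x q y :
    {in s &, forall l m, f (l / m) = g (l / m)} ->
  ratio_calc s f x q y = ratio_calc s g x q y.
Proof.
by move=> fg; apply: eq_big_seq => l ls; apply: eq_big_seq => m ms; rewrite fg.
Qed.

Definition spanned (T : eqType) (P : set T) (g : T -> R -> R[i]) f (rs : seq R) :=
  exists2 e : seq (R[i] * T), (forall k, k \in e -> P k.2)
    & {in rs, forall r, f r = \sum_(k <- e) k.1 * g k.2 r}.

Definition spanning (T : eqType) (P : set T) (g : T -> R -> R[i]) :=
  forall f (rs : seq R), {in rs, forall r, 0 < r} -> spanned P g f rs.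

Lemma ratio_calc_sum (T : eqType) (g : T -> R -> R[i]) (e : seq (R[i] * T)) s x q y :
  ratio_calc s (fun r => \sum_(k <- e) k.1 * g k.2 r) x q y
    = \sum_(k <- e) k.1 *: ratio_calc s (g k.2) x q y.
Proof.
under [RHS]eq_bigr do rewrite scaler_sumr.
rewrite [RHS]exchange_big; apply: eq_bigr => l _ /=.
under [RHS]eq_bigr do rewrite scaler_sumr.
rewrite [RHS]exchange_big; apply: eq_bigr => m _ /=.
by rewrite scaler_suml; apply: eq_bigr => k _; rewrite scalerA.
Qed.

(** An assertion about ratio_calc that is linear in f and holds for every
    member of a spanning family holds for every f. In this way powers, phases
    and resolvents are exchanged for one another. *)
Lemma spanning_ratio (T : eqType) (P : set T) (g : T -> R -> R[i]) f s :
    spanning P g -> {in s, forall l, 0 < l} ->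
  exists2 e : seq (R[i] * T), (forall k, k \in e -> P k.2)
    & forall x q y, ratio_calc s f x q y
                      = \sum_(k <- e) k.1 *: ratio_calc s (g k.2) x q y.
Proof.
move=> gP s_gt0; have [|e eP fe] := gP f [seq l / m | l <- s, m <- s].
  by move=> _ /allpairsP[[l m] [/= ls ms ->]]; rewrite divr_gt0 ?s_gt0.
exists e => // x q y; rewrite -ratio_calc_sum; apply: eq_ratio_calc => l m ls ms.
by apply: fe; apply/allpairsP; exists (l, m).
Qed.

End FunctionalCalculus.

(** * Families of functions that span all functions on a finite set *)

Lemma interpolation (F : fieldType) (T : eqType) (z f : T -> F) (ts : seq T) :
  {in ts &, injective z} -> exists p : {poly F}, {in ts, forall t, p.[z t] = f t}.
Proof.
elim: ts => [|t ts IH] zI; first by exists 0.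
have [|p pE] := IH; first by move=> u v uts vts; apply: zI; rewrite inE ?uts ?vts orbT.
case: (boolP (t \in ts)) => tts.
  by exists p => u; rewrite inE => /orP[/eqP->|]; apply: pE.
pose w : {poly F} := \prod_(u <- ts) ('X - (z u)%:P).
have wt : w.[z t] != 0.
  rewrite horner_prod prodf_seq_neq0; apply/allP => u uts /=.
  rewrite hornerXsubC subr_eq0; apply: contra tts => /eqP /zI -> //.
    exact: mem_head.
  by rewrite inE uts orbT.
exists (p + ((f t - p.[z t]) / w.[z t]) *: w) => u; rewrite inE hornerD hornerZ.
case/orP => [/eqP->|uts]; first by rewrite divfK // addrC subrK.
have -> : w.[z u] = 0.
  by rewrite horner_prod (big_rem u) //= hornerXsubC subrr mul0r.
by rewrite pE // mulr0 addr0.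
Qed.

Section SpanningFamilies.
Local Open Scope complex_scope.
Variable R : realType.
Implicit Types (f : R -> R[i]) (rs : seq R) (t r : R).

Lemma interpolation_span f rs (z : R -> R[i]) : {in rs &, injective z} ->
  exists e : seq (R[i] * nat), {in rs, forall r, f r = \sum_(k <- e) k.1 * z r ^+ k.2}.
Proof.
move=> /(interpolation f)[p pE].
exists [seq (p`_i, i) | i <- iota 0 (size p)] => r rrs.
rewrite big_map /= -pE // horner_coef -(big_mkord xpredT (fun i => p`_i * z r ^+ i)).
by rewrite /index_iota subn0.
Qed.

Lemma spanning_pow : @spanning R nat setT (fun n r => r%:C ^+ n).
Proof.
move=> f rs _; have [|e eE] := @interpolation_span f rs (fun r => r%:C).
  by move=> r r' _ _ /complexI.
by exists e.
Qed.

Definition unit_phase t r : R[i] := cos (t * ln r) +i* sin (t * ln r).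

Lemma unit_phaseX t r n : unit_phase t r ^+ n = unit_phase (n%:R * t) r.
Proof.
rewrite /unit_phase; elim: n => [|n IH]; first by rewrite expr0 !mul0r cos0 sin0.
rewrite exprS IH -[n.+1]add1n natrD !mulrDl cosD sinD !mul1r.
by apply/eqP; rewrite eq_complex /=; apply/andP; split; apply/eqP; ring.
Qed.

Lemma unit_phase_conj t r : (unit_phase t r)^* = unit_phase (- t) r.
Proof. by rewrite /unit_phase mulNr cosN sinN. Qed.

Lemma unit_phase0 t r : unit_phase 0 r = 1.
Proof. by rewrite /unit_phase mul0r cos0 sin0. Qed.

Lemma unit_phaseD t t' r : unit_phase t r * unit_phase t' r = unit_phase (t + t') r.
Proof.
rewrite /unit_phase mulrDl cosD sinD.
by apply/eqP; rewrite eq_complex /=; apply/andP; split; apply/eqP; ring.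
Qed.

Lemma unit_phase_div t l m : 0 < l -> 0 < m ->
  unit_phase t (l / m) = unit_phase t l * unit_phase (- t) m.
Proof.
move=> l0 m0; rewrite -unit_phase_conj /unit_phase ln_div ?posrE // mulrBr cosB sinB.
by apply/eqP; rewrite eq_complex /=; apply/andP; split; apply/eqP; ring.
Qed.

(** For small h the phases r^(ih) separate finitely many points r, and their
    powers interpolate. *)
Lemma spanning_phase : @spanning R R setT unit_phase.
Proof.
move=> f rs rs0.
(* Then h ln r lies in [-1, 1], where the sine is injective. *)
pose h : R := (1 + \sum_(r <- rs) `|ln r|)^-1.
have h0 : 0 < h by rewrite invr_gt0 ltr_pwDl // sumr_ge0.
have hln r : r \in rs -> `|h * ln r| <= 1.
  move=> rrs; rewrite normrM gtr0_norm // mulrC ler_pdivrMr ?mul1r.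
    rewrite (big_rem r) //= addrCA lerDl addr_ge0 // sumr_ge0 //.
  by rewrite -invr_gt0.
have [|e eE] := @interpolation_span f rs (unit_phase h).
  have pi2 : 1 <= pi / 2 :> R by have := pi_ge2 R; lra.
  move=> r r' rrs r'rs /(congr1 (@complex.Im R)) /= sE.
  have [hr hr'] := (hln _ rrs, hln _ r'rs).
  rewrite !ler_norml in hr hr'.
  have /(mulfI (lt0r_neq0 h0)) : h * ln r = h * ln r'.
    by apply: sin_inj sE; rewrite in_itv /=; lra.
  by apply: ln_inj; rewrite posrE rs0.
exists [seq (k.1, k.2%:R * h) | k <- e] => // r rrs.
by rewrite big_map eE //; apply: eq_bigr => k _; rewrite unit_phaseX.
Qed.

(** Multiplication by (r - u) / (r + t), for a new pole t, maps a combination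
    of resolvents to a combination of resolvents. *)
Lemma partial_fraction (us : seq R) : exists e : seq (R * R), exists2 ts : seq R,
  (forall t, t \in ts -> 0 < t) /\ (forall k, k \in e -> 0 < k.2) &
  forall r, 0 < r -> \sum_(k <- e) k.1 * (r + k.2)^-1
    = \prod_(u <- us) (r - u) / \prod_(t <- ts) (r + t).
Proof.
elim: us => [|u us [e [ts [ts0 e0] eE]]].
  exists [:: (1, 1)], [:: 1]; first by split => ?; rewrite inE => /eqP->.
  by move=> r _; rewrite !big_seq1 big_nil.
(* A pole beyond all the previous ones. *)
pose t := 1 + \sum_(k <- e) k.2.
have t0 : 0 < t.
  by rewrite ltr_pwDl // big_seq sumr_ge0 // => k /e0 /ltW.
have tk k : k \in e -> k.2 < t.
  move=> ke; rewrite /t (big_rem k) //= addrCA ltrDl ltr_pwDl //.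
  by rewrite big_seq sumr_ge0 // => j /mem_rem /e0 /ltW.
pose a (k : R * R) : R := (u + k.2) / (k.2 - t).
exists ([seq (k.1 * a k, k.2) | k <- e] ++ [seq (k.1 * (1 - a k), t) | k <- e]), (t :: ts).
  split; first by move=> v; rewrite inE => /orP[/eqP->|/ts0].
  by move=> k; rewrite mem_cat => /orP[] /mapP[j je ->] //=; apply: e0.
move=> r r0; rewrite big_cat !big_map !big_cons /= -big_split /= invfM mulrACA -eE //.
rewrite mulr_sumr; apply: eq_big_seq => k ke; have := e0 _ ke; have := tk _ ke.
move=> ? ?; rewrite /a; field.
by apply/and3P; split; apply/eqP; lra.
Qed.

(** A combination of resolvents that vanishes at the other points corrects the
    value at one point. *)
Lemma spanning_resolvent :
  @spanning R R [set t | 0 < t] (fun t r => ((r + t)^-1)%:C).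
Proof.
move=> f rs; elim: rs => [|r rs IH] rs0; first by exists [::].
have [|e e0 eE] := IH; first by move=> u urs; apply: rs0; rewrite inE urs orbT.
case: (boolP (r \in rs)) => rrs.
  by exists e => // u; rewrite inE => /orP[/eqP->|]; apply: eE.
have [h [ts [ts0 h0] hE]] := partial_fraction rs.
pose c := \sum_(k <- h) k.1 * (r + k.2)^-1.
have r0 : 0 < r by apply: rs0; apply: mem_head.
have c0 : c != 0.
  rewrite /c hE // mulf_neq0 ?invr_eq0 // prodf_seq_neq0; apply/allP => u urs /=.
    by rewrite subr_eq0; apply: contraNneq rrs => ->.
  by rewrite gt_eqF // addr_gt0 // ts0.
pose b := (f r - \sum_(k <- e) k.1 * ((r + k.2)^-1)%:C) / c%:C.
exists (e ++ [seq (b * k.1%:C, k.2) | k <- h]).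
  by move=> k; rewrite mem_cat => /orP[/e0|/mapP[j /h0 ? ->]].
have hsum u : \sum_(k <- [seq (b * k.1%:C, k.2) | k <- h]) k.1 * ((u + k.2)^-1)%:C
    = b * (\sum_(k <- h) k.1 * (u + k.2)^-1)%:C.
  rewrite big_map raddf_sum mulr_sumr; apply: eq_bigr => k _ /=.
  by rewrite rmorphM mulrA.
move=> u; rewrite inE big_cat hsum => /orP[/eqP->|urs].
  rewrite -/c /b divfK ?fmorph_eq0 //.
  by rewrite [RHS]addrC subrK.
rewrite hE ?rs0 ?inE ?urs ?orbT // -eE // (big_rem u) //= subrr !mul0r mulr0 addr0 //.
Qed.

End SpanningFamilies.

(** * Norm, involution and functional calculus *)

Section CstarNorm.
Local Open Scope complex_scope.
Variables (R : realType) (A : cstarAlgType R).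
Implicit Types (x y : A) (c : R[i]) (B : set A).

Lemma cnormZE c x : cnorm (c *: x) = Normc.normc c * cnorm x.
Proof.
by apply: (@complexI R); rewrite cnormZ rmorphM; congr (_ * _); case: c.
Qed.

Lemma cnorm0 : cnorm (0 : A) = 0.
Proof. by rewrite -(scale0r 0) cnormZE Normc.normc0 mul0r. Qed.

Lemma cnormN x : cnorm (- x) = cnorm x.
Proof. by apply: (@complexI R); rewrite -scaleN1r cnormZ normrN1 mul1r. Qed.

Lemma cnorm_ge0 x : 0 <= cnorm x.
Proof.
by have := ler_cnormD x (- x); rewrite subrr cnorm0 cnormN; lra.
Qed.

Lemma cnormB x y : cnorm (x - y) = cnorm (y - x).
Proof. by rewrite -cnormN opprB. Qed.

Lemma ler_cnorm_sum (T : Type) (r : seq T) (P : pred T) (F : T -> A) :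
  cnorm (\sum_(i <- r | P i) F i) <= \sum_(i <- r | P i) cnorm (F i).
Proof.
elim/big_rec2: _ => [|i u v _ h]; first by rewrite cnorm0.
by apply: le_trans (ler_cnormD _ _) _; rewrite lerD2l.
Qed.

Lemma star0 : star (0 : A) = 0.
Proof. by apply: (addrI (star 0)); rewrite -starD !addr0. Qed.

Lemma star1 : star (1 : A) = 1.
Proof. by rewrite -[RHS]starK -[in RHS](mulr1 (star 1)) starM starK mulr1. Qed.

Lemma starN x : star (- x) = - star x.
Proof. by apply: (addrI (star x)); rewrite -starD !subrr star0. Qed.

Lemma starB x y : star (x - y) = star x - star y.
Proof. by rewrite starD starN. Qed.

Lemma star_sum (T : Type) (r : seq T) (P : pred T) (F : T -> A) :
  star (\sum_(i <- r | P i) F i) = \sum_(i <- r | P i) star (F i).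
Proof. by elim/big_rec2: _ => [|i u v _ <-]; rewrite ?star0 ?starD. Qed.

Lemma cnorm_star x : cnorm (star x) = cnorm x.
Proof.
have h y : cnorm y <= cnorm (star y).
  have [->|y0] := eqVneq (cnorm y) 0; first exact: cnorm_ge0.
  have y_gt0 : 0 < cnorm y by rewrite lt_def y0 cnorm_ge0.
  by rewrite -(ler_pM2r y_gt0) -expr2 -cstar_identity ler_cnormM.
by apply/eqP; rewrite eq_le h -{2}(starK x) h.
Qed.

Lemma cnorm_lim_eq x y : (forall e : R, 0 < e -> cnorm (x - y) <= e) -> x = y.
Proof.
move=> h; apply/eqP; rewrite -subr_eq0; apply/eqP/cnorm0_eq0.
apply/eqP; rewrite eq_le cnorm_ge0 andbT.
by apply/ler_addgt0Pl => e e0; rewrite addr0 h.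
Qed.

Lemma spectrum_annihilates s x l : annihilates s x -> spectrum x l%:C -> l \in s.
Proof.
move=> ann; apply: contra_notT => ls.
pose f (m : R) : R[i] := m%:C - l%:C.
have xE : x - (l%:C)%:A = fcalc s f x.
  rewrite -{1}(fcalc_id ann) -(fcalc1 ann) fcalcZ -scaleN1r fcalcZ fcalcD.
  by apply: eq_fcalc => m _; rewrite mulr1 mulN1r.
exists (fcalc s (fun m => (f m)^-1) x).
rewrite xE !fcalcM // -(fcalc1 ann).
by split; apply: eq_fcalc => m ms; rewrite ?mulVf ?mulfV //;
  rewrite subr_eq0 (inj_eq (@complexI R)); apply: contraNneq ls => <-.
Qed.

Lemma eigenproj_out s x l : annihilates s x -> l \in s -> ~ spectrum x l%:C ->
  eigenproj s l x = 0.
Proof.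
move=> ann ls /contrapT [y [_ yx]].
rewrite -[LHS]mul1r -yx -mulrA mulrBl mul_eigenproj // mulr_algl subrr mulr0 //.
Qed.

(** Uniqueness of the limit defining the functional calculus: polynomials
    that are close to f on the spectrum differ, at x, by a small combination of
    the finitely many spectral projections. *)
Lemma cfc_fcalc s f x : annihilates s x -> cfc f x = fcalc s f x.
Proof.
move=> ann; have [us _] := ann.
have Pf : is_cfc f x (fcalc s f x).
  move=> e e0; exists (fpoly s f) => [l /(spectrum_annihilates ann) ls|].
    by rewrite fpolyE // subrr normr0 lecR ltW.
  by rewrite -fcalc_fpoly subrr cnorm0 ltW.
rewrite /cfc; case: xgetP => [y _ /= yP|/(_ (fcalc s f x))] //.
pose K := \sum_(l <- s) cnorm (eigenproj s l x).
have K0 : 0 <= K by apply: sumr_ge0 => l _; apply: cnorm_ge0.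
apply: cnorm_lim_eq => e e0.
have [p pf py] := yP (e / (1 + K)) (divr_gt0 e0 (ltr_pwDl ltr01 K0)).
have -> : y - fcalc s f x = (y - horner_alg x p) + (horner_alg x p - fcalc s f x).
  by rewrite addrA subrK.
apply: le_trans (ler_cnormD _ _) _; rewrite cnormB.
apply: (@le_trans _ _ (e / (1 + K) + e / (1 + K) * K)); last first.
  by rewrite -[X in X + _]mulr1 -mulrDr divfK // gt_eqF // ltr_pwDl.
apply: lerD => //; rewrite (horner_alg_fcalc _ ann) -scaleN1r fcalcZ fcalcD.
apply: le_trans (ler_cnorm_sum _ _ _) _.
rewrite mulr_sumr big_seq [leRHS]big_seq; apply: ler_sum => l ls.
have [spl|/(eigenproj_out ann ls) ->] := pselect (spectrum x l%:C); last first.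
  by rewrite scaler0 cnorm0 mulr0.
rewrite cnormZE ler_wpM2r ?cnorm_ge0 // mulN1r.
by have := pf _ spl; rewrite -lecR; case: (_ - _).
Qed.

End CstarNorm.

(** * Spectral theory in finite dimension *)

Section StarAlgebras.
Local Open Scope complex_scope.
Variables (R : realType) (W : algType R[i]).

Record star_operation (st : W -> W) : Prop := StarOperation {
  sopK : involutive st ;
  sopD : forall x y, st (x + y) = st x + st y ;
  sopZ : forall (c : R[i]) x, st (c *: x) = c^* *: st x ;
  sopM : forall x y, st (x * y) = st y * st x
}.

(** A faithful positive functional takes the place of the norm, so that the
    record applies to finite-dimensional subalgebras of a C*-algebra and to
    the matrices over them alike. *)
Record findim_star_subalgebra (st : W -> W) (B : set W) (Phi : W -> R[i]) : Prop :=
  FindimStarSubalgebra {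
  fs_star : star_operation st ;
  fs1 : B 1 ;
  fsD : forall x y, B x -> B y -> B (x + y) ;
  fsZ : forall (c : R[i]) x, B x -> B (c *: x) ;
  fsM : forall x y, B x -> B y -> B (x * y) ;
  fs_st : forall x, B x -> B (st x) ;
  fs_span : exists n (e : 'I_n -> W), forall x, B x ->
    exists c : 'I_n -> R[i], x = \sum_i c i *: e i ;
  fs_PhiD : forall x y, Phi (x + y) = Phi x + Phi y ;
  fs_PhiZ : forall (c : R[i]) x, Phi (c *: x) = c * Phi x ;
  fs_ge0 : forall x, B x -> 0 <= Phi (st x * x) ;
  fs_faithful : forall x, B x -> Phi (st x * x) = 0 -> x = 0
}.

Section StarOperation.
Variables (st : W -> W) (hst : star_operation st).

Lemma sop0 : st 0 = 0.
Proof. by apply: (addrI (st 0)); rewrite -(sopD hst) !addr0. Qed.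

Lemma sop1 : st 1 = 1.
Proof.
by rewrite -[RHS](sopK hst) -[in RHS](mulr1 (st 1)) (sopM hst) (sopK hst) mulr1.
Qed.

Lemma sop_sum (T : Type) (r : seq T) (P : pred T) (F : T -> W) :
  st (\sum_(i <- r | P i) F i) = \sum_(i <- r | P i) st (F i).
Proof. by elim/big_rec2: _ => [|i u v _ <-]; rewrite ?sop0 ?(sopD hst). Qed.

Lemma sop_horner x (p : {poly R[i]}) : st x = x ->
  st (horner_alg x p) = horner_alg x (map_poly conjc p).
Proof.
move=> sx; elim/poly_ind: p => [|p c IH]; first by rewrite !rmorph0 sop0.
rewrite !(rmorphD, rmorphM) /= map_polyX map_polyC /= !horner_algC horner_algX.
rewrite (sopD hst) (sopM hst) IH sx (sopZ hst) sop1; congr (_ + _).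
by rewrite -{1 4}(horner_algX x) -!rmorphM mulrC.
Qed.

Lemma sop_eigenproj s l x : st x = x -> st (eigenproj s l x) = eigenproj s l x.
Proof.
move=> sx; rewrite /eigenproj sop_horner //; congr horner_alg.
rewrite /lagrange_basis rmorph_prod; apply: eq_bigr => m _ /=.
rewrite -!mul_polyC rmorphM rmorphB /= !map_polyC map_polyX /=.
by rewrite oppr0.
Qed.

Lemma sop_fcalc s f x : st x = x ->
  st (fcalc s f x) = fcalc s (fun l => (f l)^*) x.
Proof.
by move=> sx; rewrite sop_sum; apply: eq_bigr => l _; rewrite (sopZ hst) sop_eigenproj.
Qed.

End StarOperation.

Section Spectral.
Variables (st : W -> W) (B : set W) (Phi : W -> R[i]).
Hypothesis hB : findim_star_subalgebra st B Phi.
Let hst : star_operation st := fs_star hB.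

Lemma fs0 : B 0.
Proof. by rewrite -(scale0r 1); apply: (fsZ hB); apply: (fs1 hB). Qed.

Lemma fsN x : B x -> B (- x).
Proof. by move=> Bx; rewrite -scaleN1r; apply: (fsZ hB). Qed.

Lemma fs_horner x p : B x -> B (horner_alg x p).
Proof.
move=> Bx; elim/poly_ind: p => [|p c IH]; first by rewrite rmorph0; apply: fs0.
rewrite rmorphD rmorphM /= horner_algX horner_algC.
by apply: (fsD hB); [apply: (fsM hB) | apply: (fsZ hB); apply: (fs1 hB)].
Qed.

Lemma fs_fcalc x s f : B x -> B (fcalc s f x).
Proof. by move=> Bx; rewrite fcalc_fpoly; apply: fs_horner. Qed.

Lemma fs_Phi0 : Phi 0 = 0.
Proof. by rewrite -(scale0r 0) (fs_PhiZ hB) mul0r. Qed.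

Lemma fs_gt0 x : B x -> x != 0 -> 0 < Phi (st x * x).
Proof.
move=> Bx x0; rewrite lt_def (fs_ge0 hB) // andbT.
by apply: contraNneq x0 => /(fs_faithful hB Bx) ->.
Qed.

Lemma annihilating_poly x : B x -> exists2 p : {poly R[i]}, p != 0 & horner_alg x p = 0.
Proof.
move=> Bx; have [n [e eP]] := fs_span hB.
have /boolp.choice[c cE] : forall i : 'I_n.+1, exists c : 'I_n -> R[i],
    x ^+ i = \sum_j c j *: e j.
  move=> i; apply: eP; rewrite -(horner_algX x) -rmorphXn; exact: fs_horner.
pose M : 'M[R[i]]_(n.+1, n) := \matrix_(i, j) c i j.
have /rowV0Pn[v /sub_kermxP vM v0] : kermx M != 0.
  rewrite -mxrank_eq0 mxrank_ker subn_eq0 -ltnNge ltnS; exact: rank_leq_col.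
exists (rVpoly v).
  by apply: contraNneq v0 => h; rewrite -[v]rVpolyK h linear0.
rewrite [rVpoly v]poly_def (big_morph _ (raddfD (horner_alg x)) (rmorph0 (horner_alg x))).
transitivity (\sum_(i < n.+1) v 0 i *: x ^+ i).
  apply: eq_bigr => i _; by rewrite /= horner_algZ rmorphXn /= horner_algX valK.
under eq_bigr do rewrite cE scaler_sumr.
rewrite exchange_big /= big1 // => j _.
have vMj : \sum_i v 0 i * c i j = 0.
  by have /matrixP/(_ 0 j) := vM; rewrite !mxE; under eq_bigr do rewrite mxE.
under eq_bigr do rewrite scalerA.
by rewrite -scaler_suml vMj scale0r.
Qed.

Lemma selfadjoint_eigenvalue_real (x y : W) (z : R[i]) : st x = x -> B y -> y != 0 ->
  x * y = z *: y -> z^* = z.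
Proof.
move=> sx By y0 xy.
have yy := gt_eqF (fs_gt0 By y0).
have e1 : z *: (st y * y) = st y * x * y by rewrite -mulrA xy scalerAr.
have : z^* *: (st y * y) = z *: (st y * y).
  have := congr1 st e1; rewrite (sopZ hst) !(sopM hst) sx (sopK hst) => ->.
  by rewrite e1 mulrA.
move/(congr1 Phi); rewrite !(fs_PhiZ hB) => /mulIf; apply.
by rewrite yy.
Qed.

Lemma eigenvalue_Phi (x y : W) (l : R[i]) : x * y = l *: y ->
  Phi (st y * (x * y)) = l * Phi (st y * y).
Proof. by move=> ->; rewrite -scalerAr (fs_PhiZ hB). Qed.

Lemma eigenvalue_ge0 (x y : W) (l : R) : B y -> y != 0 -> x * y = l%:C *: y ->
  0 <= Phi (st y * (x * y)) -> 0 <= l.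
Proof.
move=> By y0 /eigenvalue_Phi ->.
by rewrite pmulr_lge0 ?ler0c // fs_gt0.
Qed.

(** A minimal product of linear factors killing a self-adjoint x has only
    simple real roots: dropping one factor leaves an eigenvector, and a double
    root would give v <> 0 with star v * v = 0. *)
Lemma spectral_theorem x : B x -> st x = x -> exists2 s, annihilates s x &
  {in s, forall l, exists y, [/\ B y, y != 0 & x * y = l%:C *: y]}.
Proof.
move=> Bx sx.
pose pr (zs : seq R[i]) := horner_alg x (\prod_(z <- zs) ('X - z%:P)).
have Bpr zs : B (pr zs) by apply: fs_horner.
have pr_rem z zs : z \in zs -> pr zs = (x - z%:A) * pr (rem z zs).
  move=> zzs; rewrite /pr (big_rem z) //= rmorphM rmorphB /=.
  by rewrite horner_algX horner_algC.
have [zs zs0] : exists zs, pr zs = 0.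
  have [p p0 px] := annihilating_poly Bx.
  have [zs pE] := closed_field_poly_normal p.
  exists zs; have : lead_coef p *: pr zs = 0.
    by rewrite -px [in RHS]pE -mul_polyC rmorphM /= horner_algC mulr_algl.
  by move/eqP; rewrite scaler_eq0 lead_coef_eq0 (negPf p0) => /eqP.
have [n] := ubnP (size zs); elim: n zs zs0 => // n IH zs zs0 /ltnSE szs.
have [[z zzs /eqP rz0]|min] := pselect (exists2 z, z \in zs & pr (rem z zs) == 0).
  apply: IH rz0 _; rewrite size_rem //; case: zs zzs szs {zs0} => //=.
have min_neq0 z : z \in zs -> pr (rem z zs) != 0.
  by move=> zzs; apply/negP => h; apply: min; exists z.
have eig z : z \in zs -> x * pr (rem z zs) = z *: pr (rem z zs).
  move=> zzs; apply/eqP; rewrite -subr_eq0 -[z *: _]mulr_algl -mulrBl -pr_rem //.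
  exact/eqP.
have zreal z : z \in zs -> z^* = z.
  move=> zzs; apply: (selfadjoint_eigenvalue_real sx (Bpr (rem z zs))); first exact: min_neq0.
  exact: eig.
have zRe z : z \in zs -> (complex.Re z)%:C = z.
  by case: z => u v /zreal [] /eqP; rewrite eq_sym -addr_eq0 -mulr2n mulrn_eq0 => /eqP ->.
have uzs : uniq zs.
  apply: count_mem_uniq => z; case: (boolP (z \in zs)) => zzs; last exact/count_memPn.
  rewrite (permP (perm_to_rem zzs)) /= eqxx.
  suff /count_memPn -> : z \notin rem z zs by [].
  apply/negP => zr; have := min_neq0 _ zzs; rewrite (pr_rem _ _ zr).
  set y := pr _; set v := _ * y => v0.
  have xv : (x - z%:A) * v = 0 by rewrite /v /y -(pr_rem z (rem z zs) zr) -(pr_rem z zs zzs).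
  have By : B v by rewrite /v /y -(pr_rem z (rem z zs) zr); apply: Bpr.
  move/eqP: v0; apply; apply: (fs_faithful hB By).
  have sxz : st (x - z%:A) = x - z%:A.
    rewrite (sopD hst) sx -[in LHS]scaleNr (sopZ hst) (sop1 hst) -scaleNr.
    congr (_ + _ *: 1); rewrite -[in RHS](zreal z zzs).
    exact: (raddfN (@conjc R) z).
  by rewrite {1}/v (sopM hst) sxz -mulrA xv mulr0 fs_Phi0.
pose s := [seq complex.Re z | z <- zs].
exists s.
  split.
    rewrite map_inj_in_uniq // => z1 z2 h1 h2 e; by rewrite -(zRe _ h1) e zRe.
  rewrite /node_poly big_map -[RHS]zs0; congr horner_alg.
  by apply: eq_big_seq => z /zRe ->.
move=> _ /mapP[z zzs ->]; exists (pr (rem z zs)).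
by split; [exact: Bpr | exact: min_neq0 | rewrite zRe // eig].
Qed.

Lemma fs_sqrt x s : B x -> st x = x -> annihilates s x -> {in s, forall l, 0 <= l} ->
  let c := fcalc s (fun l => (Num.sqrt l)%:C) x in [/\ B c, st c = c & c * c = x].
Proof.
move=> Bx sx ann s0; split; first exact: fs_fcalc.
  by rewrite (sop_fcalc hst) //; apply: eq_fcalc => l _; rewrite /= oppr0.
rewrite fcalcM // -[RHS](fcalc_id ann); apply: eq_fcalc => l ls.
by rewrite -rmorphM -expr2 sqr_sqrtr ?s0.
Qed.

(** A self-adjoint contraction is the real part of the unitary
    x + i sqrt(1 - x^2). *)
Lemma fs_unitary x s : B x -> st x = x -> annihilates s x ->
    {in s, forall l, `|l| <= 1} ->
  exists u, [/\ B u, st u * u = 1, u * st u = 1 & x = 2^-1 *: (u + st u)].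
Proof.
move=> Bx sx ann s1; pose f l : R[i] := l +i* Num.sqrt (1 - l ^+ 2).
have ff l : l \in s -> (f l)^* * f l = 1.
  move=> /s1 l1; apply/eqP; rewrite eq_complex /=.
  have h : Num.sqrt (1 - l ^+ 2) ^+ 2 = 1 - l ^+ 2.
    by rewrite sqr_sqrtr // subr_ge0 -real_normK ?num_real // expr_le1.
  by apply/andP; split; apply/eqP; [move: h; rewrite !expr2 => h; nra | ring].
exists (fcalc s f x); rewrite (sop_fcalc hst) //; split; first exact: fs_fcalc.
- by rewrite fcalcM // -(fcalc1 ann); apply: eq_fcalc => l /ff.
- by rewrite fcalcM // -(fcalc1 ann); apply: eq_fcalc => l /ff; rewrite mulrC.
rewrite fcalcD fcalcZ -[LHS](fcalc_id ann); apply: eq_fcalc => l _.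
apply/eqP; rewrite /f addcJ mulrA mulVf ?mul1r //.
Qed.

End Spectral.
End StarAlgebras.

(** * Convergence and bounded maps *)

Section CstarLimits.
Local Open Scope complex_scope.
Variables (R : realType) (A : cstarAlgType R).
Implicit Types (x y a b h : A) (c : R[i]) (u v : nat -> A) (B : set A).

Lemma starZE c x : star (c *: x) = (conjc c) *: star x.
Proof. exact: starZ. Qed.

Lemma half_real : 2^-1 = (2^-1 : R)%:C :> R[i].
Proof. by rewrite fmorphV rmorph_nat. Qed.

Lemma conjc_i : conjc ('i : R[i]) = - 'i.
Proof. by apply/eqP; rewrite eq_complex /= oppr0 !eqxx. Qed.

Lemma mul_i_i : 'i * 'i = -1 :> R[i].
Proof. by apply/eqP; rewrite eq_complex /= !mulr0 !mul0r mulr1 sub0r addr0 oppr0 !eqxx. Qed.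

Lemma conjc_half : conjc (2^-1 : R[i]) = 2^-1.
Proof. by rewrite half_real conjc_real. Qed.

Lemma normc_ge0_real (r : R) : 0 <= r -> Normc.normc r%:C = r.
Proof.
by move=> r0; apply: (@complexI R); rewrite -[LHS]/(`|r%:C|) ger0_norm // ler0c.
Qed.

Lemma normc_half : Normc.normc (2^-1 : R[i]) = 2^-1.
Proof. by rewrite half_real normc_ge0_real ?invr_ge0. Qed.

Lemma half_scale_double x : 2^-1 *: (x + x) = x.
Proof.
have -> : x + x = (2 : R[i]) *: x by rewrite -[2]/(1 + 1 : R[i]) scalerDl scale1r.
by rewrite scalerA mulVf ?scale1r // pnatr_eq0.
Qed.

Definition tends u x := forall e : R, 0 < e -> exists N, forall n,
  (N <= n)%N -> cnorm (u n - x) < e.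

Lemma tends_cst x : tends (fun=> x) x.
Proof. by move=> e e0; exists 0%N => n _; rewrite subrr cnorm0. Qed.

Lemma tends_le u x (f : nat -> R) (K : R) : 0 <= K ->
    (forall n, cnorm (u n - x) <= K * f n) ->
    (forall e, 0 < e -> exists N, forall n, (N <= n)%N -> f n < e) -> tends u x.
Proof.
move=> K0 uf f0 e e0; have K1 : 0 < 1 + K by rewrite ltr_pwDl.
have [N NP] := f0 (e / (1 + K)) (divr_gt0 e0 K1).
exists N => n /NP; rewrite ltr_pdivlMr // => fe.
apply: le_lt_trans (uf n) _.
have := le_trans (cnorm_ge0 _) (uf n).
have [fn0|fn0] := lerP 0 (f n); first by nra.
by nra.
Qed.

Lemma tends_unique u x y : tends u x -> tends u y -> x = y.
Proof.
move=> ux uy; apply: cnorm_lim_eq => e e0.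
have e2 : 0 < e / 2 by rewrite divr_gt0.
have [N NP] := ux _ e2; have [M MP] := uy _ e2.
have := NP _ (leq_maxl N M); have := MP _ (leq_maxr N M).
have := ler_cnormD (x - u (maxn N M)) (u (maxn N M) - y).
by rewrite subrKA (cnormB x); lra.
Qed.

Lemma tendsD u v x y : tends u x -> tends v y -> tends (fun n => u n + v n) (x + y).
Proof.
move=> ux vy e e0; have e2 : 0 < e / 2 by rewrite divr_gt0.
have [N NP] := ux _ e2; have [M MP] := vy _ e2.
exists (maxn N M) => n; rewrite geq_max => /andP[/NP h1 /MP h2].
rewrite opprD addrACA; apply: le_lt_trans (ler_cnormD _ _) _; lra.
Qed.

Lemma tends_bounded (f : A -> A) (K : R) u x : 0 <= K ->
    (forall y z, f (y - z) = f y - f z) -> (forall y, cnorm (f y) <= K * cnorm y) ->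
  tends u x -> tends (f \o u) (f x).
Proof.
move=> K0 fB fK ux; apply: (tends_le K0 (f := fun n => cnorm (u n - x))) => // n.
by rewrite /= -fB fK.
Qed.

Lemma tendsMl a u x : tends u x -> tends (fun n => a * u n) (a * x).
Proof.
apply: (@tends_bounded ( *%R a) (cnorm a)) => [|y z|y]; first exact: cnorm_ge0.
  exact: mulrBr.
exact: ler_cnormM.
Qed.

Lemma tendsMr a u x : tends u x -> tends (fun n => u n * a) (x * a).
Proof.
apply: (@tends_bounded ( *%R^~ a) (cnorm a)) => [|y z|y]; first exact: cnorm_ge0.
  exact: mulrBl.
by rewrite mulrC ler_cnormM.
Qed.

Lemma tendsZ c u x : tends u x -> tends (fun n => c *: u n) (c *: x).
Proof.
apply: (@tends_bounded ( *:%R c) (Normc.normc c)) => [|y z|y].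
- by case: c => c1 c2; apply: sqrtr_ge0.
- exact: scalerBr.
by rewrite cnormZE.
Qed.

Lemma tends_star u x : tends u x -> tends (fun n => star (u n)) (star x).
Proof.
apply: (@tends_bounded (@star R A) 1) => // [y z|y]; first exact: starB.
by rewrite cnorm_star mul1r.
Qed.

Lemma tendsM u v x y : tends u x -> tends v y -> tends (fun n => u n * v n) (x * y).
Proof.
move=> ux vy e e0.
pose d := Num.min 1 (e / (1 + cnorm x + cnorm y)).
have [x0 y0] := (cnorm_ge0 x, cnorm_ge0 y).
have D0 : 0 < 1 + cnorm x + cnorm y by lra.
have d0 : 0 < d by rewrite lt_min ltr01 divr_gt0.
have [N NP] := ux _ d0; have [M MP] := vy _ d0.
exists (maxn N M) => n; rewrite geq_max => /andP[/NP h1 /MP h2].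
have -> : u n * v n - x * y = (u n - x) * (v n - y) + ((u n - x) * y + x * (v n - y)).
  by rewrite mulrBr addrA subrK mulrBr mulrBl addrA subrK.
have dle : d * (1 + cnorm x + cnorm y) <= e.
  by rewrite -ler_pdivlMr // ge_min lexx orbT.
have d1 : d <= 1 by rewrite ge_min lexx.
apply: le_lt_trans (ler_cnormD _ _) _.
have := ler_cnormD ((u n - x) * y) (x * (v n - y)).
have := ler_cnormM (u n - x) y; have := ler_cnormM x (v n - y).
have := ler_cnormM (u n - x) (v n - y).
have := cnorm_ge0 (u n - x); have := cnorm_ge0 (v n - y).
move: (cnorm (u n - x)) (cnorm (v n - y)) (cnorm (_ * _)) (cnorm (_ * _)) (cnorm (_ * _)) h1 h2.
move=> p q r s t pd qd q0 p0 rpq sxq tpy; nra.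
Qed.

Lemma tends_sum (T : Type) (r : seq T) (F : T -> nat -> A) (G : T -> A) :
  (forall i, tends (F i) (G i)) ->
  tends (fun n => \sum_(i <- r) F i n) (\sum_(i <- r) G i).
Proof.
move=> FG; elim: r => [|i r IH].
  rewrite big_nil => e e0; exists 0%N => n _; rewrite big_nil subrr cnorm0 //.
rewrite big_cons => e e0; have [N NP] := tendsD (FG i) IH e0.
by exists N => n /NP; rewrite big_cons.
Qed.

Lemma tends_shift u x : tends u x -> tends (fun n => u n.+1) x.
Proof. by move=> ux e /ux[N NP]; exists N => n Nn; apply/NP/leqW. Qed.

Lemma exists_half_pow_lt (e : R) : 0 < e -> exists N, forall n, (N <= n)%N -> 2^-1 ^+ n < e.
Proof.
move=> e0; exists (Num.truncn e^-1).+1 => n Nn.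
rewrite exprVn -[ltRHS]invrK ltf_pV2 ?posrE ?exprn_gt0 ?invr_gt0 //.
apply: lt_le_trans (truncnS_gt _) _; rewrite -natrX ler_nat.
by apply: leq_trans Nn (ltnW (ltn_expl _ _)).
Qed.

Lemma cstar_closed_tends B u x : cstar_closed B -> (forall n, B (u n)) -> tends u x -> B x.
Proof.
move=> cB Bu ux; apply: cB => e /ux[N NP]; exists (u N) => //.
by rewrite cnormB NP.
Qed.

Lemma tends_approx B x : (forall e : R, 0 < e -> exists2 y, B y & cnorm (x - y) < e) ->
  exists2 u, (forall n, B (u n)) & tends u x.
Proof.
move=> h; have /boolp.choice[u uP] : forall n : nat, exists y, B y /\ cnorm (x - y) < 2^-1 ^+ n.
  by move=> n; have [|y] := h (2^-1 ^+ n); [rewrite exprn_gt0 | exists y].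
exists u => [n|]; first by have [] := uP n.
apply: (tends_le (f := fun n => 2^-1 ^+ n) ler01) => [n|]; last exact: exists_half_pow_lt.
by rewrite mul1r cnormB ltW //; have [] := uP n.
Qed.

Lemma tends_geometric u : (forall n, cnorm (u n.+1 - u n) <= 2^-1 ^+ n) ->
  exists x, tends u x.
Proof.
move=> hu.
have ucauchy m n : cnorm (u (m + n)%N - u m) <= 2 * 2^-1 ^+ m - 2 * 2^-1 ^+ (m + n).
  elim: n => [|n IH]; first by rewrite addn0 !subrr cnorm0.
  have := ler_cnormD (u (m + n).+1 - u (m + n)%N) (u (m + n)%N - u m).
  rewrite subrKA addnS => /le_trans; apply.
  have := hu (m + n)%N; rewrite exprS; lra.
apply: cnorm_complete => e e0.
have [N NP] := exists_half_pow_lt (divr_gt0 e0 (ltr0Sn R 3)).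
have small n : (N <= n)%N -> cnorm (u n - u N) < e / 2.
  move=> /subnKC <-; apply: le_lt_trans (ucauchy _ _) _.
  have := NP _ (leqnn N); have : 0 <= 2^-1 ^+ (N + (n - N)) :> R by rewrite exprn_ge0.
  lra.
exists N => m n /small h1 /small h2.
have := ler_cnormD (u m - u N) (u N - u n); rewrite subrKA (cnormB (u N)); lra.
Qed.

(** The iteration y <- (a + y^2)/2 is a contraction near 0 and its fixed point
    satisfies (1 - y)^2 = 1 - a. *)
Lemma cstar_sqrt a : star a = a -> cnorm a <= 2^-1 ->
  exists b, [/\ star b = b, b * b = 1 - a & forall x, a * x = x * a -> b * x = x * b].
Proof.
move=> sa a2.
pose u := fix u n := if n is n'.+1 then 2^-1 *: (a + u n' * u n') else 0 : A.
have n2 := normc_half.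
have un n : cnorm (u n) <= 2^-1.
  elim: n => [|n IH] /=; first by rewrite cnorm0 invr_ge0.
  rewrite cnormZE n2; have := ler_cnormD a (u n * u n); have := ler_cnormM (u n) (u n).
  have := cnorm_ge0 (u n); nra.
have du n : cnorm (u n.+1 - u n) <= 2^-1 ^+ n.
  elim: n => [|n IH]; first by rewrite /= mulr0 addr0 subr0 cnormZE n2 expr0; lra.
  rewrite [u n.+2]/= [u n.+1 in X in cnorm (_ - X)]/= -scalerBr cnormZE n2 opprD addrACA subrr add0r.
  have -> : u n.+1 * u n.+1 - u n * u n = u n.+1 * (u n.+1 - u n) + (u n.+1 - u n) * u n.
    by rewrite mulrBr mulrBl addrA subrK.
  have := ler_cnormD (u n.+1 * (u n.+1 - u n)) ((u n.+1 - u n) * u n).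
  have := ler_cnormM (u n.+1) (u n.+1 - u n); have := ler_cnormM (u n.+1 - u n) (u n).
  have := un n.+1; have := un n; have := cnorm_ge0 (u n.+1 - u n); rewrite exprS; nra.
have [y uy] := tends_geometric du.
have yE : y = 2^-1 *: (a + y * y).
  apply: (tends_unique (tends_shift uy)).
  exact: (tendsZ 2^-1 (tendsD (tends_cst a) (tendsM uy uy))).
exists (1 - y); split.
- rewrite starB star1; congr (_ - _); apply: (tends_unique _ uy).
  have := tends_star uy; congr tends; apply: funext => n.
  elim: n => [|n IH] /=; first exact: star0.
  by rewrite starZE starD starM IH sa conjc_half.
- rewrite mulrBl mul1r mulrBr mulr1.
  have -> : y * y = 2 *: y - a by rewrite [in X in _ *: X]yE scalerA divff ?pnatr_eq0 // scale1r addrC addKr.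
  by rewrite scaler_nat mulr2n opprB [_ - a - y]addrAC addrK addrA subrK.
- move=> x ax; rewrite mulrBl mulrBr mul1r mulr1; congr (_ - _).
  apply: (tends_unique (tendsMr x uy)); have := tendsMl x uy; congr tends.
  apply: funext => n; elim: n => [|n IH] /=; first by rewrite mul0r mulr0.
  by rewrite -scalerAl -scalerAr mulrDl mulrDr ax mulrA IH -mulrA IH mulrA.
Qed.

Lemma cnorm1_le : cnorm (1 : A) <= 1.
Proof.
have := cstar_identity (1 : A); rewrite star1 mul1r expr2 => h.
by have := cnorm_ge0 (1 : A); nra.
Qed.

Lemma cnorm_unitary x : star x * x = 1 -> cnorm x <= 1.
Proof.
move=> xx; have := cstar_identity x; rewrite xx => h.
by have := cnorm1_le; rewrite h expr_le1 ?cnorm_ge0.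
Qed.

(** Twice the real part and twice the imaginary part of x have norm at most
    twice the norm of x, which gives the factor 4. *)
Lemma selfadjoint_bounded (N : A -> R) :
    (forall x y, N (x + y) <= N x + N y) -> (forall c x, N (c *: x) = Normc.normc c * N x) ->
    (forall h, star h = h -> cnorm h <= 2^-1 -> N h <= 1) ->
  forall x, N x <= 4 * cnorm x.
Proof.
move=> ND NZ Nh.
have Nsa h : star h = h -> N h <= 2 * cnorm h.
  move=> sh; have [->|h0] := eqVneq h 0.
    by rewrite cnorm0 mulr0 -(scale0r 0) NZ Normc.normc0 mul0r.
  have h_gt0 : 0 < cnorm h.
    by rewrite lt_def cnorm_ge0 andbT; apply: contraNneq h0 => /cnorm0_eq0 ->.
  have k0 : 0 < (2 * cnorm h)^-1 by rewrite invr_gt0 mulr_gt0.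
  have := Nh (((2 * cnorm h)^-1)%:C *: h); rewrite starZE sh conjc_real cnormZE NZ.
  rewrite !(normc_ge0_real (ltW k0)) invfM -mulrA mulVf ?gt_eqF // mulr1 => /(_ erefl (lexx _)).
  by rewrite -mulrA ler_pdivrMl // mulr1 ler_pdivrMl // mulrC.
move=> x.
have normi : Normc.normc ('i : R[i]) = 1 by rewrite /= expr0n expr1n add0r sqrtr1.
have Nsk k : star k = - k -> N k <= 2 * cnorm k.
  move=> sk; have := Nsa ('i *: k); rewrite NZ cnormZE normi !mul1r; apply.
  by rewrite starZE sk conjc_i scalerN scaleNr opprK.
have xE : x = 2^-1 *: ((x + star x) + (x - star x)).
  by rewrite addrACA subrr addr0 half_scale_double.
rewrite xE NZ normc_half -xE.
have h1 : N (x + star x) <= 2 * cnorm (x + star x).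
  by apply: Nsa; rewrite starD starK addrC.
have h2 : N (x - star x) <= 2 * cnorm (x - star x).
  by apply: Nsk; rewrite starB starK opprB.
have := ND (x + star x) (x - star x); have := ler_cnormD x (star x).
have := ler_cnormD x (- star x); rewrite cnormN cnorm_star; lra.
Qed.

(** A self-adjoint h of norm at most 1/2 is the real part of the unitary h + i
    sqrt(1 - h^2), and unitaries have norm at most 1. *)
Lemma star_automorphism_bounded (f : {lrmorphism A -> A}) :
  (forall x, f (star x) = star (f x)) -> forall x, cnorm (f x) <= 4 * cnorm x.
Proof.
move=> fs; apply: (selfadjoint_bounded (N := fun x => cnorm (f x))) => [x y|c x|h sh h2].
- by rewrite rmorphD ler_cnormD.
- by rewrite linearZ /= cnormZE.
have hh : cnorm (h * h) <= 2^-1.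
  by have := ler_cnormM h h; have := cnorm_ge0 h; nra.
have shh : star (h * h) = h * h by rewrite starM sh.
have [b [sb bb bc]] := cstar_sqrt shh hh.
have bh : b * h = h * b by apply: bc; rewrite mulrA.
pose u := h + 'i *: b.
have su : star u = h - 'i *: b by rewrite /u starD sh starZE sb conjc_i scaleNr.
have uu : star u * u = 1.
  rewrite su /u mulrDr mulrBl mulrBl -!scalerAl -!scalerAr scalerA mul_i_i scaleN1r.
  by rewrite bb opprK bh addrA subrK addrC subrK.
have fu : cnorm (f u) <= 1 by apply: cnorm_unitary; rewrite -fs -rmorphM uu rmorph1.
have hE : h = 2^-1 *: (star u + u).
  by rewrite su /u addrACA addNr addr0 half_scale_double.
rewrite hE linearZ /= cnormZE normc_half.
have -> : f (star u + u) = star (f u) + f u by rewrite rmorphD /= fs.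
have := ler_cnormD (star (f u)) (f u); rewrite cnorm_star; lra.
Qed.

(** For a self-adjoint h of norm at most 1/2, both 1 - h and 1 + h are
    squares. *)
Lemma state_bounded (phi : {scalar A}) : state phi ->
  forall x, Normc.normc (phi x) <= 4 * cnorm x.
Proof.
move=> [phi0 phi1]; apply: (selfadjoint_bounded (N := fun x => Normc.normc (phi x))) => [x y|c x|h sh h2].
- by rewrite raddfD; have := ler_normD (phi x) (phi y); rewrite -lecR rmorphD.
- by rewrite linearZ /= Normc.normcM.
have pos k : star k = k -> cnorm k <= 2^-1 -> 0 <= 1 - phi k.
  move=> sk k2; have [b [sb bb _]] := cstar_sqrt sk k2.
  by have := phi0 b; rewrite sb bb raddfB /= phi1.
have h1 := pos _ sh h2.
have := pos (- h); rewrite starN sh cnormN raddfN opprK => /(_ erefl h2) h3.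
have -> : (Normc.normc (phi h) <= 1) = (`|phi h| <= 1) by rewrite -[X in _ = (X <= _)]/((Normc.normc (phi h))%:C) lecR.
rewrite real_ler_norml; last first.
  have : phi h = 1 - (1 - phi h) by rewrite opprB addrC subrK.
  by move=> ->; rewrite rpredB ?rpred1 // ger0_real.
by apply/andP; split; rewrite -subr_ge0 ?opprK 1?addrC // addrC.
Qed.

End CstarLimits.

(** * Generated subalgebras *)

Section Generated.
Variables (R : realType) (A : cstarAlgType R).
Implicit Types (x y : A) (B S : set A).

Lemma cstar_closedP B :
  (forall u x, (forall n, B (u n)) -> tends u x -> B x) -> cstar_closed B.
Proof. by move=> h x /tends_approx[u Bu ux]; apply: h ux. Qed.

Definition tcont (f : A -> A) := forall u x, tends u x -> tends (fun n => f (u n)) (f x).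

Lemma cstar_closed_eq (f g : A -> A) : tcont f -> tcont g -> cstar_closed [set x | f x = g x].
Proof.
move=> cf cg; apply: cstar_closedP => u x fg ux.
by apply: (tends_unique (cf _ _ ux)); have := cg _ _ ux; congr tends; apply: funext => n; exact/esym/fg.
Qed.

Lemma cstar_closed_preimage (f : A -> A) B : tcont f -> cstar_closed B ->
  cstar_closed [set x | B (f x)].
Proof.
move=> cf cB; apply: cstar_closedP => u x Bu /cf; exact: cstar_closed_tends.
Qed.

Lemma cstar_generated_subalgebra S : cstar_subalgebra (cstar_generated S).
Proof.
split.
- by move=> B [/csub1].
- by move=> x y hx hy B BS; have [Bs _] := BS; apply: (csubD Bs); [apply: hx | apply: hy].
- by move=> c x hx B BS; have [Bs _] := BS; apply: (csubZ Bs); apply: hx.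
- by move=> x y hx hy B BS; have [Bs _] := BS; apply: (csubM Bs); [apply: hx | apply: hy].
- by move=> x hx B BS; have [Bs _] := BS; apply: (csub_star Bs); apply: hx.
- move=> x hx B BS; have [Bs _] := BS; apply: (csub_closed Bs) => e /hx[y hy xy].
  by exists y => //; apply: hy.
Qed.

Lemma sub_cstar_generated S x : S x -> cstar_generated S x.
Proof. by move=> Sx B [_]; apply. Qed.

Lemma cstar_generated_min S B : cstar_subalgebra B -> S `<=` B -> cstar_generated S `<=` B.
Proof. by move=> hB SB x; apply. Qed.

Lemma cstar_generated_sub S S' : S `<=` S' -> cstar_generated S `<=` cstar_generated S'.
Proof.
move=> SS'; apply: cstar_generated_min; first exact: cstar_generated_subalgebra.
by move=> x /SS'; apply: sub_cstar_generated.
Qed.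

Section Subalgebra.
Variables (B : set A) (hB : cstar_subalgebra B).

Lemma csub0 : B 0.
Proof. by rewrite -(scale0r 1); apply: (csubZ hB); apply: csub1. Qed.

Lemma csubN x : B x -> B (- x).
Proof. by move=> Bx; rewrite -scaleN1r; apply: (csubZ hB). Qed.

Lemma csubB x y : B x -> B y -> B (x - y).
Proof. by move=> Bx By; apply: (csubD hB) => //; apply: csubN. Qed.

Lemma csub_sum (T : eqType) (r : seq T) (F : T -> A) :
  (forall i, i \in r -> B (F i)) -> B (\sum_(i <- r) F i).
Proof.
move=> h; rewrite big_seq; apply: (big_ind B); first exact: csub0.
  exact: (csubD hB).
exact: h.
Qed.

End Subalgebra.

(** The hypothesis on star y makes the commutant closed under the involution. *)
Lemma generated_commute S x y : (forall g, S g -> g * y = y * g) ->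
  (forall g, S g -> g * star y = star y * g) -> cstar_generated S x -> x * y = y * x.
Proof.
move=> h1 h2 Cx.
suff [] : x * y = y * x /\ x * star y = star y * x by [].
move: x Cx; apply: cstar_generated_min; last by move=> g Sg; split; [apply: h1 | apply: h2].
split.
- by rewrite !mul1r !mulr1.
- by move=> u v [hu hu'] [hv hv']; rewrite !mulrDl !mulrDr hu hv hu' hv'.
- by move=> c u [hu hu']; rewrite -!scalerAl -!scalerAr hu hu'.
- move=> u v [hu hu'] [hv hv'].
  by rewrite -!mulrA hv hv' !mulrA hu hu'.
- move=> u [hu hu']; have := congr1 star hu; have := congr1 star hu'.
  by rewrite !starM starK => -> ->.
- apply: cstar_closedP => u z h uz; split.
    by apply: (cstar_closed_eq (@tendsMr _ _ y) (@tendsMl _ _ y))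
      => e e0; have [N /(_ _ (leqnn N)) uN] := uz _ e0; exists (u N); [case: (h N) | rewrite cnormB].
  by apply: (cstar_closed_eq (@tendsMr _ _ (star y)) (@tendsMl _ _ (star y)))
      => e e0; have [N /(_ _ (leqnn N)) uN] := uz _ e0; exists (u N); [case: (h N) | rewrite cnormB].
Qed.

End Generated.

(** * Algebras generated by Majorana operators *)

Section Majoranas.
Local Open Scope complex_scope.
Variables (R : realType) (A : cstarAlgType R) (Theta : {lrmorphism A -> A}).
Hypothesis Theta_star : forall x, Theta (star x) = star (Theta x).
Hypothesis ThetaK : forall x, Theta (Theta x) = x.
Implicit Types (x y u v g : A) (B S : set A) (s : seq A).
Local Notation Cg := (@cstar_generated R A).

Let Cg_sub S : cstar_subalgebra (Cg S) := cstar_generated_subalgebra S.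

Definition majorana g := [/\ star g = g, g * g = 1 & Theta g = - g].

Definition anticommutes g S := forall x, S x -> g * x = - (x * g).

Definition majoranas S := forall g, S g -> majorana g.

Lemma tcont_Theta : tcont Theta.
Proof.
move=> u x ux; apply: (@tends_bounded _ _ _ 4) ux => // [y z|y].
  exact: rmorphB.
exact: star_automorphism_bounded.
Qed.

Lemma Theta_generated S x : majoranas S -> Cg S x -> Cg S (Theta x).
Proof.
move=> mS; apply: (@cstar_generated_min _ _ _ [set x | Cg S (Theta x)]); last first.
  move=> g Sg; have [_ _ /= ->] := mS _ Sg.
  by apply: (csubN (Cg_sub S)); apply: sub_cstar_generated.
split; rewrite /mkset.
- by rewrite rmorph1; apply: (csub1 (Cg_sub S)).
- by move=> u v hu hv; rewrite rmorphD; apply: (csubD (Cg_sub S)).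
- by move=> c u hu; rewrite linearZ /=; apply: (csubZ (Cg_sub S)).
- by move=> u v hu hv; rewrite rmorphM; apply: (csubM (Cg_sub S)).
- by move=> u hu; rewrite Theta_star; apply: (csub_star (Cg_sub S)).
- by apply: cstar_closed_preimage; [exact: tcont_Theta | exact: (csub_closed (Cg_sub S))].
Qed.

(** Conjugation by g undoes Theta on the algebra generated by S, because both
    change the sign of every element of S. *)
Lemma twisted_commute g S x : majorana g -> majoranas S -> anticommutes g S ->
  Cg S x -> g * Theta x * g = x.
Proof.
move=> [sg gg tg] mS gS; apply: (@cstar_generated_min _ _ _ [set x | g * Theta x * g = x]); last first.
  move=> h Sh /=; have [_ _ ->] := mS _ Sh.
  by rewrite mulrN mulNr gS // mulNr opprK -mulrA gg mulr1.
split; rewrite /mkset.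
- by rewrite rmorph1 mulr1.
- by move=> u v hu hv; rewrite rmorphD mulrDr mulrDl hu hv.
- by move=> c u hu; rewrite linearZ /= -scalerAr -scalerAl hu.
- move=> u v hu hv; rewrite rmorphM -[in RHS]hu -[in RHS]hv !mulrA.
  by rewrite -[_ * g * g]mulrA gg mulr1.
- by move=> u hu; have := congr1 star hu; rewrite !starM sg mulrA Theta_star.
- apply: cstar_closed_eq => // u y uy; apply: tendsMr; apply: tendsMl; exact: tcont_Theta.
Qed.

Lemma even_commute g S x : majorana g -> majoranas S -> anticommutes g S ->
  Cg S x -> Theta x = x -> g * x = x * g.
Proof.
move=> mg mS gS Cx tx; have [_ gg _] := mg.
by rewrite -[in RHS](twisted_commute mg mS gS Cx) tx -mulrA gg mulr1.
Qed.

(** The projection u + v g |-> u that forgets the Majorana generator g. *)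
Definition forget g x : A := 2^-1 *: (x + g * Theta x * g).

Lemma forgetD g x y : forget g (x + y) = forget g x + forget g y.
Proof. by rewrite /forget rmorphD mulrDr mulrDl addrACA scalerDr. Qed.

Lemma forgetZ g c x : forget g (c *: x) = c *: forget g x.
Proof.
by rewrite /forget linearZ /= -scalerAr -scalerAl -scalerDr !scalerA mulrC.
Qed.

Lemma tcont_forget g : tcont (forget g).
Proof.
move=> u x ux; apply: tendsZ; apply: tendsD => //.
by apply: tendsMr; apply: tendsMl; apply: tcont_Theta.
Qed.

Section OneGenerator.
Variables (g : A) (S : set A).
Hypotheses (mg : majorana g) (mS : majoranas S) (gS : anticommutes g S).
Let gg : g * g = 1. Proof. by case: mg. Qed.
Let tg : Theta g = - g. Proof. by case: mg. Qed.
Let sg : star g = g. Proof. by case: mg. Qed.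

Lemma forget_id x : Cg S x -> forget g x = x.
Proof. by move=> Cx; rewrite /forget (twisted_commute mg mS gS) // half_scale_double. Qed.

Lemma forgetMl x y : Cg S y -> forget g (y * x) = y * forget g x.
Proof.
move=> Cy; rewrite /forget -scalerAr mulrDr rmorphM /= !mulrA; congr (_ *: (_ + _ * g)).
have := twisted_commute mg mS gS Cy => {2}<-.
by rewrite -[_ * g * g]mulrA gg mulr1.
Qed.

Lemma forgetMr x y : Cg S y -> forget g (x * y) = forget g x * y.
Proof.
move=> Cy; rewrite /forget -scalerAl mulrDl rmorphM /=; congr (_ *: (_ + _)).
have := twisted_commute mg mS gS Cy => {2}<-.
by rewrite !mulrA -[_ * g * g]mulrA gg mulr1.
Qed.

Lemma forget_generator : forget g g = 0.
Proof. by rewrite /forget tg mulrN mulNr gg mul1r subrr scaler0. Qed.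

Lemma forgetE u v : Cg S u -> Cg S v -> forget g (u + v * g) = u.
Proof.
by move=> Cu Cv; rewrite forgetD forget_id // forgetMl // forget_generator mulr0 addr0.
Qed.

Lemma generator_swap v : Cg S v -> v * g = g * Theta v.
Proof.
by move=> Cv; rewrite -[in LHS](twisted_commute mg mS gS Cv) -mulrA gg mulr1.
Qed.

Lemma generator_swap' v : Cg S v -> g * v = Theta v * g.
Proof.
by move=> Cv; rewrite (generator_swap (Theta_generated mS Cv)) ThetaK.
Qed.

Lemma mul_decomp u v u' v' : Cg S u' -> Cg S v' ->
  (u + v * g) * (u' + v' * g) = (u * u' + v * Theta v') + (u * v' + v * Theta u') * g.
Proof.
move=> Cu' Cv'; rewrite !mulrDl !mulrDr -[v * g * u']mulrA generator_swap' // !mulrA.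
rewrite -[v * g * v']mulrA generator_swap' // !mulrA -[_ * g * g]mulrA gg mulr1.
by rewrite [X in _ + X = _]addrC addrACA.
Qed.

(** The elements of the form u + v g are closed under multiplication because g
    passes through v at the cost of Theta, and form a norm-closed set because u
    and v depend continuously on u + v g. *)
Lemma generated_decomp x : Cg (g |` S) x ->
  exists u v, [/\ Cg S u, Cg S v & x = u + v * g].
Proof.
pose P y := Cg S (forget g y) /\ Cg S ((y - forget g y) * g).
have Pi u v : Cg S u -> Cg S v -> P (u + v * g).
  by move=> Cu Cv; rewrite /P forgetE // addrAC subrr add0r -mulrA gg mulr1.
have Pe y : P y -> exists u v, [/\ Cg S u, Cg S v & y = u + v * g].
  move=> [P1 P2]; exists (forget g y), ((y - forget g y) * g); split=> //.
  by rewrite -mulrA gg mulr1 addrC subrK.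
move=> Cx; apply: (Pe); move: x Cx.
apply: (@cstar_generated_min _ _ _ P); last first.
  move=> y [->|Sy].
    have : P (0 + 1 * g); last by rewrite mul1r add0r.
    by apply: (Pi); [exact: (csub0 (Cg_sub S)) | exact: (csub1 (Cg_sub S))].
  have : P (y + 0 * g); last by rewrite mul0r addr0.
  by apply: (Pi); [exact: sub_cstar_generated | exact: (csub0 (Cg_sub S))].
have sub := Cg_sub S.
have P0 u : Cg S u -> P u.
  by move=> Cu; have : P (u + 0 * g); [apply: Pi => //; exact: (csub0 sub) | rewrite mul0r addr0].
split.
- by apply: P0; exact: (csub1 sub).
- move=> y z /Pe[u [v [Cu Cv ->]]] /Pe[u' [v' [Cu' Cv' ->]]].
  by rewrite addrACA -mulrDl; apply: Pi; apply: (csubD sub).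
- move=> c y /Pe[u [v [Cu Cv ->]]].
  by rewrite scalerDr scalerAl; apply: Pi; apply: (csubZ sub).
- move=> y z /Pe[u [v [Cu Cv ->]]] /Pe[u' [v' [Cu' Cv' ->]]].
  rewrite mul_decomp //.
  have Ct w : Cg S w -> Cg S (Theta w) by apply: Theta_generated.
  by apply: (Pi); apply: (csubD sub) => //; apply: (csubM sub) => //; apply: Ct.
- move=> y /Pe[u [v [Cu Cv ->]]].
  rewrite starD starM sg generator_swap'; last exact: (csub_star sub).
  by apply: (Pi); [exact: (csub_star sub) | apply: Theta_generated => //; exact: (csub_star sub)].
- apply: cstar_closedP => w y Pw wy; split.
    by apply: (cstar_closed_tends (csub_closed sub) _ (@tcont_forget g _ _ wy)) => n; have [] := Pw n.
  apply: (cstar_closed_tends (u := fun n => (w n - forget g (w n)) * g) (csub_closed sub)).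
    by move=> n; have [] := Pw n.
  apply: tendsMr; apply: tendsD => //.
  have := tendsZ (-1) (@tcont_forget g _ _ wy); rewrite scaleN1r; congr tends.
  by apply: funext => n; rewrite scaleN1r.
Qed.

Lemma forget_generated x : Cg (g |` S) x -> Cg S (forget g x).
Proof. by move=> /generated_decomp[u [v [Cu Cv ->]]]; rewrite forgetE. Qed.

End OneGenerator.

Lemma forget_Theta g x : Theta g = - g -> Theta (forget g x) = forget g (Theta x).
Proof.
by move=> tg; rewrite /forget linearZ /= rmorphD !rmorphM /= tg mulNr mulrNN.
Qed.

Lemma forget_even_commute g x : majorana g -> Theta x = x -> g * x = x * g -> forget g x = x.
Proof.
by move=> [_ gg _] tx gx; rewrite /forget tx gx -mulrA gg mulr1 half_scale_double.
Qed.

End Majoranas.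

Section Lists.
Local Open Scope complex_scope.
Variables (R : realType) (A : cstarAlgType R) (Theta : {lrmorphism A -> A}).
Hypothesis Theta_star : forall x, Theta (star x) = star (Theta x).
Hypothesis ThetaK : forall x, Theta (Theta x) = x.
Implicit Types (x y u v g : A) (B S : set A) (s : seq A).
Local Notation Cg := (@cstar_generated R A).
Local Notation forget := (forget Theta).
Local Notation majorana := (majorana Theta).
Local Notation majoranas := (majoranas Theta).

Let Cg_sub S : cstar_subalgebra (Cg S) := cstar_generated_subalgebra S.

Definition adjoin s S : set A := [set x | x \in s] `|` S.

Lemma adjoin_nil S : adjoin [::] S = S.
Proof. by apply/seteqP; split=> x; [case | right]. Qed.

Lemma adjoin_cons g s S : adjoin (g :: s) S = g |` adjoin s S.
Proof.
apply/seteqP; split=> x.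
  by case; rewrite /= ?inE; [case/orP => [/eqP->|?]; [left | right; left] | right; right].
by case=> [->|[?|?]]; [left; apply: mem_head | left; rewrite /= inE; apply/orP; right | right].
Qed.

Lemma adjoin_cat s1 s2 S : adjoin (s1 ++ s2) S = adjoin s1 (adjoin s2 S).
Proof. by elim: s1 => [|g s1 IH]; rewrite ?adjoin_nil // cat_cons !adjoin_cons IH. Qed.

(** The order of the list is the order in which its elements will be
    forgotten. *)
Fixpoint majorana_ext s S : Prop :=
  if s is g :: s' then [/\ majorana g, anticommutes g (adjoin s' S) & majorana_ext s' S]
  else majoranas S.

Lemma majorana_ext_cat s1 s2 S :
  majorana_ext (s1 ++ s2) S <-> majorana_ext s1 (adjoin s2 S) /\ majorana_ext s2 S.
Proof.
have ext2 : majorana_ext s2 S -> majoranas (adjoin s2 S).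
  elim: s2 => [|g s2 IH]; first by rewrite adjoin_nil.
  by rewrite adjoin_cons => -[mg _ /IH ms] x [->|/ms].
elim: s1 => [|g s1 [IH1 IH2]] /=; first by split=> [h|[]//]; split=> //; apply: ext2.
rewrite adjoin_cat; split=> [[mg gs /IH1[]]|[[mg gs h1] h2]] //.
by split=> //; apply: IH2.
Qed.

Lemma majorana_ext_majoranas s S : majorana_ext s S -> majoranas (adjoin s S).
Proof. by move=> h; have [] := (majorana_ext_cat [::] s S).1 h. Qed.

Definition forgets s x : A := foldl (fun y g => forget g y) x s.

Lemma forgets_cat s1 s2 x : forgets (s1 ++ s2) x = forgets s2 (forgets s1 x).
Proof. exact: foldl_cat. Qed.

Lemma forgetsD s x y : forgets s (x + y) = forgets s x + forgets s y.
Proof. by elim: s x y => [//|g s IH] x y /=; rewrite forgetD IH. Qed.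

Lemma forgetsZ s c x : forgets s (c *: x) = c *: forgets s x.
Proof. by elim: s x => [//|g s IH] x /=; rewrite forgetZ IH. Qed.

Lemma tcont_forgets s : tcont (forgets s).
Proof.
elim: s => [|g s IH] u x ux //=; apply: IH; exact: (tcont_forget Theta_star).
Qed.

Lemma forgets_Theta s S x : majorana_ext s S -> Theta (forgets s x) = forgets s (Theta x).
Proof.
elim: s x => [//|g s IH] x /= [[_ _ tg] _ hs].
by rewrite IH // forget_Theta.
Qed.

Section Extension.
Variables (s : seq A) (S : set A).
Hypothesis hs : majorana_ext s S.

Lemma forgets_generated x : Cg (adjoin s S) x -> Cg S (forgets s x).
Proof.
elim: s hs x => [|g t IH] ht x /=; first by rewrite adjoin_nil.
have [mg gt mt] := ht; rewrite adjoin_cons => Cx; apply: IH => //.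
by apply: (forget_generated Theta_star ThetaK mg) => //; apply: majorana_ext_majoranas.
Qed.

Let Cg_adjoin t x : Cg S x -> Cg (adjoin t S) x.
Proof. by apply: cstar_generated_sub => y; right. Qed.

Lemma forgets_id x : Cg S x -> forgets s x = x.
Proof.
move=> Cx; elim: s hs => [//|g t IH] [mg gt mt] /=.
rewrite (forget_id Theta_star mg (majorana_ext_majoranas mt) gt) ?IH //.
exact: Cg_adjoin.
Qed.

Lemma forgetsMl x y : Cg S y -> forgets s (y * x) = y * forgets s x.
Proof.
move=> Cy; elim: s hs x => [//|g t IH] [mg gt mt] x /=.
by rewrite (forgetMl Theta_star mg (majorana_ext_majoranas mt) gt) ?IH //; apply: Cg_adjoin.
Qed.

Lemma forgetsMr x y : Cg S y -> forgets s (x * y) = forgets s x * y.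
Proof.
move=> Cy; elim: s hs x => [//|g t IH] [mg gt mt] x /=.
by rewrite (forgetMr Theta_star mg (majorana_ext_majoranas mt) gt) ?IH //; apply: Cg_adjoin.
Qed.

(** Forgetting a generator does not change an even element that commutes with
    it. *)
Lemma even_commutant x : Cg (adjoin s S) x -> Theta x = x ->
  {in s, forall g, g * x = x * g} -> Cg S x.
Proof.
move=> Cx tx xs; suff <- : forgets s x = x by apply: forgets_generated.
elim: s hs xs => [//|g t IH] [mg gt mt] xs /=.
rewrite forget_even_commute ?IH // => [h hh|]; apply: xs; rewrite inE ?hh ?orbT //.
by rewrite eqxx.
Qed.

End Extension.
End Lists.

(** * Traces *)

Section StateFacts.
Local Open Scope complex_scope.
Variables (R : realType) (A : cstarAlgType R).
Variables (phi : {scalar A}) (hphi : state phi).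
Implicit Types (x y u v g : A) (B S : set A) (s : seq A).
Local Notation Cg := (@cstar_generated R A).

(** Expand the positivity of phi on the squares of x + c for c = 0, 1 and i. *)
Lemma state_star x : phi (star x) = conjc (phi x).
Proof.
have pos y : 0 <= phi (star y * y) by apply: hphi.1.
have exp c : phi (star (x + c%:A) * (x + c%:A))
    = phi (star x * x) + c * phi (star x) + conjc c * phi x + conjc c * c.
  rewrite starD starZE star1 mulrDl !mulrDr -!scalerAl -!scalerAr !mul1r !mulr1.
  by rewrite !raddfD /= !linearZ /= hphi.2 mulr1 !addrA.
have := pos x; have := pos (x + 1%:A); have := pos (x + ('i)%:A).
rewrite !exp !lecE; case: (phi (star x * x)) (phi (star x)) (phi x) => [a b] [p q] [p' q'] /=.
move=> /andP[/eqP h1 _] /andP[/eqP h2 _] /andP[/eqP h3 _].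
by apply/eqP; rewrite eq_complex /=; apply/andP; split; apply/eqP; lra.
Qed.

(** The multiples of 1 form a closed set because phi is bounded. *)
Lemma generated_scalar x : Cg set0 x -> x = (phi x)%:A.
Proof.
apply: (@cstar_generated_min _ _ _ [set x | x = (phi x)%:A]) => //.
split; rewrite /mkset.
- by rewrite hphi.2 scale1r.
- by move=> u v hu hv; rewrite raddfD scalerDl -hu -hv.
- by move=> c u hu; rewrite linearZ /= -scalerA -hu.
- move=> u v hu hv; have uv : u * v = phi u *: v by rewrite {1}hu -scalerAl mul1r.
  by rewrite uv linearZ /= {1}hv scalerA.
- move=> u hu; rewrite state_star {1}hu starZE star1 //.
- apply: (@cstar_closed_eq _ _ id) => [u y //|u z uz].
  apply: (@tends_bounded _ _ (fun x => (phi x)%:A) (4 * cnorm (1 : A))) uz => [|y y'|y].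
  + by rewrite mulr_ge0 ?cnorm_ge0.
  + by rewrite raddfB scalerBl.
  + by rewrite cnormZE mulrAC ler_wpM2r ?cnorm_ge0 // state_bounded.
Qed.

End StateFacts.

Section Traces.
Local Open Scope complex_scope.
Variables (R : realType) (A : cstarAlgType R) (Theta : {lrmorphism A -> A}).
Hypothesis Theta_star : forall x, Theta (star x) = star (Theta x).
Hypothesis ThetaK : forall x, Theta (Theta x) = x.
Variables (phi : {scalar A}) (hphi : state phi).
Implicit Types (x y u v g : A) (B S : set A) (s : seq A).
Local Notation Cg := (@cstar_generated R A).
Local Notation forget := (forget Theta).
Local Notation forgets := (forgets Theta).
Local Notation majorana := (majorana Theta).
Local Notation majorana_ext := (majorana_ext Theta).

Let Cg_sub S : cstar_subalgebra (Cg S) := cstar_generated_subalgebra S.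

(** Once all the generators are forgotten a scalar is left, which phi reads
    off: this is the normalized trace. *)
Definition tau s x : R[i] := phi (forgets s x).

Lemma tauD s x y : tau s (x + y) = tau s x + tau s y.
Proof. by rewrite /tau forgetsD raddfD. Qed.

Lemma tauZ s c x : tau s (c *: x) = c * tau s x.
Proof. by rewrite /tau forgetsZ linearZ. Qed.

Lemma tau1 s : majorana_ext s set0 -> tau s 1 = 1.
Proof.
by move=> hs; rewrite /tau (forgets_id Theta_star hs) ?hphi.2 //; apply: csub1.
Qed.

Lemma forgets_star s S x : majorana_ext s S -> forgets s (star x) = star (forgets s x).
Proof.
elim: s x => [//|g s IH] x /= [[sg _ _] _ hs].
rewrite -IH //; congr forgets; rewrite /forget starZE conjc_half starD !starM sg.
by rewrite Theta_star mulrA.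
Qed.

Lemma tau_star s S x : majorana_ext s S -> tau s (star x) = conjc (tau s x).
Proof. by move=> hs; rewrite /tau (forgets_star _ hs) (state_star hphi). Qed.

Lemma forgets_scalar s x : majorana_ext s set0 -> Cg (adjoin s set0) x ->
  forgets s x = (tau s x)%:A.
Proof. by move=> hs /(forgets_generated Theta_star ThetaK hs) /(generated_scalar hphi). Qed.

Lemma tau_Theta s x : majorana_ext s set0 -> Cg (adjoin s set0) x ->
  tau s (Theta x) = tau s x.
Proof.
move=> hs Cx; rewrite /tau -(forgets_Theta _ hs) (forgets_scalar hs Cx).
by rewrite linearZ /= rmorph1.
Qed.

(** In a product (u + v g)(u' + v' g), forgetting g leaves u u' + v Theta(v').
    The first term is symmetric by induction, and so is the second because tau
    is invariant under Theta. *)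
Lemma tauC s x y : majorana_ext s set0 -> Cg (adjoin s set0) x -> Cg (adjoin s set0) y ->
  tau s (x * y) = tau s (y * x).
Proof.
elim: s x y => [|g s IH] x y.
  rewrite adjoin_nil => _ /(generated_scalar hphi) -> _.
  by rewrite -scalerAl -scalerAr mul1r mulr1.
rewrite adjoin_cons => -[mg gs hs].
have ms := majorana_ext_majoranas hs.
move=> /(generated_decomp Theta_star ThetaK mg ms gs)[u [v [Cu Cv ->]]].
move=> /(generated_decomp Theta_star ThetaK mg ms gs)[u' [v' [Cu' Cv' ->]]].
have sub := Cg_sub (adjoin s set0).
have Ct w : Cg (adjoin s set0) w -> Cg (adjoin s set0) (Theta w).
  exact: Theta_generated.
have CM w w' : Cg (adjoin s set0) w -> Cg (adjoin s set0) w' -> Cg (adjoin s set0) (w * w').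
  exact: (csubM sub).
have CD w w' : Cg (adjoin s set0) w -> Cg (adjoin s set0) w' -> Cg (adjoin s set0) (w + w').
  exact: (csubD sub).
have step p q p' q' : Cg (adjoin s set0) p -> Cg (adjoin s set0) q ->
    Cg (adjoin s set0) p' -> Cg (adjoin s set0) q' ->
    tau (g :: s) ((p + q * g) * (p' + q' * g)) = tau s (p * p') + tau s (q * Theta q').
  move=> Cp Cq Cp' Cq'; rewrite (mul_decomp Theta_star ThetaK mg ms gs) //.
  rewrite /tau /= (forgetE Theta_star mg ms gs) ?forgetsD ?raddfD //.
    by apply: CD; apply: CM => //; apply: Ct.
  by apply: CD; apply: CM => //; apply: Ct.
rewrite !step // IH //; congr (_ + _).
rewrite IH //; last exact: Ct.
rewrite -[LHS](tau_Theta hs); last by apply: CM => //; apply: Ct.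
by rewrite rmorphM /= ThetaK.
Qed.

(** Forgetting g averages the square of x and the square of Theta(x) g. Hence
    tau dominates a positive multiple of phi on squares, which gives the
    second part. *)
Lemma tau_ge0 s S x : majorana_ext s S -> 0 <= tau s (star x * x)
  /\ (tau s (star x * x) = 0 -> phi (star x * x) = 0).
Proof.
elim: s x => [|g s IH] x /=; first by move=> _; split=> //; apply: hphi.1.
move=> [[sg _ _] _ hs].
have E : tau (g :: s) (star x * x)
    = 2^-1 * (tau s (star x * x) + tau s (star (Theta x * g) * (Theta x * g))).
  rewrite /tau /= /forget forgetsZ linearZ /= forgetsD raddfD /=; congr (_ * (_ + phi _)).
  by rewrite rmorphM starM sg /= Theta_star !mulrA.
have [h1 k1] := IH x hs; have [h2 _] := IH (Theta x * g) hs.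
rewrite E; split; first by rewrite mulr_ge0 ?addr_ge0 // invr_ge0 ler0n.
move/eqP; rewrite mulf_eq0 invr_eq0 pnatr_eq0 /= paddr_eq0 // => /andP[/eqP h _].
exact: k1.
Qed.

(** If D1 and D2 represent psi and x |-> psi(x g) on the smaller algebra, then
    D1 + Theta(D2) g represents psi on the larger one. *)
Lemma tau_density s (psi : A -> R[i]) : majorana_ext s set0 ->
    (forall x y, psi (x + y) = psi x + psi y) -> (forall c x, psi (c *: x) = c * psi x) ->
  exists2 D, Cg (adjoin s set0) D & forall y, Cg (adjoin s set0) y -> psi y = tau s (y * D).
Proof.
elim: s psi => [|g s IH] psi.
  rewrite adjoin_nil => _ pD pZ; exists (psi 1)%:A.
    by apply: (csubZ (Cg_sub _)); apply: (csub1 (Cg_sub _)).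
  move=> y /(generated_scalar hphi) yE; rewrite [in LHS]yE pZ /tau /=.
  by rewrite -scalerAr mulr1 linearZ /= mulrC.
rewrite adjoin_cons => -[mg gs hs] pD pZ.
have [D1 CD1 D1E] := IH psi hs pD pZ.
have [|c x|D2 CD2 D2E] := IH (fun x => psi (x * g)) hs.
- by move=> x y; rewrite mulrDl pD.
- by rewrite -scalerAl pZ.
have ms := majorana_ext_majoranas hs; have [_ gg _] := mg.
have sub := Cg_sub (adjoin s set0); have subg := Cg_sub (g |` adjoin s set0).
have inc x : Cg (adjoin s set0) x -> Cg (g |` adjoin s set0) x.
  by apply: cstar_generated_sub => z; right.
exists (D1 + Theta D2 * g).
  apply: (csubD subg); first exact: inc.
  apply: (csubM subg); first by apply: inc; apply: Theta_generated.
  by apply: sub_cstar_generated; left.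
move=> y /(generated_decomp Theta_star ThetaK mg ms gs)[u [v [Cu Cv ->]]].
have Ct : Cg (adjoin s set0) (Theta D2) by apply: Theta_generated.
rewrite (mul_decomp Theta_star ThetaK mg ms gs) // /tau /=.
rewrite (forgetE Theta_star mg ms gs); first last.
- by apply: (csubD sub); apply: (csubM sub) => //; apply: Theta_generated.
- by apply: (csubD sub); apply: (csubM sub) => //; apply: Theta_generated.
by rewrite pD D1E // D2E // ThetaK forgetsD raddfD.
Qed.

Lemma generated_span s : majorana_ext s set0 -> exists n (e : 'I_n -> A), forall x,
  Cg (adjoin s set0) x -> exists c : 'I_n -> R[i], x = \sum_i c i *: e i.
Proof.
elim: s => [|g s IH].
  move=> _; exists 1%N, (fun=> 1) => x; rewrite adjoin_nil => /(generated_scalar hphi) xE.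
  by exists (fun=> phi x); rewrite big_ord1.
move=> [mg gs hs]; have [n [e eP]] := IH hs.
exists (n + n)%N, (fun i => match fintype.split i with inl j => e j | inr j => e j * g end).
move=> x; rewrite adjoin_cons.
move=> /(generated_decomp Theta_star ThetaK mg (majorana_ext_majoranas hs) gs)[u [v [Cu Cv ->]]].
have [[c ->] [c' ->]] := (eP _ Cu, eP _ Cv).
exists (fun i => match fintype.split i with inl j => c j | inr j => c' j end).
rewrite big_split_ord mulr_suml; congr (_ + _); apply: eq_bigr => i _.
  by rewrite (unsplitK (inl i)).
by rewrite (unsplitK (inr i)) scalerAl.
Qed.

(** The product of an even number of generators is even and anticommutes with
    each of them, so it implements Theta. *)
Lemma parity_unitary (ps : seq (A * A)) :
  let s := flatten [seq [:: p.1; p.2] | p <- ps] in majorana_ext s set0 ->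
  exists t, [/\ Cg (adjoin s set0) t, Theta t = t, star t * t = 1, t * star t = 1
    & {in s, forall g, t * g = - (g * t)}].
Proof.
elim: ps => [|[g h] ps IH] /=.
  by move=> _; exists 1; rewrite rmorph1 star1 mulr1; split=> //; apply: (csub1 (Cg_sub _)).
set s := flatten _; rewrite -/s in IH * => -[mg gs [mh hhs hs]].
have [t [Ct tt st ts anti]] := IH hs.
have ms := majorana_ext_majoranas hs.
have hg : h * g = - (g * h) by rewrite gs ?opprK //; rewrite adjoin_cons; left.
have gs' : anticommutes g (adjoin s set0).
  by move=> x xs; apply: gs; rewrite adjoin_cons; right.
have gt := even_commute Theta_star mg ms gs' Ct tt.
have ht := even_commute Theta_star mh ms hhs Ct tt.
have [sg gg tg] := mg; have [sh hh th] := mh.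
have sub := Cg_sub (adjoin [:: g, h & s] set0).
have in_s x : x \in s -> adjoin s set0 x by left.
exists (g * h * t); split.
- apply: (csubM sub); last first.
    by move: Ct; apply: cstar_generated_sub => x; rewrite !adjoin_cons; right; right.
  by apply: (csubM sub); apply: sub_cstar_generated; rewrite !adjoin_cons; [left | right; left].
- by rewrite !rmorphM /= tg th tt mulrNN.
- by rewrite !starM sg sh !mulrA -[_ * g * g]mulrA gg mulr1 -[_ * h * h]mulrA hh mulr1.
- by rewrite !starM sg sh !mulrA -[_ * t * star t]mulrA ts mulr1 -[_ * h * h]mulrA hh mulr1.
move=> x; rewrite !inE => /or3P[/eqP->|/eqP->|xs].
- by rewrite -!mulrA -gt [h * (g * t)]mulrA hg mulNr mulrN !mulrA.
- by rewrite -!mulrA -ht [h * (h * t)]mulrA hh mul1r mulrA [h * g]hg mulNr opprK -!mulrA [h * (h * t)]mulrA hh mul1r.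
- rewrite -mulrA anti // mulrN !mulrA; congr (- (_ * t)).
  by have xs' := in_s _ xs; rewrite -[LHS]mulrA hhs // mulrN mulrA gs' // mulNr opprK.
Qed.

(** A trace is invariant under the inner automorphism Theta, hence under
    forgetting any generator, and finally only a scalar is left. *)
Lemma tau_unique (ps : seq (A * A)) (tr : A -> R[i]) x :
    let s := flatten [seq [:: p.1; p.2] | p <- ps] in majorana_ext s set0 ->
    tracial_state (Cg (adjoin s set0)) tr ->
  Cg (adjoin s set0) x -> tr x = tau s x.
Proof.
move=> s hs htr; have [t [Ct tt st ts anti]] := parity_unitary hs.
rewrite -/s in Ct anti; set B := Cg _ in htr Ct *.
have sub : cstar_subalgebra B := Cg_sub _.
have inner y : B y -> t * y = Theta y * t.
  apply: (@cstar_generated_min _ _ _ [set y | t * y = Theta y * t]); last first.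
    move=> g; rewrite /adjoin setU0 => gs; rewrite /mkset anti //.
    have [_ _ ->] : majorana g by apply: (majorana_ext_majoranas hs); left.
    by rewrite mulNr.
  split; rewrite /mkset.
  - by rewrite rmorph1 mulr1 mul1r.
  - by move=> u v hu hv; rewrite rmorphD mulrDr mulrDl hu hv.
  - by move=> c u hu; rewrite linearZ /= -scalerAr -scalerAl hu.
  - by move=> u v hu hv; rewrite rmorphM mulrA hu -mulrA hv mulrA.
  - move=> u hu; have := congr1 (fun w => t * star w * t) hu.
    rewrite !starM !mulrA ts mul1r -!mulrA st mulr1 Theta_star => ->; by [].
  - apply: cstar_closed_eq => u z uz; first exact: tendsMl.
    by apply: tendsMr; apply: tcont_Theta uz.
have trD y z : B y -> B z -> tr (y + z) = tr y + tr z.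
  by move=> By Bz; have := trace_linear htr 1 By Bz; rewrite scale1r mul1r.
have tr0 : tr 0 = 0.
  have := trD 0 0 (csub0 sub) (csub0 sub); rewrite addr0 => h.
  by apply: (addrI (tr 0)); rewrite -h addr0.
have trZ c y : B y -> tr (c *: y) = c * tr y.
  by move=> By; have := trace_linear htr c By (csub0 sub); rewrite tr0 !addr0.
have Bt y : B y -> B (Theta y).
  by apply: Theta_generated => //; apply: majorana_ext_majoranas.
have trTheta y : B y -> tr (Theta y) = tr y.
  move=> By; have -> : Theta y = t * (y * star t) by rewrite mulrA inner // -mulrA ts mulr1.
  rewrite (traceC htr) //; first by rewrite -mulrA st mulr1.
  by apply: (csubM sub) => //; apply: (csub_star sub).
have step g y : g \in s -> B y -> B (forget g y) /\ tr (forget g y) = tr y.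
  move=> gs By; have [_ gg _] : majorana g by apply: (majorana_ext_majoranas hs); left.
  have Bg : B g by apply: sub_cstar_generated; left.
  have BgT : B (g * Theta y) by apply: (csubM sub) => //; apply: Bt.
  have BgTg : B (g * Theta y * g) by apply: (csubM sub).
  rewrite /forget; split; first by apply: (csubZ sub); apply: (csubD sub).
  rewrite trZ ?trD //; last exact: (csubD sub).
  rewrite (traceC htr) // mulrA gg mul1r trTheta //.
  by field.
have steps s' y : {subset s' <= s} -> B y -> tr (forgets s' y) = tr y.
  elim: s' y => [//|g s' IH] y /= ss By.
  have [Bf <-] := step g y (ss g (mem_head _ _)) By.
  by rewrite IH // => z zs; apply: ss; rewrite inE zs orbT.
move=> Bx; rewrite -(steps s x) // (forgets_scalar hs Bx) trZ; last exact: (csub1 sub).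
by rewrite (trace1 htr) mulr1.
Qed.

Lemma tau_tracial s : majorana_ext s set0 -> tracial_state (Cg (adjoin s set0)) (tau s).
Proof.
move=> hs; split.
- by move=> c x y _ _; rewrite tauD tauZ.
- by move=> x _; have [] := tau_ge0 x hs.
- exact: tau1.
- by move=> x y; apply: tauC.
Qed.

Lemma generated_findim_for (Phi : A -> R[i]) s : majorana_ext s set0 ->
    (forall x y, Phi (x + y) = Phi x + Phi y) -> (forall c x, Phi (c *: x) = c * Phi x) ->
    (forall x, 0 <= Phi (star x * x)) ->
    (forall x, Cg (adjoin s set0) x -> Phi (star x * x) = 0 -> x = 0) ->
  findim_star_subalgebra star (Cg (adjoin s set0)) Phi.
Proof.
move=> hs PD PZ P0 faith; have sub := Cg_sub (adjoin s set0); split=> //.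
- by split; [exact: starK | exact: starD | exact: starZ | exact: starM].
- exact: (csub1 sub).
- exact: (csubD sub).
- exact: (csubZ sub).
- exact: (csubM sub).
- exact: (csub_star sub).
- exact: generated_span.
Qed.

Lemma generated_findim s : majorana_ext s set0 -> faithful_on (Cg (adjoin s set0)) phi ->
  findim_star_subalgebra star (Cg (adjoin s set0)) phi.
Proof.
move=> hs; apply: generated_findim_for => //; first exact: raddfD.
  by move=> c x; rewrite linearZ.
exact: hphi.1.
Qed.

Lemma generated_findim_tau s : majorana_ext s set0 -> faithful_on (Cg (adjoin s set0)) phi ->
  findim_star_subalgebra star (Cg (adjoin s set0)) (tau s).
Proof.
move=> hs faith; apply: generated_findim_for => //; first exact: tauD.
- exact: tauZ.
- by move=> x; have [] := tau_ge0 x hs.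
- by move=> x Cx; have [_ /[apply]] := tau_ge0 x hs; apply: faith.
Qed.

End Traces.

(** * Sums of squares of matrices *)

Section PositiveComparison.
Local Open Scope complex_scope.
Variables (R : realType) (W : algType R[i]).
Lemma sopN (st : W -> W) (hst : star_operation st) x : st (- x) = - st x.
Proof. by apply: (addrI (st x)); rewrite -(sopD hst) !subrr (sop0 hst). Qed.

Lemma sopZr (st : W -> W) (hst : star_operation st) (l : R) x :
  st (l%:C *: x) = l%:C *: st x.
Proof. by rewrite (sopZ hst); congr (_ *: _); exact: conjc_real. Qed.

Lemma sopB (st : W -> W) (hst : star_operation st) x y : st (x - y) = st x - st y.
Proof. by rewrite (sopD hst) (sopN hst). Qed.

Variables (st : W -> W) (B : set W) (Phi : W -> R[i]).
Hypothesis hB : findim_star_subalgebra st B Phi.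
Let hst : star_operation st := fs_star hB.

Lemma ge0_real (z : R[i]) : 0 <= z -> z = (complex.Re z)%:C.
Proof. by case: z => a b; rewrite lecE /= => /andP[/eqP -> _]. Qed.

(** By the spectral theorem k - x has a square root. *)
Lemma fs_eigen_bound x (k : R) y : B x -> st x = x -> B y ->
    (forall l v, B v -> v != 0 -> x * v = l%:C *: v -> l <= k) ->
  Phi (st y * (x * y)) <= k%:C * Phi (st y * y).
Proof.
move=> Bx sx By hk; have [s ann eig] := spectral_theorem hB Bx sx.
pose c := fcalc s (fun l => (Num.sqrt (k - l))%:C) x.
have Bc : B c by apply: (fs_fcalc hB).
have sc : st c = c.
  by rewrite (sop_fcalc hst) //; apply: eq_fcalc => l _; rewrite /= oppr0.
have cc : c * c = k%:C *: 1 - x.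
  rewrite fcalcM // -(fcalc1 ann) fcalcZ -[X in _ = _ - X](fcalc_id ann) -scaleN1r fcalcZ fcalcD.
  apply: eq_fcalc => l ls; have [v [Bv v0 xv]] := eig l ls.
  rewrite -rmorphM -expr2 sqr_sqrtr ?subr_ge0; last exact: hk xv.
  by rewrite mulr1 mulN1r rmorphB.
have := fs_ge0 hB (fsM hB Bc By).
rewrite (sopM hst) sc -mulrA [c * (c * y)]mulrA cc mulrBl mulrBr -scalerAl mul1r -scalerAr.
by rewrite -scaleN1r (fs_PhiD hB) !(fs_PhiZ hB) mulN1r subr_ge0.
Qed.

(** If S and S' are positive and S y - S' y = l y, then
    l y*(S + S')y = y*(S^2 - S'^2)y while |l| y*y <= y*(S + S')y. *)
Lemma sqrt_difference_eigenvalue (S S' c c' : W) (e l : R) y :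
    B c -> st c = c -> c * c = S -> B c' -> st c' = c' -> c' * c' = S' ->
    0 <= e -> B y -> y != 0 -> (S - S') * y = l%:C *: y ->
    `|Phi (st y * ((S * S - S' * S') * y))| <= (e ^+ 2)%:C * Phi (st y * y) ->
  `|l| <= e.
Proof.
move=> Bc sc cS Bc' sc' cS' e0 By y0 eig.
have sS : st S = S by rewrite -cS (sopM hst) sc.
have sS' : st S' = S' by rewrite -cS' (sopM hst) sc'.
pose p := Phi (st y * (S * y)); pose p' := Phi (st y * (S' * y)); pose q := Phi (st y * y).
have p0 : 0 <= p.
  by have := fs_ge0 hB (fsM hB Bc By); rewrite (sopM hst) sc -mulrA [c * (c * y)]mulrA cS.
have p'0 : 0 <= p'.
  by have := fs_ge0 hB (fsM hB Bc' By); rewrite (sopM hst) sc' -mulrA [c' * (c' * y)]mulrA cS'.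
have q0 : 0 < q by apply: (fs_gt0 hB).
have eig' : S * y = S' * y + l%:C *: y by rewrite -eig mulrBl addrC subrK.
have pp : p = p' + l%:C * q.
  by rewrite /p eig' mulrDr (fs_PhiD hB) -scalerAr (fs_PhiZ hB).
have ysS : st y * (S - S') = l%:C *: st y.
  by have := congr1 st eig; rewrite (sopM hst) (sopB hst) sS sS' (sopZr hst).
have -> : Phi (st y * ((S * S - S' * S') * y)) = l%:C * (p + p').
  have -> : S * S - S' * S' = S * (S - S') + (S - S') * S'.
    by rewrite mulrBr mulrBl addrA subrK.
  rewrite mulrDl mulrDr (fs_PhiD hB) -[S * _ * y]mulrA eig -!scalerAr (fs_PhiZ hB).
  by rewrite !mulrA ysS -!scalerAl (fs_PhiZ hB) -mulrDr -!mulrA.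
have [[rp rp'] rq] := (ge0_real p0, ge0_real p'0, ge0_real (ltW q0)).
have u0 : 0 <= complex.Re p by rewrite -ler0c -rp.
have v0 : 0 <= complex.Re p' by rewrite -ler0c -rp'.
have w0 : 0 < complex.Re q by rewrite -ltcR -rq.
rewrite -/q => h0; move: h0 pp; rewrite rp rp' rq.
move: (complex.Re p) (complex.Re p') (complex.Re q) u0 v0 w0 => u v w u0 v0 w0 h0.
rewrite -rmorphM -rmorphD => /complexI uE; move: h0.
rewrite -rmorphD -!rmorphM /= normc_def /= expr0n /= addr0 sqrtr_sqr lecR normrM.
rewrite (ger0_norm (addr_ge0 u0 v0)) => h.
have lw : `|l| * w <= u + v.
  by have [l0|l0] := lerP 0 l; rewrite ?(ger0_norm l0) ?(ltr0_norm l0); nra.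
rewrite -(ler_sqr (x := `|l|)) ?nnegrE // -(ler_pM2r w0).
apply: le_trans h; rewrite expr2 -mulrA ler_wpM2l //.
Qed.

End PositiveComparison.

Section NormBound.
Local Open Scope complex_scope.
Variables (R : realType) (A : cstarAlgType R) (B : set A) (phi : A -> R[i]).
Hypothesis hB : findim_star_subalgebra star B phi.

(** By the spectral theorem h is the real part of a unitary. *)
Lemma cnorm_le1 h : B h -> star h = h ->
    (forall y, B y -> 0 <= phi (star y * (h * y)) <= phi (star y * y)) ->
  cnorm h <= 1.
Proof.
move=> Bh sh h01; have [s ann eig] := spectral_theorem hB Bh sh.
have [l ls|u [Bu uu _ ->]] := fs_unitary hB Bh sh ann.
  have [y [By y0 hy]] := eig l ls; have := h01 y By.
  have yy := fs_gt0 hB By y0.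
  rewrite (eigenvalue_Phi hB hy) pmulr_lge0 // ler0c => /andP[l0].
  rewrite -[leRHS]mul1r ler_pM2r // -(rmorph1 (real_complex R)) lecR => l1.
  by rewrite ger0_norm.
have u1 := cnorm_unitary uu.
rewrite cnormZE normc_half; have := ler_cnormD u (star u); rewrite cnorm_star; lra.
Qed.

End NormBound.

Section MatrixAlgebra.
Variables (R : realType) (A : algType R[i]) (n : nat).

(** Square matrices over a complex algebra, scaled by complex numbers: the
    canonical scaling of matrices is by entries. *)
Definition matrix_algebra : Type := 'M[A]_n.+1.

HB.instance Definition _ := GRing.NzRing.on matrix_algebra.

Implicit Types X Y : matrix_algebra.

Definition mx_scale (c : R[i]) X : matrix_algebra := map_mx ( *:%R c) X.

Lemma mx_scaleA (a b : R[i]) X : mx_scale a (mx_scale b X) = mx_scale (a * b) X.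
Proof. by apply/matrixP => i j; rewrite !mxE scalerA. Qed.

Lemma mx_scale1 : left_id 1 mx_scale.
Proof. by move=> X; apply/matrixP => i j; rewrite !mxE scale1r. Qed.

Lemma mx_scaleDr : right_distributive mx_scale +%R.
Proof. by move=> c X Y; apply/matrixP => i j; rewrite !mxE scalerDr. Qed.

Lemma mx_scaleDl X : {morph mx_scale^~ X : a b / a + b}.
Proof. by move=> a b; apply/matrixP => i j; rewrite !mxE scalerDl. Qed.

HB.instance Definition _ := GRing.Zmodule_isLmodule.Build R[i] matrix_algebra
  mx_scaleA mx_scale1 mx_scaleDr mx_scaleDl.

Lemma mx_scaleAl (c : R[i]) X Y : c *: (X * Y) = (c *: X) * Y.
Proof.
apply/matrixP => i j; rewrite !mxE scaler_sumr; apply: eq_bigr => k _.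
by rewrite !mxE scalerAl.
Qed.

HB.instance Definition _ := GRing.Lmodule_isLalgebra.Build R[i] matrix_algebra mx_scaleAl.

Lemma mx_scaleAr (c : R[i]) X Y : c *: (X * Y) = X * (c *: Y).
Proof.
apply/matrixP => i j; rewrite !mxE scaler_sumr; apply: eq_bigr => k _.
by rewrite !mxE scalerAr.
Qed.

HB.instance Definition _ := GRing.Lalgebra_isAlgebra.Build R[i] matrix_algebra mx_scaleAr.

End MatrixAlgebra.

Section MatrixStar.
Local Open Scope complex_scope.
Variables (R : realType) (A : cstarAlgType R) (n : nat).
Local Notation M := (matrix_algebra A n).
Implicit Types (X Y : M).

Definition mstar X : M := star_mx X.

Lemma mstarE X i j : mstar X i j = star (X j i).
Proof. by rewrite !mxE. Qed.

Lemma mstar_operation : star_operation mstar.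
Proof.
split.
- by move=> X; apply/matrixP => i j; rewrite !mstarE starK.
- by move=> X Y; apply/matrixP => i j; rewrite [RHS]mxE !mstarE mxE starD.
- by move=> c X; apply/matrixP => i j; rewrite [RHS]mxE !mstarE mxE starZ.
- move=> X Y; apply/matrixP => i j; rewrite mstarE !mxE star_sum.
  by apply: eq_bigr => k _; rewrite starM !mstarE.
Qed.

Lemma matrix_findim (B : set A) (phi : {scalar A}) :
  findim_star_subalgebra star B phi ->
  findim_star_subalgebra mstar (fun X : M => mx_over B X) (fun X => \sum_i phi (X i i)).
Proof.
move=> hB.
have B0 := fs0 hB.
have Bsum (F : 'I_n.+1 -> A) : (forall i, B (F i)) -> B (\sum_i F i).
  by move=> BF; elim/big_ind: _ => //; exact: (fsD hB).
have diag X : \sum_i phi ((mstar X * X) i i) = \sum_i \sum_j phi (star (X j i) * X j i).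
  apply: eq_bigr => i _; rewrite mxE raddf_sum; apply: eq_bigr => j _.
  by rewrite mstarE.
split.
- exact: mstar_operation.
- move=> i j; rewrite mxE; case: (i == j); rewrite ?mulr1n ?mulr0n //; exact: (fs1 hB).
- by move=> X Y BX BY i j; rewrite mxE; apply: (fsD hB).
- by move=> c X BX i j; rewrite mxE; apply: (fsZ hB).
- by move=> X Y BX BY i j; rewrite mxE; apply: Bsum => k; apply: (fsM hB).
- by move=> X BX i j; rewrite mstarE; apply: (fs_st hB).
- have [m [e eP]] := fs_span hB.
  pose T := ('I_n.+1 * 'I_n.+1 * 'I_m)%type.
  pose E (t : T) : M := \matrix_(i, j) (if (i, j) == t.1 then e t.2 else 0).
  exists #|{: T}|, (fun k => E (enum_val k)) => X BX.
  have /boolp.choice[c cE] : forall t : 'I_n.+1 * 'I_n.+1, exists c : 'I_m -> R[i],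
      X t.1 t.2 = \sum_k c k *: e k by move=> t; apply: eP; apply: BX.
  exists (fun k => c (enum_val k).1 (enum_val k).2).
  rewrite -(big_enum_val (A := {: T}) (fun t : T => c t.1 t.2 *: E t)).
  apply/matrixP => i j; rewrite summxE.
  rewrite -(pair_bigA _ (fun p k => (c p k *: E (p, k)) i j)) /= (bigD1 (i, j)) //=.
  rewrite [X in _ + X]big1 ?addr0 => [|p pij].
    by rewrite (cE (i, j)); apply: eq_bigr => k _; rewrite !mxE eqxx.
  by rewrite big1 // => k _; rewrite !mxE eq_sym (negPf pij) scaler0.
- by move=> X Y; rewrite -big_split; apply: eq_bigr => i _; rewrite mxE raddfD.
- by move=> c X; rewrite mulr_sumr; apply: eq_bigr => i _; rewrite mxE linearZ.
- by move=> X BX; rewrite diag; apply: sumr_ge0 => i _; apply: sumr_ge0 => j _; apply: (fs_ge0 hB).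
- move=> X BX; rewrite diag => /eqP; rewrite psumr_eq0; last first.
    by move=> i _; apply: sumr_ge0 => j _; apply: (fs_ge0 hB).
  move=> /allP X0; apply/matrixP => j i; rewrite mxE; apply: (fs_faithful hB) => //.
  have := X0 i (mem_index_enum i); rewrite /= psumr_eq0; last first.
    by move=> k _; apply: (fs_ge0 hB).
  by move=> /allP/(_ j (mem_index_enum j)) /eqP.
Qed.

End MatrixStar.

Section MatrixBounds.
Local Open Scope complex_scope.
Variables (R : realType) (A : cstarAlgType R) (n : nat) (B : set A) (phi : {scalar A}).
Hypothesis hB : findim_star_subalgebra star B phi.
Local Notation M := (matrix_algebra A n).
Local Notation BM := (fun X : M => mx_over B X).
Let Phi (X : M) : R[i] := \sum_i phi (X i i).
Let hM : findim_star_subalgebra (@mstar R A n) BM Phi := matrix_findim n hB.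

(** Compare the sums of the norms of all the entries of K y and of l y. *)
Lemma matrix_eigenvalue_bound (K y : M) (l e : R) :
    (forall i j, cnorm (K i j) <= e) -> y != 0 -> K * y = l%:C *: y ->
  `|l| <= n.+1%:R * e.
Proof.
move=> Ke y0 Ky; pose N := \sum_i \sum_j cnorm (y i j).
have N0 : 0 < N.
  rewrite lt_def; apply/andP; split; last first.
    by apply: sumr_ge0 => i _; apply: sumr_ge0 => j _; apply: cnorm_ge0.
  apply: contraNneq y0 => N0; apply/eqP/matrixP => i j; rewrite mxE.
  apply: cnorm0_eq0; apply/eqP; rewrite eq_le cnorm_ge0 andbT -N0 /N.
  rewrite (bigD1 i) //= (bigD1 j) //= -addrA lerDl addr_ge0 //.
    by apply: sumr_ge0 => k _; apply: cnorm_ge0.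
  by apply: sumr_ge0 => k _; apply: sumr_ge0 => k' _; apply: cnorm_ge0.
rewrite -(ler_pM2r N0).
have e0 : 0 <= e := le_trans (cnorm_ge0 _) (Ke 0 0).
have -> : `|l| * N = \sum_i \sum_j cnorm ((K * y) i j).
  rewrite Ky mulr_sumr; apply: eq_bigr => i _; rewrite mulr_sumr; apply: eq_bigr => j _.
  rewrite mxE cnormZE; congr (_ * _).
  by rewrite /= expr0n addr0 sqrtr_sqr.
have -> : n.+1%:R * e * N = \sum_(i < n.+1) \sum_j \sum_k e * cnorm (y k j).
  under eq_bigr do rewrite exchange_big /=.
  rewrite sumr_const card_ord -[RHS]mulr_natl -mulrA; congr (_ * _).
  by rewrite mulr_sumr; apply: eq_bigr => i _; rewrite mulr_sumr.
apply: ler_sum => i _; apply: ler_sum => j _; rewrite mxE.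
apply: le_trans (ler_cnorm_sum _ _ _) _; apply: ler_sum => k _.
apply: le_trans (ler_cnormM _ _) _; by apply: ler_wpM2r; [exact: cnorm_ge0 | exact: Ke].
Qed.

(** The squares of the entries of column j add up to 1, so that each of them
    lies between 0 and 1. *)
Lemma unitary_entry_bound (U : M) i j : BM U -> mstar U * U = 1 -> cnorm (U i j) <= 1.
Proof.
move=> BU UU; have : cnorm (star (U i j) * U i j) <= 1.
  apply: (cnorm_le1 hB).
  - by apply: (fsM hB) => //; apply: (fs_st hB).
  - by rewrite starM starK.
  - move=> y By.
    have pos k : 0 <= phi (star y * (star (U k j) * U k j * y)).
      have := fs_ge0 hB (fsM hB (BU k j) By).
      by rewrite starM !mulrA.
    rewrite pos /=.
    have -> : star y * y = \sum_k star y * (star (U k j) * U k j * y).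
      rewrite -mulr_sumr -mulr_suml; congr (_ * _); rewrite -[LHS]mul1r; congr (_ * _).
      have /matrixP/(_ j j) := UU; rewrite !mxE eqxx /= => UUj.
      apply: (etrans (esym UUj)); by apply: eq_bigr => k _; rewrite mstarE.
    rewrite raddf_sum (bigD1 i) //= lerDl; apply: sumr_ge0 => k _; exact: pos.
rewrite cstar_identity expr_le1 ?cnorm_ge0 //.
Qed.

(** By the spectral theorem S / e is the real part of a unitary matrix. *)
Lemma selfadjoint_entry_bound (S : M) (e : R) i j : BM S -> mstar S = S -> 0 < e ->
    (forall l (y : M), BM y -> y != 0 -> S * y = l%:C *: y -> `|l| <= e) ->
  cnorm (S i j) <= e.
Proof.
move=> BS sS e0 hS; pose X : M := (e^-1)%:C *: S.
have BX : BM X by apply: (fsZ hM).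
have sX : mstar X = X by rewrite (sopZr (fs_star hM)) sS.
have [s ann eig] := spectral_theorem hM BX sX.
have [l ls|U [BU UU UU' XU]] := fs_unitary hM BX sX ann.
  have [y [By y0 Xy]] := eig l ls.
  have : S * y = (e * l)%:C *: y.
    rewrite rmorphM -scalerA -Xy -scalerAl scalerA -rmorphM mulfV ?gt_eqF // scale1r //.
  move/(hS _ _ By y0); rewrite normrM gtr0_norm // -ler_pdivlMl // mulVf ?gt_eqF //.
have : cnorm (X i j) <= 1.
  rewrite XU mxE cnormZE normc_half mxE mstarE.
  have := unitary_entry_bound i j BU UU; have := unitary_entry_bound j i BU UU.
  have := ler_cnormD (U i j) (star (U j i)); rewrite cnorm_star; lra.
have e1 : 0 <= e^-1 by rewrite invr_ge0 ltW.
rewrite /X mxE cnormZE (normc_ge0_real e1).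
by rewrite ler_pdivrMl ?mulr1.
Qed.

(** The square root is 1/2-Hoelder continuous. The bounds concern single
    entries instead of the norm of a matrix, whence the factor n.+1. *)
Lemma matrix_sqrt_continuous (S S' c c' : M) (e d : R) i j :
    BM c -> mstar c = c -> c * c = S -> BM c' -> mstar c' = c' -> c' * c' = S' ->
    0 < e -> n.+1%:R * d <= e ^+ 2 ->
    (forall i j, cnorm ((S * S - S' * S') i j) <= d) ->
  cnorm ((S - S') i j) <= e.
Proof.
move=> Bc sc cS Bc' sc' cS' e0 de hd; have hst := fs_star hM.
have sS : mstar S = S by rewrite -cS (sopM hst) sc.
have sS' : mstar S' = S' by rewrite -cS' (sopM hst) sc'.
have BS : BM S by rewrite -cS; apply: (fsM hM).
have BS' : BM S' by rewrite -cS'; apply: (fsM hM).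
have BD (X Y : M) : BM X -> BM Y -> BM (X - Y).
  by move=> BX BY; apply: (fsD hM) => //; apply: (fsN hM).
apply: selfadjoint_entry_bound => //; first exact: BD.
  by rewrite (sopB hst) sS sS'.
move=> l y By y0 Sy; pose K := S * S - S' * S'.
have BK : BM K by apply: BD; apply: (fsM hM).
have sK : mstar K = K by rewrite (sopB hst) !(sopM hst) sS sS'.
apply: (sqrt_difference_eigenvalue hM Bc sc cS Bc' sc' cS' (ltW e0) By y0 Sy).
rewrite -/K.
have up (K' : M) : BM K' -> mstar K' = K' -> (forall i j, cnorm (K' i j) <= d) ->
    Phi (mstar y * (K' * y)) <= (e ^+ 2)%:C * Phi (mstar y * y).
  move=> BK' sK' hK'; apply: (fs_eigen_bound hM) => // m v Bv v0 Kv.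
  apply: le_trans (ler_norm _) _; apply: le_trans de.
  exact: matrix_eigenvalue_bound Kv.
have h1 := up K BK sK hd.
have h2 : Phi (mstar y * (- K * y)) <= (e ^+ 2)%:C * Phi (mstar y * y).
  apply: up; [exact: (fsN hM) | by rewrite (sopN hst) sK | by move=> a b; rewrite mxE cnormN].
have hreal : Phi (mstar y * (K * y)) \is Num.real.
  have q0 : 0 <= Phi (mstar y * y) by apply: (fs_ge0 hM).
  rewrite -[Phi _](subrK ((e ^+ 2)%:C * Phi (mstar y * y))) rpredD //.
    by rewrite -opprB rpredN ger0_real // subr_ge0.
  by rewrite ger0_real // mulr_ge0 // ler0c sqr_ge0.
rewrite real_ler_norml // h1 andbT.
have : Phi (mstar y * (- K * y)) = - Phi (mstar y * (K * y)).
  by rewrite mulNr mulrN -scaleN1r (fs_PhiZ hM) mulN1r.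
move: h2 => /[swap] ->; by rewrite lerNl.
Qed.

End MatrixBounds.

Section FourthRoot.
Local Open Scope complex_scope.
Variables (R : realType) (W : algType R[i]) (st : W -> W) (B : set W) (Phi : W -> R[i]).
Hypothesis hB : findim_star_subalgebra st B Phi.

(** The positivity of the square root c * c is visible: it is a square. *)
Lemma fs_fourth_root (x : W) : B x -> st x = x ->
    (forall y, B y -> 0 <= Phi (st y * (x * y))) ->
  exists c, [/\ B c, st c = c & (c * c) * (c * c) = x].
Proof.
move=> Bx sx x0; have [s ann eig] := spectral_theorem hB Bx sx.
exists (fcalc s (fun l => (Num.sqrt (Num.sqrt l))%:C) x); split; first exact: (fs_fcalc hB).
  by rewrite (sop_fcalc (fs_star hB)) //; apply: eq_fcalc => l _; rewrite /= oppr0.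
rewrite !fcalcM // -[RHS](fcalc_id ann); apply: eq_fcalc => l ls.
have [y [By y0 xy]] := eig l ls.
have l0 : 0 <= l by apply: (eigenvalue_ge0 hB By y0 xy); apply: x0.
by rewrite -!rmorphM -!expr2 sqr_sqrtr ?sqrtr_ge0 // sqr_sqrtr.
Qed.

End FourthRoot.

Section SumsOfSquares.
Local Open Scope complex_scope.
Variables (R : realType) (A : cstarAlgType R) (phi : {scalar A}).
Variables (B : set A) (F : nat -> set A).
Hypothesis hB : cstar_subalgebra B.
Hypothesis hF : forall m, findim_star_subalgebra star (F m) phi.
Hypothesis F_mono : forall m m', (m <= m')%N -> F m `<=` F m'.
Hypothesis F_sub : forall m, F m `<=` B.
Hypothesis F_dense : forall x, B x -> forall e : R, 0 < e ->
  exists m, exists2 y, F m y & cnorm (x - y) < e.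

Definition tends_mx (n : nat) (u : nat -> matrix_algebra A n) (X : matrix_algebra A n) :=
  forall i j, tends (fun k => u k i j) (X i j).

Lemma tends_mx_star n u X : @tends_mx n u X -> tends_mx (fun k => mstar (u k)) (mstar X).
Proof.
move=> uX i j; rewrite mstarE; have := tends_star (uX j i); congr tends.
by apply: funext => k; rewrite mstarE.
Qed.

Lemma tends_mxM n u v X Y : @tends_mx n u X -> tends_mx v Y ->
  tends_mx (fun k => u k * v k) (X * Y).
Proof.
move=> uX vY i j; rewrite mxE.
have := tends_sum (index_enum 'I_n.+1) (fun l => tendsM (uX i l) (vY l j)); congr tends.
by apply: funext => k; rewrite mxE.
Qed.

Lemma tends_mx_sum n r (u : 'I_r -> nat -> matrix_algebra A n) X :
  (forall l, tends_mx (u l) (X l)) -> tends_mx (fun k => \sum_l u l k) (\sum_l X l).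
Proof.
move=> uX i j; rewrite summxE.
have := tends_sum (index_enum 'I_r) (fun l => uX l i j); congr tends.
by apply: funext => k; rewrite summxE.
Qed.

Lemma tends_mx_cauchy n u X : @tends_mx n u X -> forall e : R, 0 < e ->
  exists N, forall k k', (N <= k)%N -> (N <= k')%N -> forall i j, cnorm ((u k - u k') i j) < e.
Proof.
move=> uX e e0; have e2 : 0 < e / 2 by rewrite divr_gt0.
have /boolp.choice[N NP] : forall p : 'I_n.+1 * 'I_n.+1, exists N, forall k, (N <= k)%N ->
    cnorm (u k p.1 p.2 - X p.1 p.2) < e / 2 by move=> p; apply: uX.
exists (\max_p N p)%N => k k' hk hk' i j; rewrite !mxE.
have h1 := NP (i, j) k (leq_trans (leq_bigmax (i, j)) hk).
have h2 := NP (i, j) k' (leq_trans (leq_bigmax (i, j)) hk').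
have := ler_cnormD (u k i j - X i j) (X i j - u k' i j).
by rewrite subrKA (cnormB (X i j)) /= in h1 h2 *; lra.
Qed.

Lemma simultaneous_approximation (T : finType) (x : T -> A) (e : R) :
    (forall t, B (x t)) -> 0 < e ->
  exists m, exists y : T -> A, forall t, F m (y t) /\ cnorm (x t - y t) < e.
Proof.
move=> Bx e0; have /boolp.choice[f fP] : forall t, exists my : nat * A,
    F my.1 my.2 /\ cnorm (x t - my.2) < e.
  by move=> t; have [m [y Fy xy]] := F_dense (Bx t) e0; exists (m, y).
exists (\max_t (f t).1)%N, (fun t => (f t).2) => t; have [h1 h2] := fP t; split=> //.
by apply: F_mono h1; exact: leq_bigmax.
Qed.

(** Sums of squares of matrices over the finite-dimensional F m have square
    roots; along approximations from the F m these roots form a Cauchy sequence. *)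
Lemma sum_of_squares_is_square (n r : nat) (Z : 'I_r -> 'M[A]_n) :
  (forall k, mx_over B (Z k)) -> mx_positive B (\sum_k star_mx (Z k) *m Z k).
Proof.
case: n Z => [|n] Z BZ.
  by exists 0 => [[]//|]; apply/matrixP => -[].
pose M := matrix_algebra A n.
pose x (t : 'I_r * ('I_n.+1 * 'I_n.+1)) := Z t.1 t.2.1 t.2.2.
have half0 : 0 < 2^-1 :> R by rewrite invr_gt0.
have /boolp.choice[g gP] : forall j : nat, exists my : nat * ('I_r * ('I_n.+1 * 'I_n.+1) -> A),
    forall t, F my.1 (my.2 t) /\ cnorm (x t - my.2 t) < 2^-1 ^+ j.
  move=> j; have [t|m [y yP]] := @simultaneous_approximation _ x _ _ (exprn_gt0 j half0).
    exact: BZ.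
  by exists (m, y).
pose Zj k j : M := \matrix_(a, b) (g j).2 (k, (a, b)).
have FZ k j : mx_over (F (g j).1) (Zj k j).
  by move=> a b; rewrite mxE; have [] := gP j (k, (a, b)).
have hM m := matrix_findim n (hF m); have hst := @mstar_operation R A n.
pose H j : M := \sum_k mstar (Zj k j) * Zj k j.
have FH j : mx_over (F (g j).1) (H j).
  rewrite /H; elim/big_ind: _ => [|X Y FX FY|k _].
  - exact: (fs0 (hM _)).
  - exact: (fsD (hM _) FX FY).
  - by apply: (fsM (hM _)); [apply: (fs_st (hM _)); exact: FZ | exact: FZ].
have sH j : mstar (H j) = H j.
  by rewrite (sop_sum hst); apply: eq_bigr => k _; rewrite (sopM hst) (sopK hst).
have /boolp.choice[c cP] : forall j, exists c : M,
    [/\ mx_over (F (g j).1) c, mstar c = c & (c * c) * (c * c) = H j].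
  move=> j; apply: (fs_fourth_root (hM (g j).1)) => // y Fy.
  rewrite mulr_suml mulr_sumr.
  rewrite (big_morph _ (fs_PhiD (hM (g j).1)) (fs_Phi0 (hM (g j).1))).
  apply: sumr_ge0 => k _.
  have := fs_ge0 (hM (g j).1) (fsM (hM (g j).1) (FZ k j) Fy).
  by rewrite (sopM hst) !mulrA.
pose S j : M := c j * c j.
pose X k : M := Z k.
have limZ k : tends_mx (Zj k) (X k).
  move=> a b; apply: (tends_le (f := fun j => 2^-1 ^+ j) ler01) => [j|]; last exact: exists_half_pow_lt.
  by rewrite mxE mul1r cnormB ltW //; have [] := gP j (k, (a, b)).
have limH : tends_mx H (\sum_k mstar (X k) * X k).
  apply: tends_mx_sum => k; apply: tends_mxM => //; exact: tends_mx_star.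
have cauchyS e : 0 < e -> exists N, forall k k', (N <= k)%N -> (N <= k')%N ->
    forall a b, cnorm (S k a b - S k' a b) < e.
  move=> e0; have e2 : 0 < e / 2 by rewrite divr_gt0.
  have d0 : 0 < (e / 2) ^+ 2 / n.+1%:R by rewrite divr_gt0 // exprn_gt0.
  have [N NP] := tends_mx_cauchy limH d0; exists N => k k' Nk Nk' a b.
  pose m := maxn (g k).1 (g k').1.
  have [Fc sc cc] := cP k; have [Fc' sc' cc'] := cP k'.
  have up j (Y : M) : ((g j).1 <= m)%N -> mx_over (F (g j).1) Y -> mx_over (F m) Y.
    by move=> jm FY i l; apply: F_mono jm _ _; apply: FY.
  have := @matrix_sqrt_continuous R A n (F m) phi (hF m) (S k) (S k') (c k) (c k')
    (e / 2) ((e / 2) ^+ 2 / n.+1%:R) a b (up _ _ (leq_maxl _ _) Fc) sc erefl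
    (up _ _ (leq_maxr _ _) Fc') sc' erefl e2.
  rewrite mulrC divfK ?pnatr_eq0 // => /(_ (lexx _)); rewrite !mxE => h.
  apply: le_lt_trans (h _) _; last by lra.
  by move=> i j; rewrite /S cc cc'; apply/ltW/NP.
have /boolp.choice[L LP] : forall p : 'I_n.+1 * 'I_n.+1, exists y, tends (fun k => S k p.1 p.2) y.
  move=> p; have [|y yP] := @cnorm_complete _ _ (fun k => S k p.1 p.2).
    by move=> e e0; have [N NP] := cauchyS e e0; exists N => k k' Nk Nk'; apply: NP.
  by exists y.
pose Y : M := \matrix_(a, b) L (a, b).
have limS : tends_mx S Y by move=> a b; rewrite mxE; apply: (LP (a, b)).
exists Y.
  move=> a b; apply: (cstar_closed_tends (csub_closed hB) _ (limS a b)) => j.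
  have [Fc _ _] := cP j; apply: (F_sub (m := (g j).1)).
  exact: (fsM (hM (g j).1) Fc Fc).
have limYY := tends_mxM (tends_mx_star limS) limS.
apply/matrixP => a b; apply: (tends_unique (limH a b)); have := limYY a b.
congr tends; apply: funext => j; have [_ sc cc] := cP j.
by rewrite (sopM hst) sc cc.
Qed.

End SumsOfSquares.

(** * Nonnegative sums of resolvents *)

Section RealLemma.
Variable R : realType.
Implicit Types (t x : R) (P : seq (R * R)).

Definition log_sum P x : R := \sum_(k <- P) k.2 * ln (k.1 + x).
Definition resolvent_sum P x : R := \sum_(k <- P) k.2 * (k.1 + x)^-1.

Lemma is_derive_log_sum P x : (forall k, k \in P -> 0 < k.1) -> 0 <= x ->
  is_derive x 1 (log_sum P) (resolvent_sum P x).
Proof.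
move=> P0 x0; elim: P P0 => [|k P IH] P0.
  have -> : log_sum [::] = cst 0 by apply: funext => y; rewrite /log_sum big_nil.
  by rewrite /resolvent_sum big_nil; exact: is_derive_cst.
have -> : log_sum (k :: P) = (k.2 *: (@ln R \o (fun y => k.1 + y))) + log_sum P.
  by apply: funext => y; rewrite /log_sum big_cons.
rewrite /resolvent_sum big_cons; apply: is_deriveD; last first.
  by apply: IH => j jP; apply: P0; rewrite inE jP orbT.
apply: is_deriveZ.
have k0 : 0 < k.1 + x by rewrite ltr_pwDl // P0 // mem_head.
have h1 : is_derive x (1 : R) (fun y : R => k.1 + y) 1.
  rewrite -[X in is_derive _ _ _ X]add0r; apply: is_deriveD.
have := is_derive1_comp (f := @ln R) (g := fun y => k.1 + y) (is_derive1_ln k0) h1.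
by rewrite mulr1.
Qed.

Lemma log_sum_mono P a b : (forall k, k \in P -> 0 < k.1) ->
    (forall x, 0 < x -> 0 <= resolvent_sum P x) -> 0 <= a -> a < b ->
  log_sum P a <= log_sum P b.
Proof.
move=> P0 F0 a0 ab.
have [x||c] := @MVT R (log_sum P) (resolvent_sum P) a b ab.
- by rewrite in_itv /= => /andP[ax _]; apply: is_derive_log_sum => //; lra.
- apply: derivable_within_continuous => x; rewrite in_itv /= => /andP[ax _].
  by have [] := is_derive_log_sum P0 (le_trans a0 ax).
rewrite in_itv /= => /andP[ac _] E; rewrite -subr_ge0 E mulr_ge0 ?F0 ?subr_ge0 ?ltW //.
exact: le_lt_trans a0 ac.
Qed.

(** The function sum a ln(r + x) has derivative sum a / (r + x); it vanishes at
    0 and at infinity, so if its derivative is nonnegative it is constant. *)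
Lemma resolvent_sum_eq0 P t : (forall k, k \in P -> 0 < k.1) ->
    \sum_(k <- P) k.2 = 0 -> \sum_(k <- P) k.2 * ln k.1 = 0 ->
    (forall x, 0 < x -> 0 <= resolvent_sum P x) -> 0 < t ->
  resolvent_sum P t = 0.
Proof.
move=> P0 S0 L0 F0 t0.
have G0 : log_sum P 0 = 0.
  by rewrite -[RHS]L0; apply: eq_bigr => k _; rewrite addr0.
have Gge0 x : 0 < x -> 0 <= log_sum P x by move=> x0; rewrite -G0 log_sum_mono.
pose K := \sum_(k <- P) `|k.2| * k.1.
have K0 : 0 <= K by rewrite /K big_seq; apply: sumr_ge0 => k /P0 /ltW ?; rewrite mulr_ge0.
have Gup x : 0 < x -> log_sum P x <= K / x.
  move=> x0; have -> : log_sum P x = \sum_(k <- P) k.2 * ln (1 + k.1 / x).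
    have -> : log_sum P x = log_sum P x - (\sum_(k <- P) k.2) * ln x by rewrite S0 mul0r subr0.
    rewrite mulr_suml -sumrB big_seq [RHS]big_seq; apply: eq_bigr => k /P0 k0.
    rewrite -mulrBr -ln_div ?posrE ?addr_gt0 //; congr (_ * ln _).
    by rewrite mulrDl divff ?gt_eqF // addrC.
  rewrite /K mulr_suml big_seq [leRHS]big_seq; apply: ler_sum => k /P0 k0.
  have y0 : 0 < k.1 / x by rewrite divr_gt0.
  have l0 : 0 <= ln (1 + k.1 / x) by rewrite ln_ge0 // lerDl ltW.
  have l1 : ln (1 + k.1 / x) <= k.1 / x by apply: le_ln1Dx; lra.
  by rewrite -mulrA; apply: le_trans (ler_wpM2r l0 (ler_norm _)) _; rewrite ler_wpM2l.
have Geq0 x : 0 < x -> log_sum P x = 0.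
  move=> x0; apply/eqP; rewrite eq_le Gge0 // andbT.
  apply/ler_addgt0Pl => e e0; rewrite addr0.
  (* The bound K / y is smaller than e. *)
  pose y := x + 1 + K / e.
  have Ke : 0 <= K / e by rewrite divr_ge0 // ltW.
  have y0 : 0 < y by rewrite /y; lra.
  apply: (@le_trans _ _ (log_sum P y)); first by apply: log_sum_mono => //; rewrite /y; lra.
  apply: le_trans (Gup _ y0) _; rewrite ler_pdivrMr // mulrC -ler_pdivrMr //.
  by rewrite /y; lra.
have h1 := is_derive_log_sum P0 (ltW t0).
have h2 : is_derive t 1 (log_sum P) 0.
  have h0 : is_derive t (1 : R) (cst (0 : R) : R -> R) 0 by apply: is_derive_cst.
  apply: near_eq_is_derive h0.
  by near=> x; rewrite Geq0 //; near: x; exact: lt_nbhsr.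
by rewrite -(@derive_val _ _ _ _ _ _ _ h1) (@derive_val _ _ _ _ _ _ _ h2).
Unshelve. all: by end_near.
Qed.

End RealLemma.

(** * Density matrices *)

Section Density.
Local Open Scope complex_scope.
Variables (R : realType) (A : cstarAlgType R) (Theta : {lrmorphism A -> A}).
Hypothesis Theta_star : forall x, Theta (star x) = star (Theta x).
Hypothesis ThetaK : forall x, Theta (Theta x) = x.
Variables (phi : {scalar A}) (hphi : state phi).
Hypothesis phi_even : forall x, phi (Theta x) = phi x.
Implicit Types (x y u v g : A) (B S : set A) (s : seq A) (ps : seq (A * A)).
Local Notation tau := (tau Theta phi).
Local Notation majorana_ext := (majorana_ext Theta).

(** The generators come in pairs because the trace is unique only when their
    number is even. *)
Definition unpair ps : seq A := flatten [seq [:: p.1; p.2] | p <- ps].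

Lemma unpair_cat ps ps' : unpair (ps ++ ps') = unpair ps ++ unpair ps'.
Proof. by rewrite /unpair map_cat flatten_cat. Qed.

Definition region s : set A := cstar_generated (adjoin s set0).

Lemma region_subalgebra s : cstar_subalgebra (region s).
Proof. exact: cstar_generated_subalgebra. Qed.

Lemma tauB s x y : tau s (x - y) = tau s x - tau s y.
Proof. by rewrite -scaleN1r tauD tauZ mulN1r. Qed.

Section OneRegion.
Variables (ps : seq (A * A)).
Let s := unpair ps.
Hypothesis hs : majorana_ext s set0.
Hypothesis faith : faithful_on (region s) phi.
Let sub : cstar_subalgebra (region s) := region_subalgebra s.
Let hB : findim_star_subalgebra star (region s) phi :=
  generated_findim Theta_star ThetaK hphi hs faith.
Let hT : findim_star_subalgebra star (region s) (tau s) :=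
  generated_findim_tau Theta_star ThetaK hphi hs faith.

Lemma normalized_traceE x : region s x -> normalized_trace (region s) x = tau s x.
Proof.
move=> sx; rewrite /normalized_trace; case: xgetP => [tr _ /= htr|].
  exact: (tau_unique Theta_star ThetaK hphi hs htr).
by move=> /(_ (tau s)) []; apply: tau_tracial.
Qed.

Lemma density_unique x x' : region s x -> region s x' ->
  (forall y, region s y -> tau s (y * x) = tau s (y * x')) -> x = x'.
Proof.
move=> sx sx' h; apply/eqP; rewrite -subr_eq0; apply/eqP.
have sd : region s (x - x') by apply: (csubB sub).
apply: (fs_faithful hT sd).
rewrite mulrBr tauB h ?subrr //.
exact: (csub_star sub).
Qed.

(** The density is determined by phi, so it inherits the symmetries of phi: it
    is self-adjoint because phi is, and even because phi is. Its eigenvalues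
    are positive because phi is faithful. *)
Lemma density_spec (D := adjusted_density phi (region s)) :
  [/\ region s D, star D = D, forall y, region s y -> phi y = tau s (y * D),
      Theta D = D & exists2 l, annihilates l D & {in l, forall r, 0 < r}].
Proof.
have [D0 sD0 D0E] := tau_density Theta_star ThetaK hphi hs (fs_PhiD hB) (fs_PhiZ hB).
have sD0s : star D0 = D0.
  apply: density_unique => // [|y sy]; first exact: (csub_star sub).
  have ssy := csub_star sub sy.
  rewrite -[y in LHS]starK -starM (tau_star Theta_star hphi _ hs).
  rewrite (tauC Theta_star ThetaK hphi hs sD0 ssy) -D0E // (state_star hphi) conjcK.
  exact: D0E.
have [l ann eig] := spectral_theorem hT sD0 sD0s.
have l0 : {in l, forall r, 0 < r}.
  move=> r /eig[y [sy y0 Dy]]; have ssy := csub_star sub sy.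
  have : 0 < phi (star (star y) * star y).
    apply: (fs_gt0 hB ssy); apply: contraNneq y0 => h.
    by rewrite -[y]starK h star0.
  rewrite starK D0E; last exact: (csubM sub).
  rewrite -mulrA (tauC Theta_star ThetaK hphi hs) //; last exact: (csubM sub).
  rewrite -mulrA (eigenvalue_Phi hT Dy) pmulr_lgt0 ?ltcR //.
  exact: (fs_gt0 hT).
have DP : is_adjusted_density phi (region s) D0.
  split=> // [|y sy].
    have [c0 sc cc] := fs_sqrt hB sD0 sD0s ann (fun r rl => ltW (l0 r rl)).
    by exists (fcalc l (fun r => (Num.sqrt r)%:C) D0); rewrite sc cc.
  by rewrite normalized_traceE ?D0E //; apply: (csubM sub).
have DE : D = D0.
  rewrite /D /adjusted_density; case: xgetP => [x _ [sx _ xE]|/(_ D0)//].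
  apply: density_unique => // y sy.
  by rewrite -D0E // xE // normalized_traceE //; apply: (csubM sub).
have Ts x : region s x -> region s (Theta x).
  by apply: Theta_generated => //; apply: majorana_ext_majoranas.
rewrite DE; split=> //; last by exists l.
apply: density_unique => // [|y sy]; first exact: Ts.
rewrite -[LHS](tau_Theta Theta_star ThetaK hphi hs); last first.
  by apply: (csubM sub) => //; apply: Ts.
by rewrite rmorphM /= ThetaK -!D0E ?phi_even //; apply: Ts.
Qed.

Lemma density_eq x : region s x -> (forall y, region s y -> phi y = tau s (y * x)) ->
  adjusted_density phi (region s) = x.
Proof.
move=> sx xE; have [sD _ DE _ _] := density_spec.
by apply: density_unique => // y sy; rewrite -DE // -xE.
Qed.

End OneRegion.

Lemma tau_region ps ps' x : let s := unpair ps in let s' := unpair ps' in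
  majorana_ext s set0 -> majorana_ext s' set0 -> region s = region s' ->
  region s x -> tau s x = tau s' x.
Proof.
move=> s s' hs hs' ss sx; apply: (tau_unique Theta_star ThetaK hphi hs') => //.
  by rewrite -/(region _) -ss; apply: tau_tracial.
by rewrite -/(region _) -ss.
Qed.

End Density.

Section MoreRegions.
Local Open Scope complex_scope.
Variables (R : realType) (A : cstarAlgType R).
Implicit Types (x y : A) (s : seq A) (S : set A).

Lemma lrmorph_horner (f : {lrmorphism A -> A}) x p :
  f (horner_alg x p) = horner_alg (f x) p.
Proof.
elim/poly_ind: p => [|p c IH]; first by rewrite !rmorph0.
by rewrite !(rmorphD, rmorphM) /= !horner_algC !horner_algX linearZ /= rmorph1 IH.
Qed.

Lemma lrmorph_annihilates (f : {lrmorphism A -> A}) l x :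
  annihilates l x -> annihilates l (f x).
Proof. by move=> [ul h]; split=> //; rewrite -lrmorph_horner h rmorph0. Qed.

Lemma lrmorph_eigenproj (f : {lrmorphism A -> A}) l r x :
  f (eigenproj l r x) = eigenproj l r (f x).
Proof. exact: lrmorph_horner. Qed.

Lemma lrmorph_fcalc (f : {lrmorphism A -> A}) l h x :
  f (fcalc l h x) = fcalc l h (f x).
Proof.
rewrite /fcalc raddf_sum; apply: eq_bigr => r _.
by rewrite /= linearZ /= lrmorph_eigenproj.
Qed.

Lemma adjoin_sub s s' S S' : {subset s <= s'} -> S `<=` S' -> adjoin s S `<=` adjoin s' S'.
Proof. by move=> ss SS x [xs|Sx]; [left; apply: ss | right; apply: SS]. Qed.

Lemma region_sub s s' : {subset s <= s'} -> region s `<=` region s'.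
Proof. by move=> ss; apply: cstar_generated_sub; apply: adjoin_sub. Qed.

Lemma region_eq s s' : s =i s' -> region s = region s'.
Proof.
by move=> ss; apply/seteqP; split; apply: region_sub => x; rewrite ss.
Qed.

Lemma majorana_ext_sub (Theta : {lrmorphism A -> A}) s S S' : S' `<=` S ->
  majorana_ext Theta s S -> majorana_ext Theta s S'.
Proof.
move=> SS; elim: s => [|g s IH] /=; first by move=> h x /SS /h.
move=> [mg gs /IH hs]; split=> // x xs; apply: gs.
by apply: adjoin_sub xs.
Qed.

End MoreRegions.

(** * Functions of the ratio of two densities *)

Section RatioInverse.
Variables (R : realType) (W : algType R[i]).
Local Open Scope complex_scope.
Variables (l : seq R) (x : W).
Hypothesis ann : annihilates l x.
Hypothesis l0 : {in l, forall r, 0 < r}.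

Definition inv_of : W := fcalc l (fun r => (r%:C)^-1) x.

Let r0 r : r \in l -> r%:C != 0.
Proof. by move=> /l0 h; rewrite -(rmorph0 (real_complex R)) (inj_eq (@complexI R)) gt_eqF. Qed.

Lemma inv_of_l : inv_of * x = 1.
Proof.
rewrite -[X in _ * X](fcalc_id ann) fcalcM // -(fcalc1 ann).
by apply: eq_fcalc => r rl; rewrite mulVf ?r0.
Qed.

Lemma inv_of_r : x * inv_of = 1.
Proof.
rewrite -[X in X * _](fcalc_id ann) fcalcM // -(fcalc1 ann).
by apply: eq_fcalc => r rl; rewrite mulfV ?r0.
Qed.

Lemma ratio_pow q n (y : W) : annihilates l y ->
  ratio_calc l (fun r => r%:C ^+ n) y q x = y ^+ n * q * inv_of ^+ n.
Proof.
move=> anny.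
rewrite (ratio_calcE (g := fun r => r%:C ^+ n) (h := fun r => (r%:C)^-1 ^+ n)); last first.
  by move=> r m rl ml /=; rewrite fmorph_div exprMn.
congr (_ * _ * _).
  elim: n => [|n IH]; first by rewrite fcalc1.
  rewrite !exprS -IH -[X in _ = X * _](fcalc_id anny) fcalcM //.
  by apply: eq_fcalc => r _; rewrite exprS.
elim: n => [|n IH]; first by rewrite fcalc1.
by rewrite !exprS -IH fcalcM //; apply: eq_fcalc => r _; rewrite exprS.
Qed.

Lemma ratio_phase q t (y : W) :
  ratio_calc l (unit_phase t) y q x = fcalc l (unit_phase t) y * q * fcalc l (unit_phase (- t)) x.
Proof.
by apply: ratio_calcE => r m rl ml; rewrite unit_phase_div ?l0.
Qed.

Lemma fcalc_phaseN t : fcalc l (unit_phase t) x * fcalc l (unit_phase (- t)) x = 1.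
Proof.
rewrite fcalcM // -(fcalc1 ann); apply: eq_fcalc => r _.
by rewrite unit_phaseD subrr unit_phase0.
Qed.

End RatioInverse.

Section RatioSums.
Variables (R : realType) (W : algType R[i]).
Local Open Scope complex_scope.
Implicit Types (l : seq R) (x y q : W).

Lemma double_fcalc l (g h : R -> R[i]) x q y :
  \sum_(r <- l) \sum_(m <- l) (g r * h m) *: (eigenproj l r x * q * eigenproj l m y)
    = fcalc l g x * q * fcalc l h y.
Proof.
rewrite mulr_suml mulr_suml; apply: eq_bigr => r _; rewrite mulr_sumr.
by apply: eq_bigr => m _; rewrite -!scalerAl -scalerAr scalerA.
Qed.

Lemma ratio_calcD l f g h x y : annihilates l x -> annihilates l y ->
    {in l &, forall r m, f (r / m) = g r + h m} ->
  ratio_calc l f x 1 y = fcalc l g x + fcalc l h y.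
Proof.
move=> annx anny fE.
transitivity (\sum_(r <- l) \sum_(m <- l) ((g r * 1) *: (eigenproj l r x * 1 * eigenproj l m y)
    + (1 * h m) *: (eigenproj l r x * 1 * eigenproj l m y))).
  apply: eq_big_seq => r rl; apply: eq_big_seq => m ml.
  by rewrite fE // !mulr1 mul1r scalerDl.
under eq_bigr do rewrite big_split.
by rewrite big_split !double_fcalc !fcalc1 // !mulr1 mul1r.
Qed.

Lemma eigenproj_mul l r x : annihilates l x -> r \in l ->
  eigenproj l r x * x = r%:C *: eigenproj l r x.
Proof.
move=> ann rl; rewrite -(mul_eigenproj ann rl) /eigenproj.
by rewrite -[X in _ * X = _]horner_algX -[X in _ = X * _]horner_algX -!rmorphM mulrC.
Qed.

(** On the component of eigenvalues r and m the map z |-> x z y^-1 is the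
    multiplication by r / m. *)
Lemma ratio_shift l f x q y : annihilates l x -> annihilates l y ->
    {in l, forall r, 0 < r} ->
  x * ratio_calc l f x q y * inv_of l y = ratio_calc l (fun r => r%:C * f r) x q y.
Proof.
move=> annx anny l0; rewrite [x * _]mulr_sumr mulr_suml; apply: eq_big_seq => r rl.
rewrite [x * _]mulr_sumr mulr_suml; apply: eq_big_seq => m ml.
have inv : eigenproj l m y * inv_of l y = (m%:C)^-1 *: eigenproj l m y.
  have m0 : m%:C != 0.
    by rewrite -(rmorph0 (real_complex R)) (inj_eq (@complexI R)) gt_eqF ?l0.
  rewrite -[eigenproj l m y in LHS](scalerK m0) -(eigenproj_mul anny ml) -scalerAl.
  by rewrite -mulrA (inv_of_r anny l0) mulr1.
rewrite -scalerAr -scalerAl !mulrA (mul_eigenproj annx rl) -[X in _ *: X = _]mulrA inv.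
by rewrite -!scalerAl -!scalerAr !scalerA; congr (_ *: _); rewrite fmorph_div /=; ring.
Qed.

End RatioSums.

(** * Three adjacent regions *)

Section ThreeRegions.
Local Open Scope complex_scope.
Variables (R : realType) (A : cstarAlgType R) (Theta : {lrmorphism A -> A}).
Hypothesis Theta_star : forall x, Theta (star x) = star (Theta x).
Hypothesis ThetaK : forall x, Theta (Theta x) = x.
Variables (phi : {scalar A}) (hphi : state phi).
Hypothesis phi_even : forall x, phi (Theta x) = phi x.
Implicit Types (x y u v g : A) (S : set A) (s : seq A) (ps : seq (A * A)).
Local Notation tau := (tau Theta phi).
Local Notation majorana_ext := (majorana_ext Theta).
Local Notation forgets := (forgets Theta).

Definition region_density s := adjusted_density phi (region s).

Lemma majorana_ext_drop s1 s2 S : majorana_ext (s1 ++ s2) S -> majorana_ext s2 S.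
Proof. by move=> /majorana_ext_cat[]. Qed.

(** Forgetting is a module map over the smaller algebra and preserves the
    trace. *)
Lemma forgets_density ps1 ps2 (s1 := unpair ps1) (s2 := unpair ps2) :
    majorana_ext (s1 ++ s2) set0 -> faithful_on (region (s1 ++ s2)) phi ->
  forgets s1 (region_density (s1 ++ s2)) = region_density s2.
Proof.
move=> hs faith; have [h1 h2] := (majorana_ext_cat Theta s1 s2 set0).1 hs.
have inc : region s2 `<=` region (s1 ++ s2).
  by apply: region_sub => x xs; rewrite mem_cat xs orbT.
have := @density_spec _ _ _ Theta_star ThetaK _ hphi phi_even (ps1 ++ ps2).
rewrite unpair_cat -/s1 -/s2 => /(_ hs faith) [sD _ DE _ _].
symmetry; apply: (density_eq Theta_star ThetaK hphi phi_even h2).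
- by move=> x /inc; apply: faith.
- by apply: (forgets_generated Theta_star ThetaK h1); rewrite -adjoin_cat.
move=> y sy; rewrite (DE _ (inc _ sy)) /tau forgets_cat.
by rewrite (forgetsMl Theta_star h1).
Qed.

(** The regions A, B and C stand for the past, the present site and the next
    site of a chain; M is their union and N the union of A and B. *)
Variables pA pB pC : seq (A * A).
Let sA := unpair pA. Let sB := unpair pB. Let sC := unpair pC.
Hypothesis hM : majorana_ext (sA ++ (sB ++ sC)) set0.
Hypothesis hM' : majorana_ext (sC ++ (sA ++ sB)) set0.
Hypothesis faith : faithful_on (region (sA ++ (sB ++ sC))) phi.

Let rM := region (sA ++ (sB ++ sC)).
Let rN := region (sA ++ sB).
Let rBC := region (sB ++ sC).
Let rB := region sB.

Let DM := region_density (sA ++ (sB ++ sC)).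
Let DN := region_density (sA ++ sB).
Let DBC := region_density (sB ++ sC).
Let DB := region_density sB.

Let perm_M : region (sC ++ (sA ++ sB)) = rM.
Proof. by apply: region_eq => x; rewrite !mem_cat orbC -orbA. Qed.

Let NM : rN `<=` rM.
Proof. by apply: region_sub => x; rewrite !mem_cat => /orP[->|->]; rewrite ?orbT. Qed.
Let BCM : rBC `<=` rM.
Proof. by apply: region_sub => x; rewrite !mem_cat => ->; rewrite orbT. Qed.
Let BM : rB `<=` rM.
Proof. by apply: region_sub => x; rewrite !mem_cat => ->; rewrite orbT. Qed.
Let faithN : faithful_on rN phi. Proof. by move=> x /NM; apply: faith. Qed.
Let faithBC : faithful_on rBC phi. Proof. by move=> x /BCM; apply: faith. Qed.
Let faithB : faithful_on rB phi. Proof. by move=> x /BM; apply: faith. Qed.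

Let hN : majorana_ext (sA ++ sB) set0 := majorana_ext_drop hM'.
Let hBC : majorana_ext (sB ++ sC) set0 := majorana_ext_drop hM.
Let hB : majorana_ext sB set0 := majorana_ext_drop hN.
Let hA : majorana_ext sA (adjoin (sB ++ sC) set0).
Proof. by have [] := (majorana_ext_cat Theta _ _ _).1 hM. Qed.
Let hC : majorana_ext sC (adjoin (sA ++ sB) set0).
Proof. by have [] := (majorana_ext_cat Theta _ _ _).1 hM'. Qed.
Let hCB : majorana_ext (sC ++ sB) set0.
Proof.
apply/majorana_ext_cat; split=> //; apply: majorana_ext_sub hC.
by apply: adjoin_sub => // x; rewrite mem_cat => ->; rewrite orbT.
Qed.

Lemma densities_spec : exists2 l : seq R, {in l, forall r, 0 < r} &
  [/\ annihilates l DM, annihilates l DN, annihilates l DBC & annihilates l DB].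
Proof.
have spec ps := @density_spec _ _ _ Theta_star ThetaK _ hphi phi_even ps.
have [_ _ _ _ [l1 a1 p1]] := spec (pA ++ (pB ++ pC)) ltac:(rewrite !unpair_cat; exact: hM)
  ltac:(rewrite !unpair_cat; exact: faith).
have [_ _ _ _ [l2 a2 p2]] := spec (pA ++ pB) ltac:(rewrite !unpair_cat; exact: hN)
  ltac:(rewrite !unpair_cat; exact: faithN).
have [_ _ _ _ [l3 a3 p3]] := spec (pB ++ pC) ltac:(rewrite !unpair_cat; exact: hBC)
  ltac:(rewrite !unpair_cat; exact: faithBC).
have [_ _ _ _ [l4 a4 p4]] := spec pB hB faithB.
rewrite !unpair_cat in a1 a2 a3.
exists (undup (l1 ++ l2 ++ l3 ++ l4)).
  move=> r; rewrite mem_undup !mem_cat => /or4P[].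
  - exact: p1.
  - exact: p2.
  - exact: p3.
  - exact: p4.
have U := undup_uniq (l1 ++ l2 ++ l3 ++ l4).
by split; [apply: annihilates_sub U _ a1 | apply: annihilates_sub U _ a2
  | apply: annihilates_sub U _ a3 | apply: annihilates_sub U _ a4] => r rl;
  rewrite mem_undup !mem_cat rl ?orbT.
Qed.

Lemma forgets_DM_A : forgets sA DM = DBC.
Proof. have := @forgets_density pA (pB ++ pC); rewrite unpair_cat; exact. Qed.

Lemma forgets_DN_A : forgets sA DN = DB.
Proof. by apply: forgets_density. Qed.

Lemma forgets_DBC_C : forgets sC DBC = DB.
Proof.
have := @forgets_density pC pB; rewrite -/sC -/sB => /(_ hCB).
rewrite /region_density.
rewrite (_ : region (sC ++ sB) = rBC); first exact.
by apply: region_eq => x; rewrite !mem_cat orbC.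
Qed.

Lemma DM_spec : [/\ rM DM, star DM = DM, Theta DM = DM &
  forall y, rM y -> phi y = tau (sA ++ (sB ++ sC)) (y * DM)].
Proof.
have := @density_spec _ _ _ Theta_star ThetaK _ hphi phi_even (pA ++ (pB ++ pC)).
by rewrite !unpair_cat => /(_ hM faith)[].
Qed.

Lemma DN_spec : [/\ rN DN, star DN = DN, Theta DN = DN &
  forall y, rN y -> phi y = tau (sA ++ sB) (y * DN)].
Proof.
have := @density_spec _ _ _ Theta_star ThetaK _ hphi phi_even (pA ++ pB).
by rewrite !unpair_cat => /(_ hN faithN)[].
Qed.

Lemma DBC_spec : [/\ rBC DBC, star DBC = DBC, Theta DBC = DBC &
  forall y, rBC y -> phi y = tau (sB ++ sC) (y * DBC)].
Proof.
have := @density_spec _ _ _ Theta_star ThetaK _ hphi phi_even (pB ++ pC).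
by rewrite !unpair_cat => /(_ hBC faithBC)[].
Qed.

Lemma DB_spec : [/\ rB DB, star DB = DB, Theta DB = DB &
  forall y, rB y -> phi y = tau sB (y * DB)].
Proof.
by have [] := @density_spec _ _ _ Theta_star ThetaK _ hphi phi_even pB hB faithB.
Qed.

Variable l : seq R.
Hypothesis l0 : {in l, forall r, 0 < r}.
Hypotheses (annM : annihilates l DM) (annN : annihilates l DN).
Hypotheses (annBC : annihilates l DBC) (annB : annihilates l DB).

Let subM : cstar_subalgebra rM := region_subalgebra _.
Let subN : cstar_subalgebra rN := region_subalgebra _.
Let subBC : cstar_subalgebra rBC := region_subalgebra _.
Let subB : cstar_subalgebra rB := region_subalgebra _.

Lemma csubM3 (B : set A) x y z : cstar_subalgebra B -> B x -> B y -> B z -> B (x * y * z).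
Proof. by move=> hsub Bx By Bz; do 2!apply: (csubM hsub) => //. Qed.

Lemma csub_horner (B : set A) (p : {poly R[i]}) x : cstar_subalgebra B -> B x ->
  B (horner_alg x p).
Proof.
move=> hsub Bx; elim/poly_ind: p => [|p c IH]; first by rewrite rmorph0; apply: csub0.
rewrite rmorphD rmorphM /= horner_algX horner_algC.
by apply: (csubD hsub); [apply: (csubM hsub) | apply: (csubZ hsub); apply: csub1].
Qed.

Lemma csub_fcalc (B : set A) f x : cstar_subalgebra B -> B x -> B (fcalc l f x).
Proof.
by move=> hsub Bx; rewrite fcalc_fpoly; apply: csub_horner.
Qed.

Lemma phi_square (c : R[i]) x y : phi (star (c *: x + y) * (c *: x + y)) =
  conjc c * c * phi (star x * x) + conjc c * phi (star x * y) + c * phi (star y * x)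
    + phi (star y * y).
Proof.
rewrite starD starZE mulrDl !mulrDr -!scalerAl -!scalerAr scalerA.
by rewrite !raddfD /= !linearZ /= !addrA [conjc c * c]mulrC -mulrA.
Qed.

Section MarkovImpliesCocycle.
Variable E : A -> A.
Hypothesis E_linear : linear_on rM E.
Hypothesis E_codom : forall x, rM x -> rN (E x).
Hypothesis E_star : forall x, rM x -> E (star x) = star (E x).
Hypothesis E_phi : forall x, rM x -> phi (E x) = phi x.
Hypothesis E_schwarz : forall x, rM x -> 0 <= phi (star x * x) - phi (star (E x) * E x).
Hypothesis E_fix : forall g, g \in sA -> E g = g.

(** The positive form phi(star x * y) - phi(star (E x) * E y) vanishes at the
    fixed point q, so q is orthogonal to everything for it. *)
Lemma fixed_point_orthogonal x q : rM x -> rM q -> E q = q ->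
  phi (star x * q) = phi (star (E x) * q).
Proof.
move=> Mx Mq Eq.
have EZD c : E (c *: q + x) = c *: q + E x by rewrite E_linear // Eq.
pose h := phi (star x * q) - phi (star (E x) * q).
have hc : phi (star q * x) - phi (star q * E x) = conjc h.
  by rewrite /h rmorphB /= -!(state_star hphi) !starM !starK.
pose k := phi (star x * x) - phi (star (E x) * E x).
have pos c : 0 <= conjc c * conjc h + c * h + k.
  have := E_schwarz (csubD subM (csubZ subM c Mq) Mx); rewrite EZD !phi_square.
  suff -> : conjc c * conjc h + c * h + k =
      conjc c * c * phi (star q * q) + conjc c * phi (star q * x) + c * phi (star x * q)
        + phi (star x * x)
      - (conjc c * c * phi (star q * q) + conjc c * phi (star q * E x)
        + c * phi (star (E x) * q) + phi (star (E x) * E x)) by [].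
  by rewrite -hc /h /k; ring.
have [h0|hn] := eqVneq h 0; first by apply/eqP; rewrite -subr_eq0 -/h h0.
have k0 : 0 <= k by apply: E_schwarz.
have kr := ge0_real k0.
pose n2 : R := complex.Re h ^+ 2 + complex.Im h ^+ 2.
have n20 : 0 < n2.
  rewrite lt_def addr_ge0 ?sqr_ge0 // andbT paddr_eq0 ?sqr_ge0 // !sqrf_eq0.
  by move: hn; case: (h) => u v; rewrite eq_complex.
(* For this t the form at - t (conjc h) q + x would be -1. *)
pose t := (complex.Re k + 1) / (2 * n2).
have := pos (- t%:C * conjc h); rewrite kr.
have -> : conjc (- t%:C * conjc h) * conjc h + - t%:C * conjc h * h
    = (- (2 * t * n2))%:C.
  rewrite /n2; case: (h) => u v; apply/eqP; rewrite eq_complex /=.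
  by apply/andP; split; apply/eqP; ring.
rewrite -rmorphD ler0c /t.
have -> : 2 * ((complex.Re k + 1) / (2 * n2)) * n2 = complex.Re k + 1.
  by field; rewrite gt_eqF.
by rewrite opprD addrAC addNr add0r oppr_ge0 ler10.
Qed.

Lemma fixed_point_module x q : rM x -> rM q -> E q = q -> phi (x * q) = phi (E x * q).
Proof.
move=> Mx Mq Eq; have Msx := csub_star subM Mx.
by have := fixed_point_orthogonal Msx Mq Eq; rewrite E_star // !starK.
Qed.

Let iM := inv_of l DM.
Let iN := inv_of l DN.

(** For s = D_M^-1 q D_M and r = D_N^-1 q D_N one has phi(s x) = phi(r E(x))
    on M and phi(s x) = phi(r x) on N. So star r is the orthogonal projection
    of star s to N, while star s is the image of star r under the adjoint of
    the contraction E. Both have the same length, and they coincide. *)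
Lemma fixed_point_modular q : rM q -> E q = q ->
  iM * q * DM = iN * q * DN /\ E (iM * q * DM) = iM * q * DM.
Proof.
move=> Mq Eq; have Nq : rN q by rewrite -Eq; apply: E_codom.
have [MDM sDM _ DME] := DM_spec; have [NDN sDN _ DNE] := DN_spec.
have MiM : rM iM by apply: (csub_fcalc _ subM).
have NiN : rN iN by apply: (csub_fcalc _ subN).
set s := iM * q * DM; set r := iN * q * DN.
have Ms : rM s by apply: (csubM3 subM).
have Nr : rN r by apply: (csubM3 subN).
have Mss := csub_star subM Ms; have Nsr := csub_star subN Nr.
have sE x : rM x -> phi (s * x) = phi (x * q).
  move=> Mx; rewrite DME; last exact: (csubM subM).
  rewrite -mulrA (tauC Theta_star ThetaK hphi hM) //; last exact: (csubM subM).
  rewrite -mulrA /s !mulrA -[_ * DM * iM]mulrA (inv_of_r annM l0) mulr1 -DME //.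
  exact: (csubM subM).
have rE x : rN x -> phi (r * x) = phi (x * q).
  move=> Nx; rewrite DNE; last exact: (csubM subN).
  rewrite -mulrA (tauC Theta_star ThetaK hphi hN) //; last exact: (csubM subN).
  rewrite -mulrA /r !mulrA -[_ * DN * iN]mulrA (inv_of_r annN l0) mulr1 -DNE //.
  exact: (csubM subN).
have srE x : rM x -> phi (s * x) = phi (r * E x).
  by move=> Mx; rewrite (sE _ Mx) (rE _ (E_codom Mx)); apply: fixed_point_module.
have ss : phi (s * star s) = phi (r * E (star s)) by apply: srE.
have sr : phi (s * star r) = phi (r * star r) by rewrite (sE _ (NM Nsr)) (rE _ Nsr).
have rs : phi (r * star s) = phi (r * star r).
  by have := congr1 conjc sr; rewrite -!(state_star hphi) !starM !starK.
have NEs : rN (E (star s)) by apply: E_codom.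
have Es : phi (star (E (star s)) * star r) = phi (s * star s).
  by have := congr1 conjc ss; rewrite -!(state_star hphi) !starM !starK.
have pos1 : 0 <= phi (s * star s) - phi (r * star r).
  have := hphi.1 (star s - star r); rewrite starB !starK mulrBl !mulrBr !raddfB /=.
  by rewrite sr rs subrr addr0.
have pos2 : phi (star (star r - E (star s)) * (star r - E (star s)))
    = phi (r * star r) - 2 * phi (s * star s) + phi (star (E (star s)) * E (star s)).
  rewrite starB starK mulrBl !mulrBr !raddfB /= -ss Es; ring.
have pos3 : 0 <= phi (s * star s) - phi (star (E (star s)) * E (star s)).
  by have := E_schwarz Mss; rewrite starK.
have pos4 := hphi.1 (star r - E (star s)).
rewrite pos2 in pos4.
have le1 : phi (s * star s) - phi (r * star r) <= 0.
  rewrite -oppr_ge0; apply: le_trans (addr_ge0 pos4 pos3) _.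
  by rewrite le_eqVlt; apply/orP; left; apply/eqP; ring.
have e1 : phi (s * star s) - phi (r * star r) = 0.
  by apply/eqP; rewrite eq_le le1 pos1.
have srs : star s = star r.
  apply/eqP; rewrite -subr_eq0; apply/eqP; apply: faith.
    by apply: (csubB subM) => //; apply: NM.
  rewrite starB !starK mulrBl !mulrBr !raddfB /= sr rs subrr addr0 e1 //.
have Ers : star r = E (star s).
  apply/eqP; rewrite -subr_eq0; apply/eqP; apply: faith.
    by apply: (csubB subM) => //; apply: NM.
  apply/eqP; rewrite eq_le hphi.1 andbT pos2.
  have -> : phi (r * star r) = phi (s * star s) by apply/esym/eqP; rewrite -subr_eq0 e1.
  rewrite -oppr_ge0; apply: le_trans pos3 _.
  by rewrite le_eqVlt; apply/orP; left; apply/eqP; ring.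
have sE2 : s = r by rewrite -[s]starK srs starK.
split=> //.
by rewrite -[in LHS](starK s) E_star // -Ers -srs starK.
Qed.

Lemma fixed_point_modular' q : rM q -> E q = q ->
  DM * q * iM = DN * q * iN /\ E (DM * q * iM) = DM * q * iM.
Proof.
move=> Mq Eq; have Msq := csub_star subM Mq.
have [MDM sDM _ _] := DM_spec; have [NDN sDN _ _] := DN_spec.
have star_inv D : annihilates l D -> star D = D -> star (inv_of l D) = inv_of l D.
  move=> ann sD; rewrite (sop_fcalc (StarOperation starK starD starZ starM) _ _ sD).
  by apply: eq_fcalc => r _; rewrite -fmorphV; exact: conjc_real.
have siM : star iM = iM by apply: star_inv.
have siN : star iN = iN by apply: star_inv.
have [h1 h2] := fixed_point_modular Msq ltac:(by rewrite E_star // Eq).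
have e1 : DM * q * iM = star (iM * star q * DM) by rewrite !starM starK sDM siM mulrA.
have e2 : DN * q * iN = star (iN * star q * DN) by rewrite !starM starK sDN siN mulrA.
split; first by rewrite e1 e2 h1.
rewrite e1 E_star ?h2 //.
by apply: (csubM3 subM) => //; apply: (csub_fcalc _ subM).
Qed.

Lemma fixed_point_pow q n : rM q -> E q = q ->
  DM ^+ n * q * iM ^+ n = DN ^+ n * q * iN ^+ n.
Proof.
elim: n q => [|n IH] q Mq Eq; first by rewrite !expr0.
have [h1 h2] := fixed_point_modular' Mq Eq; have [MDM _ _ _] := DM_spec.
have MiM : rM iM by apply: (csub_fcalc _ subM).
have step D i : D ^+ n.+1 * q * i ^+ n.+1 = D ^+ n * (D * q * i) * i ^+ n.
  by rewrite exprSr exprS !mulrA.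
rewrite !step -h1; apply: IH => //.
by apply: (csubM3 subM).
Qed.

Lemma fixed_point_ratio f q : rM q -> E q = q ->
  ratio_calc l f DM q DM = ratio_calc l f DN q DN.
Proof.
move=> Mq Eq; have [e _ eE] := spanning_ratio A f (@spanning_pow R) l0.
rewrite !eE; apply: eq_bigr => k _; congr (_ *: _).
by rewrite (ratio_pow annM _ _ annM) (ratio_pow annN _ _ annN) fixed_point_pow.
Qed.

(** The modular groups of M and N move the fixed points of E in the same way,
    so the cocycle commutes with the region A. Being even, it lies in the
    region BC. *)
Lemma markov_cocycle t (w := fcalc l (unit_phase t) DM * fcalc l (unit_phase (- t)) DN) :
  rBC w /\ Theta w = w.
Proof.
have [MDM sDM tDM _] := DM_spec; have [NDN sDN tDN _] := DN_spec.
have starU D (u : R) : star D = D -> star (fcalc l (unit_phase u) D) = fcalc l (unit_phase (- u)) D.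
  move=> sD; rewrite (sop_fcalc (StarOperation starK starD starZ starM) _ _ sD).
  by apply: eq_fcalc => r _; exact: unit_phase_conj.
pose v := fcalc l (unit_phase t) DN * fcalc l (unit_phase (- t)) DM.
have wv : w = star v by rewrite starM !starU // opprK.
have Tw : Theta w = w by rewrite /w rmorphM /= !lrmorph_fcalc tDM tDN.
split=> //; rewrite wv; apply: (csub_star subBC).
apply: (even_commutant Theta_star ThetaK hA).
- by rewrite -adjoin_cat; apply: (csubM subM); [apply: NM; apply: (csub_fcalc _ subN) | apply: (csub_fcalc _ subM)].
- by rewrite rmorphM /= !lrmorph_fcalc tDM tDN.
move=> g gs; have Mg : rM g.
  by apply: sub_cstar_generated; left; rewrite /mkset mem_cat gs.
have := fixed_point_ratio (unit_phase (- t)) Mg (E_fix gs).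
rewrite !(ratio_phase _ l0) opprK => h.
have [uM uN] := (fcalc_phaseN annM t, fcalc_phaseN annN t).
have -> : v * g = fcalc l (unit_phase t) DN
    * (fcalc l (unit_phase (- t)) DM * g * fcalc l (unit_phase t) DM)
    * fcalc l (unit_phase (- t)) DM.
  by rewrite !mulrA -[_ * _ * fcalc l (unit_phase (- t)) DM]mulrA uM mulr1.
by rewrite h !mulrA uN mul1r.
Qed.

End MarkovImpliesCocycle.

Section CocycleImpliesLocal.
Hypothesis local_cocycle : forall t, rBC (ratio_calc l (unit_phase t) DM 1 DN).

Lemma local_ratio f : rBC (ratio_calc l f DM 1 DN).
Proof.
have [e _ eE] := spanning_ratio A f (@spanning_phase R) l0.
by rewrite eE; apply: (csub_sum subBC) => k _; apply: (csubZ subBC).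
Qed.

(** Since D_M w_n = w_(n+1) D_N for w_n = D_M^n D_N^-n, forgetting the region
    A replaces D_M and D_N by D_BC and D_B. *)
Lemma ratio_localization f : ratio_calc l f DM 1 DN = ratio_calc l f DBC 1 DB.
Proof.
have [e _ eE] := spanning_ratio A f (@spanning_pow R) l0.
rewrite !eE; apply: eq_bigr => k _; congr (_ *: _); move: k.2 => {k} n.
have [NDN _ _ _] := DN_spec.
elim: n => [|n IH].
  by rewrite (ratio_pow annN _ _ annM) (ratio_pow annB _ _ annBC) !expr0.
have := local_ratio (fun r => r%:C ^+ n.+1); have := local_ratio (fun r => r%:C ^+ n).
move: IH; set w := ratio_calc l _ DM 1 DN; set w' := ratio_calc l _ DM 1 DN => IH Bw Bw'.
have ww' : DM * w = w' * DN.
  rewrite /w /w' !(ratio_pow annN _ _ annM) !mulr1 exprS exprSr !mulrA.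
  by rewrite -[_ * inv_of l DN * DN]mulrA (inv_of_l annN l0) mulr1.
have := congr1 (forgets sA) ww'.
rewrite (forgetsMr Theta_star hA) // (forgetsMl Theta_star hA) // forgets_DM_A forgets_DN_A.
rewrite IH (ratio_pow annB _ _ annBC) => h.
rewrite (ratio_pow annB _ _ annBC) exprS [inv_of l DB ^+ _]exprSr.
rewrite !mulrA !mulr1 in h *.
by rewrite h -mulrA (inv_of_r annB l0) mulr1.
Qed.

End CocycleImpliesLocal.

Section Expectation.
Hypothesis ratio_local : forall f, ratio_calc l f DM 1 DN = ratio_calc l f DBC 1 DB.

Let sqr (r : R) : R[i] := (Num.sqrt r)%:C.
Let isqr (r : R) : R[i] := ((Num.sqrt r)^-1)%:C.

(** The conjugation x |-> w x (star w) carries D_N to D_M, which makes the map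
    x |-> (star w) x w followed by forgetting C invariant for phi. *)
Definition markov_kraus : A := fcalc l sqr DBC * fcalc l isqr DB.

Lemma markov_kraus_global : markov_kraus = fcalc l sqr DM * fcalc l isqr DN.
Proof.
have E x y : ratio_calc l sqr x 1 y = fcalc l sqr x * fcalc l isqr y.
  rewrite (ratio_calcE (g := sqr) (h := isqr)) ?mulr1 // => r m rl ml.
  by rewrite /sqr /isqr -rmorphM sqrtrM ?ltW ?l0 // sqrtrV // ltW ?l0.
by rewrite /markov_kraus -!E ratio_local.
Qed.

Let star_real (D : A) (f : R -> R) : star D = D -> star (fcalc l (fun r => (f r)%:C) D) = fcalc l (fun r => (f r)%:C) D.
Proof.
move=> sD; rewrite (sop_fcalc (StarOperation starK starD starZ starM) _ _ sD).
by apply: eq_fcalc => r _; exact: conjc_real.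
Qed.

Let star_sqr (D : A) : star D = D -> star (fcalc l sqr D) = fcalc l sqr D.
Proof. exact: star_real. Qed.

Let star_isqr (D : A) : star D = D -> star (fcalc l isqr D) = fcalc l isqr D.
Proof. exact: (star_real (fun r => (Num.sqrt r)^-1)). Qed.

Let sqr0 r : r \in l -> Num.sqrt r != 0.
Proof. by move=> /l0 r0; rewrite gt_eqF // sqrtr_gt0. Qed.

Lemma markov_kraus_region : rBC markov_kraus.
Proof.
have [BDBC _ _ _] := DBC_spec; have [BDB _ _ _] := DB_spec.
apply: (csubM subBC); first exact: (csub_fcalc _ subBC).
apply: (csub_fcalc _ subBC); move: BDB; apply: region_sub => x.
by rewrite mem_cat => ->.
Qed.

Lemma markov_kraus_even : Theta markov_kraus = markov_kraus.
Proof.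
have [_ _ tBC _] := DBC_spec; have [_ _ tB _] := DB_spec.
by rewrite rmorphM /= !lrmorph_fcalc tBC tB.
Qed.

Lemma markov_kraus_density : markov_kraus * DN * star markov_kraus = DM.
Proof.
have [_ sM _ _] := DM_spec; have [_ sN _ _] := DN_spec.
rewrite markov_kraus_global starM star_sqr // star_isqr // -[X in _ * X * _](fcalc_id annN).
have one : fcalc l isqr DN * fcalc l (fun r => r%:C) DN * fcalc l isqr DN = 1.
  rewrite !fcalcM // -(fcalc1 annN); apply: eq_fcalc => r rl.
  rewrite /isqr -!rmorphM -(rmorph1 (real_complex R)); congr (_%:C).
  rewrite -{2}(sqr_sqrtr (ltW (l0 rl))) expr2 mulrA mulVf ?sqr0 // mul1r mulfV ?sqr0 //.
rewrite !mulrA -[_ * _ * fcalc l (fun r => r%:C) DN]mulrA.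
rewrite -[_ * _ * fcalc l isqr DN]mulrA one mulr1 fcalcM // -[RHS](fcalc_id annM).
by apply: eq_fcalc => r rl; rewrite /sqr -rmorphM -expr2 sqr_sqrtr // ltW ?l0.
Qed.

Definition markov_expectation x := forgets sC (star markov_kraus * x * markov_kraus).

(** Forgetting the region C turns D_BC into D_B. *)
Lemma markov_expectation1 : markov_expectation 1 = 1.
Proof.
have [_ sBC _ _] := DBC_spec; have [BDB sB' _ _] := DB_spec.
have [hCB1 _] := (majorana_ext_cat Theta _ _ _).1 hCB.
have rBi : rB (fcalc l isqr DB) by apply: (csub_fcalc _ subB).
rewrite /markov_expectation mulr1 /markov_kraus starM star_sqr // star_isqr //.
rewrite mulrA -[_ * fcalc l sqr DBC * fcalc l sqr DBC]mulrA fcalcM //.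
have -> : fcalc l (fun r => sqr r * sqr r) DBC = DBC.
  rewrite -[RHS](fcalc_id annBC); apply: eq_fcalc => r rl.
  by rewrite /sqr -rmorphM -expr2 sqr_sqrtr // ltW ?l0.
rewrite (forgetsMr Theta_star hCB1) // (forgetsMl Theta_star hCB1) // forgets_DBC_C.
rewrite -[X in _ * X * _](fcalc_id annB) !fcalcM // -(fcalc1 annB).
apply: eq_fcalc => r rl.
rewrite /isqr -!rmorphM -(rmorph1 (real_complex R)); congr (_%:C).
by rewrite -{2}(sqr_sqrtr (ltW (l0 rl))) expr2 mulrA mulVf ?sqr0 // mul1r mulfV ?sqr0.
Qed.

Lemma markov_expectation_phi x : rM x -> phi (markov_expectation x) = phi x.
Proof.
move=> Mx; have [NDN _ _ DNE] := DN_spec; have [MDM _ _ DME] := DM_spec.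
have Mw : rM markov_kraus by apply: BCM; exact: markov_kraus_region.
have Msw := csub_star subM Mw.
have Mwxw : rM (star markov_kraus * x * markov_kraus) by apply: (csubM3 subM).
have NE : rN (markov_expectation x).
  apply: (forgets_generated Theta_star ThetaK hC).
  by rewrite -adjoin_cat -/(region _) perm_M.
rewrite DNE // /markov_expectation /tau -(forgetsMr Theta_star hC) // -forgets_cat -/(tau (sC ++ sA ++ sB) _).
have MwD : rM (markov_kraus * DN) by apply: (csubM subM) => //; apply: NM.
have := @tau_region _ _ _ Theta_star ThetaK _ hphi (pC ++ (pA ++ pB)) (pA ++ (pB ++ pC))
  (star markov_kraus * x * markov_kraus * DN).
rewrite !unpair_cat -/sA -/sB -/sC => /(_ hM' hM perm_M).
rewrite perm_M => -> //; last by rewrite -mulrA; apply: (csubM subM) => //; apply: (csubM subM).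
have MxwD : rM (x * (markov_kraus * DN)) by apply: (csubM subM).
have -> : star markov_kraus * x * markov_kraus * DN = star markov_kraus * (x * (markov_kraus * DN)).
  by rewrite !mulrA.
rewrite (tauC Theta_star ThetaK hphi hM Msw MxwD).
by rewrite -mulrA markov_kraus_density -DME.
Qed.

End Expectation.

Section Entropy.

(** For a density this is the opposite of the entropy, up to the normalization
    of the trace. *)
Definition log_mean D : R[i] := phi (fcalc l (fun r => (ln r)%:C) D).

Lemma log_mean_ratio x y : annihilates l x -> annihilates l y ->
  phi (ratio_calc l (fun r => (ln r)%:C) x 1 y) = log_mean x - log_mean y.
Proof.
move=> annx anny; rewrite /log_mean -raddfB /=; congr (phi _).
rewrite (ratio_calcD (g := fun r => (ln r)%:C) (h := fun r => - (ln r)%:C)) //.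
  congr (_ + _); rewrite -scaleN1r fcalcZ.
  by apply: eq_fcalc => r _; rewrite mulN1r.
by move=> r m rl ml; rewrite ln_div ?posrE ?l0 // rmorphB.
Qed.

Lemma ratio_local_entropy :
    (forall f, ratio_calc l f DM 1 DN = ratio_calc l f DBC 1 DB) ->
  log_mean DM - log_mean DN = log_mean DBC - log_mean DB.
Proof.
by move=> /(_ (fun r => (ln r)%:C)) /(congr1 phi); rewrite !log_mean_ratio.
Qed.

Hypothesis entropy_eq : log_mean DM - log_mean DN = log_mean DBC - log_mean DB.

Let resol (t r : R) : R[i] := ((r + t)^-1)%:C.
Let X t := ratio_calc l (resol t) DBC 1 DM.
Let Y t := ratio_calc l (resol t) DB 1 DN.
Let iM := inv_of l DM.
Let iN := inv_of l DN.

Lemma csub_ratio (B : set A) f q x y : cstar_subalgebra B -> B x -> B q -> B y ->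
  B (ratio_calc l f x q y).
Proof.
move=> hsub Bx Bq By; apply: (csub_sum hsub) => r _; apply: (csub_sum hsub) => m _.
apply: (csubZ hsub); apply: (csubM3 hsub) => //.
  exact: csub_horner.
exact: csub_horner.
Qed.

Let resolvent_equation t x y : 0 < t -> annihilates l x -> annihilates l y ->
  x * ratio_calc l (resol t) x 1 y * inv_of l y + t%:C *: ratio_calc l (resol t) x 1 y = 1.
Proof.
move=> t0 annx anny; rewrite (ratio_shift _ _ annx anny l0).
transitivity (\sum_(r <- l) \sum_(m <- l) ((1 * 1 : R[i]) *: (eigenproj l r x * 1 * eigenproj l m y)));
  last by rewrite (double_fcalc l (fun=> 1) (fun=> 1)) !fcalc1 // !mulr1.
rewrite scaler_sumr -big_split; apply: eq_big_seq => r rl.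
rewrite scaler_sumr -big_split; apply: eq_big_seq => m ml.
rewrite /= scalerA -scalerDl; congr (_ *: _); rewrite /resol mulr1 -!rmorphM -rmorphD.
rewrite -mulrDl mulfV // gt_eqF // addr_gt0 // divr_gt0 ?l0 //.
Qed.

(** The operator z |-> D_BC z D_M^-1 on M and the operator z |-> D_B z D_N^-1
    on N have the same quadratic form on N. Here X and Y are their resolvents
    at -t, applied to 1, and the bound is the value at X - Y of the form of
    the first operator shifted by t. *)
Lemma resolvent_gap t (Z := X t - Y t) : 0 < t ->
  t%:C * phi (star Z * Z) <= phi (star (X t)) - phi (Y t).
Proof.
move=> t0.
have [MDM _ _ DME] := DM_spec; have [NDN _ _ DNE] := DN_spec.
have [BCD sBC _ _] := DBC_spec; have [BDB sB' _ _] := DB_spec.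
have M1 : rM 1 := csub1 subM.
have MDBC : rM DBC := BCM BCD.
have NDB : rN DB by move: BDB; apply: region_sub => x; rewrite mem_cat => ->; rewrite orbT.
have MX : rM (X t) by apply: (csub_ratio _ subM).
have NY : rN (Y t) by apply: (csub_ratio _ subN) => //; apply: (csub1 subN).
have MY := NM NY.
have MiM : rM iM by apply: (csub_fcalc _ subM).
have NiN : rN iN by apply: (csub_fcalc _ subN).
pose Q x y := tau (sA ++ (sB ++ sC)) (star x * DBC * y) + t%:C * phi (star x * y).
have MQ x y : rM x -> rM y -> rM (star x * DBC * y).
  by move=> Mx My; apply: (csubM3 subM) => //; apply: (csub_star subM).
have QM x y : rM x -> rM y -> Q x y = phi (star x * (DBC * y * iM + t%:C *: y)).
  move=> Mx My; have Msx := csub_star subM Mx.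
  rewrite mulrDr -scalerAr raddfD /= linearZ /=; congr (_ + _).
  rewrite DME; last by apply: (csubM subM) => //; apply: (csubM3 subM).
  by rewrite !mulrA -[_ * iM * DM]mulrA (inv_of_l annM l0) mulr1.
have QX x : rM x -> Q x (X t) = phi (star x).
  by move=> Mx; rewrite QM // resolvent_equation // mulr1.
have QN x y : rN x -> rN y -> Q x y = phi (star x * (DB * y * iN + t%:C *: y)).
  move=> Nx Ny; have Nsx := csub_star subN Nx.
  rewrite mulrDr -scalerAr raddfD /= linearZ /=; congr (_ + _).
  have N1 : rN (star x * (DB * y * iN)).
    by apply: (csubM subN) => //; apply: (csubM3 subN).
  rewrite DNE // !mulrA -[_ * iN * DN]mulrA (inv_of_l annN l0) mulr1.
  have [Mx My] := (NM Nsx, NM Ny).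
  rewrite -[_ * DBC * y]mulrA -[_ * DB * y]mulrA.
  rewrite (tauC Theta_star ThetaK hphi hM Mx); last exact: (csubM subM).
  rewrite (tauC Theta_star ThetaK hphi hN Nsx); last exact: (csubM subN).
  have := @tau_region _ _ _ Theta_star ThetaK _ hphi (pA ++ (pB ++ pC)) (pC ++ (pA ++ pB))
    (DBC * y * star x).
  rewrite !unpair_cat -/sA -/sB -/sC => /(_ hM hM' (esym perm_M)) -> //; last first.
    by apply: (csubM3 subM).
  have Nyx : rN (y * star x) by apply: (csubM subN).
  by rewrite /tau forgets_cat -!mulrA (forgetsMr Theta_star hC) // forgets_DBC_C.
have QC x y : rM x -> rM y -> Q x y = conjc (Q y x).
  move=> Mx My; rewrite /Q rmorphD rmorphM /= -(tau_star Theta_star hphi _ hM).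
  rewrite -(state_star hphi) !starM starK sBC mulrA; congr (_ + _ * _).
  by rewrite oppr0.
have QYY : Q (Y t) (Y t) = phi (star (Y t)).
  by rewrite QN // resolvent_equation // mulr1.
have QXY : Q (X t) (Y t) = phi (Y t).
  by rewrite QC // QX // (state_star hphi) conjcK.
have MZ : rM Z by apply: (csubB subM).
have -> : phi (star (X t)) - phi (Y t) = Q Z Z.
  have -> : Q Z Z = Q (X t) (X t) - Q (X t) (Y t) - (Q (Y t) (X t) - Q (Y t) (Y t)).
    rewrite /Q /Z starB !mulrBl !mulrBr !tauB !raddfB /=; ring.
  by rewrite QX // QXY QX // QYY subrr subr0.
rewrite /Q lerDr.
pose c := fcalc l (fun r => (Num.sqrt r)%:C) DBC.
have sc : star c = c.
  rewrite (sop_fcalc (StarOperation starK starD starZ starM) _ _ sBC).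
  by apply: eq_fcalc => r _; exact: conjc_real.
have cc : c * c = DBC.
  rewrite fcalcM // -[RHS](fcalc_id annBC); apply: eq_fcalc => r rl.
  by rewrite -rmorphM -expr2 sqr_sqrtr // ltW ?l0.
have [] := tau_ge0 Theta_star hphi (c * Z) hM.
by rewrite starM sc -cc !mulrA.
Qed.

(** The bound of resolvent_gap is a combination of resolvents evaluated at the
    ratios of eigenvalues. Its weights add up to 0 by normalization, and so do
    their products with the logarithms of the ratios, by the equality of
    entropies. Hence it vanishes. *)
Lemma resolvent_agree t : 0 < t -> X t = Y t.
Proof.
move=> t0.
have [MDM _ _ _] := DM_spec; have [NDN _ _ _] := DN_spec.
have [BCD _ _ _] := DBC_spec; have [BDB _ _ _] := DB_spec.
have MX : rM (X t).
  by apply: (csub_ratio _ subM) => //; [exact: BCM | exact: (csub1 subM)].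
have MY : rM (Y t).
  by apply: (csub_ratio _ subM) => //; [exact: BM | exact: (csub1 subM) | exact: NM].
pose a x y r m : R := complex.Re (phi (eigenproj l r x * 1 * eigenproj l m y)).
have ReD : {morph (@complex.Re R) : u v / u + v} by case=> ? ? [].
have ReE (f : R -> R) x y : complex.Re (phi (ratio_calc l (fun r => (f r)%:C) x 1 y))
    = \sum_(p <- [seq (r / m, a x y r m) | r <- l, m <- l]) p.2 * f p.1.
  rewrite big_allpairs_dep /= raddf_sum /= (big_morph _ ReD (erefl _)).
  apply: eq_bigr => r _; rewrite raddf_sum /= (big_morph _ ReD (erefl _)).
  apply: eq_bigr => m _; rewrite /= linearZ /= /a mulrC.
  by case: (phi _) => u v /=; rewrite mulr0 subr0.
pose P := [seq (r / m, a DBC DM r m) | r <- l, m <- l]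
       ++ [seq (r / m, - a DB DN r m) | r <- l, m <- l].
have PE (f : R -> R) : \sum_(p <- P) p.2 * f p.1
    = complex.Re (phi (ratio_calc l (fun r => (f r)%:C) DBC 1 DM))
      - complex.Re (phi (ratio_calc l (fun r => (f r)%:C) DB 1 DN)).
  rewrite big_cat /= !ReE; congr (_ + _); rewrite !big_allpairs_dep -sumrN.
  by apply: eq_bigr => r _; rewrite -sumrN; apply: eq_bigr => m _; rewrite mulNr.
have P0 k : k \in P -> 0 < k.1.
  by rewrite mem_cat => /orP[] /allpairsP[[r m] [/= rl ml ->]] /=; rewrite divr_gt0 ?l0.
have ReB (u v : R[i]) : complex.Re (u - v) = complex.Re u - complex.Re v :> R by case: u v => ? ? [].
have gap (x : R) : 0 < x -> complex.Re (x%:C * phi (star (X x - Y x) * (X x - Y x)))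
    <= resolvent_sum P x.
  move=> x0; have := resolvent_gap x0; rewrite lecE => /andP[_].
  rewrite /resolvent_sum (PE (fun r => (r + x)^-1)) ReB (state_star hphi).
  by case: (phi (X x)) => u v.
have F0 (x : R) : 0 < x -> 0 <= resolvent_sum P x.
  move=> x0; apply: le_trans (gap _ x0).
  have := hphi.1 (X x - Y x); case: (phi _) => u v; rewrite lecE /= => /andP[/eqP -> u0].
  by rewrite mul0r subr0 mulr_ge0 // ltW.
have S0 : \sum_(k <- P) k.2 = 0.
  have := PE (fun=> 1); under eq_bigr do rewrite mulr1; move=> ->.
  have E x y : annihilates l x -> annihilates l y -> ratio_calc l (fun=> 1%:C) x 1 y = 1.
    move=> annx anny; rewrite (ratio_calcE (g := fun=> 1) (h := fun=> 1)).
      by rewrite !fcalc1 // !mulr1.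
    by move=> r m _ _; rewrite mulr1.
  by rewrite !E // subrr.
have L0 : \sum_(k <- P) k.2 * ln k.1 = 0.
  rewrite PE !log_mean_ratio // -ReB.
  have -> : log_mean DBC - log_mean DM - (log_mean DB - log_mean DN) = 0.
    have -> : log_mean DBC - log_mean DM - (log_mean DB - log_mean DN)
      = (log_mean DBC - log_mean DB) - (log_mean DM - log_mean DN) by ring.
    by rewrite entropy_eq subrr.
  by [].
have := gap _ t0; rewrite (resolvent_sum_eq0 P0 S0 L0 F0 t0).
have := hphi.1 (X t - Y t) => z0 h.
apply/eqP; rewrite -subr_eq0; apply/eqP; apply: faith; first exact: (csubB subM).
move: z0 h; case: (phi _) => u v; rewrite lecE /= => /andP[/eqP -> u0].
rewrite mul0r subr0 pmulr_rle0 // => u1; apply/eqP; rewrite eq_complex /= eqxx andbT.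
by rewrite eq_le u0 u1.
Qed.

Lemma entropy_ratio f : ratio_calc l f DBC 1 DM = ratio_calc l f DB 1 DN.
Proof.
have [e e0 eE] := spanning_ratio A f (@spanning_resolvent R) l0.
rewrite !eE; apply: eq_big_seq => k ke; congr (_ *: _).
exact: (resolvent_agree (e0 k ke)).
Qed.

Lemma entropy_cocycle t :
  ratio_calc l (unit_phase t) DM 1 DN = ratio_calc l (unit_phase t) DBC 1 DB.
Proof.
have h : fcalc l (unit_phase (- t)) DBC * fcalc l (unit_phase t) DM
    = fcalc l (unit_phase (- t)) DB * fcalc l (unit_phase t) DN.
  by have := entropy_ratio (unit_phase (- t)); rewrite !(ratio_phase _ l0) !mulr1 opprK.
rewrite !(ratio_phase _ l0) !mulr1.
have uBC := fcalc_phaseN annBC t.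
have uN := fcalc_phaseN annN t; have uB := fcalc_phaseN annB (- t); rewrite opprK in uB.
rewrite -[fcalc l _ DM]mul1r -uBC -[_ * _ * fcalc l _ DM]mulrA h !mulrA.
by rewrite -[_ * _ * fcalc l (unit_phase (- t)) DN]mulrA uN mulr1.
Qed.

End Entropy.

End ThreeRegions.

(** * The regions of the Fermion algebra *)

Section Fermions.
Local Open Scope complex_scope.
Variables (R : realType) (A : cstarAlgType R) (I : set int).
Variables (d : int -> nat) (a : forall j : int, 'I_(d j) -> A).
Hypothesis car : canonical_anticommutation I a.
Arguments a {j}.

Definition acomm (x y : A) : A := x * y + y * x.

Lemma acommC x y : acomm x y = acomm y x.
Proof. by rewrite /acomm addrC. Qed.

Lemma acommDl x y z : acomm (x + y) z = acomm x z + acomm y z.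
Proof. by rewrite /acomm mulrDl mulrDr addrACA. Qed.

Lemma acommZl (c : R[i]) x z : acomm (c *: x) z = c *: acomm x z.
Proof. by rewrite /acomm -scalerAl -scalerAr scalerDr. Qed.

Lemma acommNl x z : acomm (- x) z = - acomm x z.
Proof. by rewrite /acomm mulNr mulrN opprD. Qed.

Lemma acommDr x y z : acomm z (x + y) = acomm z x + acomm z y.
Proof. by rewrite !(acommC z) acommDl. Qed.

Lemma acommNr x z : acomm z (- x) = - acomm z x.
Proof. by rewrite !(acommC z) acommNl. Qed.

Lemma acommZr (c : R[i]) x z : acomm z (c *: x) = c *: acomm z x.
Proof. by rewrite !(acommC z) acommZl. Qed.

Lemma acomm_star x y : acomm (star x) (star y) = star (acomm x y).
Proof. by rewrite /acomm starD !starM addrC. Qed.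

(** Twice the real part of an annihilator, and, for maj2, twice its imaginary
    part up to sign: by the anticommutation relations they have square 1. *)
Definition maj1 j (i : 'I_(d j)) : A := a i + star (a i).
Definition maj2 j (i : 'I_(d j)) : A := 'i *: (a i - star (a i)).

Lemma maj1_star j (i : 'I_(d j)) : star (maj1 i) = maj1 i.
Proof. by rewrite /maj1 starD starK addrC. Qed.

Lemma maj2_star j (i : 'I_(d j)) : star (maj2 i) = maj2 i.
Proof. by rewrite /maj2 starZE conjc_i starB starK scaleNr -scalerN opprB. Qed.

Section TwoSites.
Variables (j k : int) (i : 'I_(d j)) (h : 'I_(d k)).
Hypotheses (Ij : I j) (Ik : I k).
Let e : A := ((j == k) && (i == h :> nat))%:R.

Let aa : acomm (a i) (a h) = 0. Proof. exact: (car Ij Ik i h).2. Qed.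
Let ss : acomm (star (a i)) (star (a h)) = 0.
Proof. by rewrite acomm_star aa star0. Qed.
Let sa : acomm (star (a i)) (a h) = e. Proof. exact: (car Ij Ik i h).1. Qed.
Let as_ : acomm (a i) (star (a h)) = e.
Proof. by rewrite acommC /acomm (car Ik Ij h i).1 /e eq_sym [X in _ && X]eq_sym. Qed.

Lemma acomm11 : acomm (maj1 i) (maj1 h) = e + e.
Proof. by rewrite acommDl !acommDr aa ss sa as_ add0r addr0. Qed.

Lemma acomm22 : acomm (maj2 i) (maj2 h) = e + e.
Proof.
rewrite acommZl acommZr scalerA mul_i_i acommDl !acommDr !acommNl !acommNr aa ss sa as_.
by rewrite scaleN1r add0r !opprK addr0 opprD opprK.
Qed.

Lemma acomm12 : acomm (maj1 i) (maj2 h) = 0.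
Proof.
by rewrite acommZr acommDl !acommDr !acommNr aa ss sa as_ add0r oppr0 addr0 addNr scaler0.
Qed.

End TwoSites.

Lemma acomm0_anti x y : acomm x y = 0 -> x * y = - (y * x).
Proof. by move=> h; apply/eqP; rewrite -addr_eq0 -h. Qed.

Lemma double_cancel (x y : A) : x + x = y + y -> x = y.
Proof. by move=> h; rewrite -(half_scale_double x) h half_scale_double. Qed.

Lemma maj1_sqr j (i : 'I_(d j)) : I j -> maj1 i * maj1 i = 1.
Proof. by move=> Ij; have := acomm11 i i Ij Ij; rewrite !eqxx => /double_cancel. Qed.

Lemma maj2_sqr j (i : 'I_(d j)) : I j -> maj2 i * maj2 i = 1.
Proof. by move=> Ij; have := acomm22 i i Ij Ij; rewrite !eqxx => /double_cancel. Qed.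

Definition majorana_set (L : set int) : set A :=
  [set x | exists2 j, L j & exists i : 'I_(d j), x = maj1 i \/ x = maj2 i].

Lemma loc_majorana L : loc (@a) L = cstar_generated (majorana_set L).
Proof.
have sub S := @cstar_generated_subalgebra R A S.
apply/seteqP; split; (apply: cstar_generated_min; first exact: sub).
  move=> _ [j Lj [i ->]].
  have -> : a i = 2^-1 *: (maj1 i - 'i *: maj2 i).
    rewrite /maj1 /maj2 scalerA mul_i_i scaleN1r opprK addrACA subrr addr0.
    by rewrite half_scale_double.
  apply: (csubZ (sub _)); apply: (csubB (sub _)); last apply: (csubZ (sub _)).
    by apply: sub_cstar_generated; exists j => //; exists i; left.
  by apply: sub_cstar_generated; exists j => //; exists i; right.
move=> x [j Lj [i xE]].
have Ca : cstar_generated (generators (@a) L) (a i).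
  by apply: sub_cstar_generated; exists j => //; exists i.
have Cs := csub_star (sub _) Ca.
case: xE => ->; first exact: (csubD (sub _)).
by apply: (csubZ (sub _)); apply: (csubB (sub _)).
Qed.

Definition site_pairs j : seq (A * A) := [seq (maj1 i, maj2 i) | i <- enum 'I_(d j)].
Definition region_pairs (js : seq int) : seq (A * A) := flatten [seq site_pairs j | j <- js].
Definition region_list js : seq A := unpair (region_pairs js).

Lemma region_pairs_cat js js' : region_pairs (js ++ js') = region_pairs js ++ region_pairs js'.
Proof. by rewrite /region_pairs map_cat flatten_cat. Qed.

Lemma region_list_cat js js' : region_list (js ++ js') = region_list js ++ region_list js'.
Proof. by rewrite /region_list region_pairs_cat unpair_cat. Qed.

Variable Theta : {lrmorphism A -> A}.
Hypothesis hTheta : parity I (@a) Theta.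

Lemma parity_star x : Theta (star x) = star (Theta x).
Proof. exact: hTheta.1.2. Qed.

Lemma parity_annihilator j (i : 'I_(d j)) : I j -> Theta (a i) = - a i.
Proof. by move=> Ij; exact: hTheta.2. Qed.

Lemma parity_involutive : loc (@a) I = setT -> forall x, Theta (Theta x) = x.
Proof.
move=> Iall x; have : loc (@a) I x by rewrite Iall.
move: x; apply: (@cstar_generated_min _ _ _ [set x | Theta (Theta x) = x]); last first.
  by move=> _ [j Ij [i ->]]; rewrite /mkset parity_annihilator // rmorphN /= parity_annihilator // opprK.
have ct := tcont_Theta parity_star.
split; rewrite /mkset.
- by rewrite !rmorph1.
- by move=> u v hu hv; rewrite !rmorphD /= hu hv.
- by move=> c u hu; rewrite !linearZ /= hu.
- by move=> u v hu hv; rewrite !rmorphM /= hu hv.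
- by move=> u hu; rewrite !parity_star hu.
- by apply: (cstar_closed_eq (f := fun x => Theta (Theta x)) (g := id)) => // u z /ct /ct.
Qed.

Lemma maj1_majorana j (i : 'I_(d j)) : I j -> majorana Theta (maj1 i).
Proof.
move=> Ij; split; [exact: maj1_star | exact: maj1_sqr |].
by rewrite rmorphD /= parity_star parity_annihilator // starN -opprD.
Qed.

Lemma maj2_majorana j (i : 'I_(d j)) : I j -> majorana Theta (maj2 i).
Proof.
move=> Ij; split; [exact: maj2_star | exact: maj2_sqr |].
by rewrite linearZ /= rmorphB /= parity_star parity_annihilator // starN -opprD scalerN.
Qed.

Lemma majorana_set_majoranas L : L `<=` I -> majoranas Theta (majorana_set L).
Proof.
move=> LI _ [j /LI Ij [i [->|->]]]; [exact: maj1_majorana | exact: maj2_majorana].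
Qed.

Lemma majorana_set_anticommute (x : A) j (i : 'I_(d j)) (L : set int) :
    I j -> L `<=` I -> ~ L j -> x = maj1 i \/ x = maj2 i ->
  anticommutes x (majorana_set L).
Proof.
move=> Ij LI nLj xE y [k Lk [h yE]]; apply: acomm0_anti.
have jk : (j == k) = false by apply/eqP => e; apply: nLj; rewrite e.
have Ik := LI _ Lk.
case: xE => ->; case: yE => ->.
- by rewrite acomm11 // jk addr0.
- exact: acomm12.
- by rewrite acommC acomm12.
- by rewrite acomm22 // jk addr0.
Qed.

Lemma site_ext j (is_ : seq 'I_(d j)) L : I j -> L `<=` I -> ~ L j -> uniq is_ ->
  majorana_ext Theta (unpair [seq (maj1 i, maj2 i) | i <- is_]) (majorana_set L).
Proof.
move=> Ij LI nLj; elim: is_ => [|i is_ IH] /=.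
  by move=> _; exact: majorana_set_majoranas.
case/andP => iis uis; rewrite -/(unpair _).
have inU x : x \in unpair [seq (maj1 i, maj2 i) | i <- is_] ->
    exists2 h, h != i & x = maj1 h \/ x = maj2 h.
  case/flattenP => _ /mapP[p /mapP[h hin ->] ->].
  rewrite !inE => /orP xE; exists h; first by apply: contraNneq iis => <-.
  by case: xE => /eqP; [left | right].
have ne (h : 'I_(d j)) : h != i -> (i == h :> nat) = false.
  by rewrite eq_sym => /negPf; rewrite -val_eqE.
split; first exact: maj1_majorana.
  rewrite adjoin_cons => x [->|[/inU[h /ne hi xE]|]].
  - by apply: acomm0_anti; rewrite acomm12.
  - by apply: acomm0_anti; case: xE => ->; [rewrite acomm11 // hi andbF addr0 | rewrite acomm12].
  - by apply: (majorana_set_anticommute (i := i)) => //; left.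
split; [exact: maj2_majorana | | exact: IH].
move=> x [/inU[h /ne hi xE]|].
  apply: acomm0_anti; case: xE => ->; first by rewrite acommC acomm12.
  by rewrite acomm22 // hi andbF addr0.
by apply: (majorana_set_anticommute (i := i)) => //; right.
Qed.

Lemma adjoin_site j L : adjoin (unpair (site_pairs j)) (majorana_set L)
  = majorana_set (j |` L).
Proof.
apply/seteqP; split=> x.
  case=> [|[k Lk kE]]; last by exists k => //; right.
  case/flattenP => _ /mapP[p /mapP[h _ ->] ->].
  by rewrite !inE => /orP xE; exists j; [left | exists h; case: xE => /eqP ->; [left | right]].
case=> k [kj|Lk] [i iE]; last by right; exists k => //; exists i.
left; rewrite /= in kj; subst k; apply/flattenP; exists [:: maj1 i; maj2 i].
  apply/mapP; exists (maj1 i, maj2 i) => //; apply/mapP; exists i => //.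
  by rewrite mem_enum.
by rewrite !inE; case: iE => ->; rewrite eqxx ?orbT.
Qed.

Lemma adjoin_region js L :
  adjoin (region_list js) (majorana_set L) = majorana_set ([set` js] `|` L).
Proof.
elim: js => [|j js IH].
  rewrite adjoin_nil; congr majorana_set.
  by apply/seteqP; split=> x; [right | case].
rewrite -cat1s region_list_cat adjoin_cat IH.
rewrite {1}/region_list /region_pairs /= cats0 adjoin_site; congr majorana_set.
apply/seteqP; split=> x.
  by case=> [->|[xs|Lx]]; [left; rewrite /= mem_head | left; rewrite /= inE; apply/orP; right | right].
case=> [/=|]; last by right; right.
by rewrite inE => /orP[/eqP->|xs]; [left | right; left].
Qed.

Lemma region_ext js L : uniq js -> [set` js] `<=` I -> L `<=` I ->
    (forall j, j \in js -> ~ L j) ->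
  majorana_ext Theta (region_list js) (majorana_set L).
Proof.
move=> + + LI; elim: js => [|j js IH] /=; first by move=> *; exact: majorana_set_majoranas.
case/andP => jjs ujs jI nL.
rewrite -cat1s region_list_cat; apply/majorana_ext_cat; split; last first.
  apply: IH => // [x xs|x xs]; first by apply: jI; rewrite /= inE; apply/orP; right.
  by apply: nL; rewrite inE xs orbT.
rewrite adjoin_region {1}/region_list /region_pairs /= cats0; apply: site_ext.
- by apply: jI; rewrite /= mem_head.
- by move=> x [xs|/LI//]; apply: jI; rewrite /= inE; apply/orP; right.
- by case=> [/= js_|]; [rewrite js_ in jjs | apply: nL; rewrite mem_head].
- exact: enum_uniq.
Qed.

Lemma majorana_set0 : majorana_set set0 = set0.
Proof. by apply/seteqP; split=> [x [j /= []]|x /= []]. Qed.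

Lemma region_loc js : region (region_list js) = loc (@a) [set` js].
Proof.
by rewrite loc_majorana /region -majorana_set0 adjoin_region setU0.
Qed.

Lemma region_ext0 js : uniq js -> [set` js] `<=` I ->
  majorana_ext Theta (region_list js) set0.
Proof.
move=> ujs jI; rewrite -majorana_set0; by apply: region_ext => // x _ [].
Qed.

End Fermions.

(** * Completely positive maps *)

Section Closure.
Variables (R : realType) (A : cstarAlgType R).

Definition norm_closure (B : set A) : set A :=
  [set x | forall e : R, 0 < e -> exists2 y, B y & cnorm (x - y) < e].

Lemma norm_closure_tends (B : set A) u x : (forall n, B (u n)) -> tends u x ->
  norm_closure B x.
Proof.
move=> Bu ux e /ux[N /(_ _ (leqnn N)) uN]; exists (u N) => //.
by rewrite cnormB.
Qed.

(** Every operation is continuous along sequences. *)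
Lemma norm_closure_subalgebra (B : set A) : B 1 ->
    (forall x y, B x -> B y -> B (x + y)) -> (forall (c : R[i]) x, B x -> B (c *: x)) ->
    (forall x y, B x -> B y -> B (x * y)) -> (forall x, B x -> B (star x)) ->
  cstar_subalgebra (norm_closure B).
Proof.
move=> B1 BD BZ BM Bs; split.
- by apply: (norm_closure_tends (u := fun=> 1)) => //; exact: tends_cst.
- move=> x y /tends_approx[u Bu ux] /tends_approx[v Bv vy].
  by apply: norm_closure_tends (tendsD ux vy) => n; apply: BD.
- move=> c x /tends_approx[u Bu ux].
  by apply: norm_closure_tends (tendsZ c ux) => n; apply: BZ.
- move=> x y /tends_approx[u Bu ux] /tends_approx[v Bv vy].
  by apply: norm_closure_tends (tendsM ux vy) => n; apply: BM.
- move=> x /tends_approx[u Bu ux].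
  by apply: norm_closure_tends (tends_star ux) => n; apply: Bs.
move=> x hx e e0; have e2 : 0 < e / 2 by rewrite divr_gt0.
have [y /(_ _ e2)[z Bz yz] xy] := hx _ e2; exists z => //.
by have := ler_cnormD (x - y) (y - z); rewrite subrKA; lra.
Qed.

End Closure.

Section CompletePositivity.
Variables (R : realType) (A : cstarAlgType R) (phi : {scalar A}) (hphi : state phi).
Variables (D B : set A) (E : A -> A).
Hypothesis hD : cstar_subalgebra D.
Hypothesis E_cp : completely_positive D B E.
Hypothesis E1 : E 1 = 1.
Hypothesis E_phi : forall x, D x -> phi (E x) = phi x.

(** The map E is applied to the square of the matrix with rows [x, 1] and [0,
    0]. *)
Lemma cp_factorization x : D x -> exists z0 z1 : 'I_2 -> A,
  [/\ E (star x * x) = \sum_k star (z0 k) * z0 k, E (star x) = \sum_k star (z0 k) * z1 k,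
      E x = \sum_k star (z1 k) * z0 k & 1 = \sum_k star (z1 k) * z1 k].
Proof.
move=> Dx; pose Y : 'M[A]_2 := \matrix_(i, j) if i == 0 then (if j == 0 then x else 1) else 0.
have DY : mx_over D Y.
  by move=> i j; rewrite mxE; case: ifP => _; [case: ifP => _ //; exact: csub1 | exact: csub0].
have [|Z _ ZE] := E_cp (X := star_mx Y *m Y); first by exists Y.
exists (fun k => Z k 0), (fun k => Z k 1).
have XE i j : (star_mx Y *m Y) i j = star (Y 0 i) * Y 0 j.
  rewrite mxE big_ord_recl big_ord1 !mxE /= [X in _ + X](_ : _ = 0) ?addr0 //.
  by rewrite star0 mul0r.
have h i j : E (star (Y 0 i) * Y 0 j) = \sum_k star (Z k i) * Z k j.
  have /matrixP/(_ i j) := ZE; rewrite [LHS]mxE XE => ->; rewrite mxE.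
  by apply: eq_bigr => k _; rewrite !mxE.
split.
- by rewrite -h !mxE.
- by rewrite -h !mxE /= mulr1.
- by rewrite -h !mxE /= star1 mul1r.
- by rewrite -h !mxE /= star1 mulr1.
Qed.

Lemma cp_star x : D x -> E (star x) = star (E x).
Proof.
move=> /cp_factorization[z0 [z1 [_ -> -> _]]]; rewrite star_sum.
by apply: eq_bigr => k _; rewrite starM starK.
Qed.

(** The difference is the value of phi at the sum of the squares of z0_k -
    z1_k E(x), in the notation of cp_factorization. *)
Lemma cp_schwarz x : D x -> 0 <= phi (star x * x) - phi (star (E x) * E x).
Proof.
move=> Dx; have [z0 [z1 [e00 e01 e10 e11]]] := cp_factorization Dx.
have -> : phi (star x * x) - phi (star (E x) * E x)
    = \sum_k phi (star (z0 k - z1 k * E x) * (z0 k - z1 k * E x)).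
  rewrite -raddf_sum -(E_phi (x := star x * x)); last first.
    by apply: (csubM hD) => //; apply: (csub_star hD).
  rewrite -raddfB; congr (phi _).
  have step k : star (z0 k - z1 k * E x) * (z0 k - z1 k * E x)
      = star (z0 k) * z0 k - star (z0 k) * z1 k * E x
        - (star (E x) * (star (z1 k) * z0 k) - star (E x) * (star (z1 k) * z1 k) * E x).
    by rewrite starB starM mulrBl !mulrBr !mulrA.
  under eq_bigr do rewrite step.
  rewrite !sumrB -!mulr_suml -!mulr_sumr -e00 -e01 -e10 -e11.
  by rewrite cp_star // mulr1 subrr subr0.
by apply: sumr_ge0 => k _; apply: hphi.1.
Qed.

End CompletePositivity.

Section SumsOfSquaresForget.
Variables (R : realType) (A : cstarAlgType R) (Theta : {lrmorphism A -> A}).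
Hypothesis Theta_star : forall x, Theta (star x) = star (Theta x).
Hypothesis ThetaK : forall x, Theta (Theta x) = x.

Definition sum_of_squares (B : set A) n (X : 'M[A]_n) :=
  exists r (Z : 'I_r -> 'M[A]_n), (forall k, mx_over B (Z k)) /\
    X = \sum_k star_mx (Z k) *m Z k.

(** Forgetting g in the square of u + v g leaves the sum of the squares of u
    and of Theta(v). *)
Lemma sum_of_squares_forget g S n (X : 'M[A]_n) : majorana Theta g -> majoranas Theta S ->
    anticommutes g S -> sum_of_squares (cstar_generated (g |` S)) X ->
  sum_of_squares (cstar_generated S) (map_mx (forget Theta g) X).
Proof.
move=> mg mS gS [r [Z [CZ ->]]].
have sub := cstar_generated_subalgebra (A := A) S.
pose U k := map_mx (forget Theta g) (Z k).
pose V k := map_mx (fun x => Theta ((x - forget Theta g x) * g)) (Z k).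
exists (r + r)%N, (fun k => match fintype.split k with inl j => U j | inr j => V j end).
have dec k i j : [/\ cstar_generated S (forget Theta g (Z k i j)),
    cstar_generated S ((Z k i j - forget Theta g (Z k i j)) * g) &
    Z k i j = forget Theta g (Z k i j) + (Z k i j - forget Theta g (Z k i j)) * g * g].
  have [u [v [Cu Cv ->]]] := generated_decomp Theta_star ThetaK mg mS gS (CZ k i j).
  have [_ gg _] := mg.
  rewrite (forgetE Theta_star mg mS gS) // [u + v * g]addrC addrK -mulrA gg mulr1.
  by split=> //; rewrite addrC.
split.
  move=> k i j; case: (fintype.split k) => k'; rewrite mxE; have [h1 h2 _] := dec k' i j => //.
  exact: Theta_generated.
rewrite big_split_ord /=.
under [X in _ = X + _]eq_bigr do rewrite (unsplitK (inl _)).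
under [X in _ = _ + X]eq_bigr do rewrite (unsplitK (inr _)).
rewrite -big_split /=; apply/matrixP => i j; rewrite mxE !summxE.
rewrite (big_morph _ (forgetD Theta g) (_ : forget Theta g 0 = 0)); last first.
  by rewrite /forget rmorph0 mulr0 mul0r addr0 scaler0.
apply: eq_bigr => k _; rewrite !mxE -big_split /=.
rewrite (big_morph _ (forgetD Theta g) (_ : forget Theta g 0 = 0)); last first.
  by rewrite /forget rmorph0 mulr0 mul0r addr0 scaler0.
apply: eq_bigr => m _; rewrite !mxE.
have [Cu Cv {1}->] := dec k m i; have [Cu' Cv' {1}->] := dec k m j.
move: (forget _ _ _) ((_ - _) * g) (forget _ _ _) ((_ - _) * g) Cu Cv Cu' Cv'.
move=> u v u' v' Cu Cv Cu' Cv'.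
have [sg _ _] := mg.
have Csv := csub_star sub Cv; have Csu := csub_star sub Cu.
rewrite starD starM sg (generator_swap' Theta_star ThetaK mg mS gS Csv).
rewrite (mul_decomp Theta_star ThetaK mg mS gS) //.
have CT x : cstar_generated S x -> cstar_generated S (Theta x) by exact: Theta_generated.
rewrite (forgetE Theta_star mg mS gS) ?Theta_star //.
  by apply: (csubD sub); apply: (csubM sub) => //; rewrite -?Theta_star; apply: CT.
by apply: (csubD sub); apply: (csubM sub) => //; rewrite -?Theta_star; apply: CT.
Qed.

Lemma sum_of_squares_forgets s S n (X : 'M[A]_n) : majorana_ext Theta s S ->
    sum_of_squares (cstar_generated (adjoin s S)) X ->
  sum_of_squares (cstar_generated S) (map_mx (forgets Theta s) X).
Proof.
elim: s X => [|g s IH] X /=; first by rewrite adjoin_nil map_mx_id_in.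
rewrite adjoin_cons => -[mg gs hs] hX.
have := IH _ hs (sum_of_squares_forget mg (majorana_ext_majoranas hs) gs hX).
by rewrite -map_mx_comp.
Qed.

End SumsOfSquaresForget.

(** * Entropy and automorphisms *)

Section ScaledCalculus.
Local Open Scope complex_scope.
Variables (R : realType) (W : algType R[i]).

Lemma horner_alg_scale (c : R[i]) (x : W) (p : {poly R[i]}) :
  horner_alg (c *: x) p = horner_alg x (p \Po (c *: 'X)).
Proof.
elim/poly_ind: p => [|p b IH]; first by rewrite comp_poly0 !rmorph0.
rewrite comp_polyD comp_polyM comp_polyX comp_polyC !(rmorphD, rmorphM) /= IH.
by rewrite horner_algZ !horner_algX !horner_algC.
Qed.

Lemma fcalc_scale (c : R) l f (x : W) : c != 0 -> annihilates l x ->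
  let cl := [seq c * r | r <- l] in
  annihilates cl (c%:C *: x) /\
  fcalc cl f (c%:C *: x) = fcalc l (fun r => f (c * r)) x.
Proof.
move=> c0 ann cl; have [ul _] := ann.
have ucl : uniq cl by rewrite map_inj_uniq // => r r' /(mulfI c0).
have hE (p : {poly R[i]}) r : (p \Po (c%:C *: 'X)).[r%:C] = p.[(c * r)%:C].
  by rewrite horner_comp hornerZ hornerX rmorphM.
have anncl : annihilates cl (c%:C *: x).
  split=> //; rewrite horner_alg_scale (horner_alg_fcalc _ ann).
  rewrite /fcalc big_seq big1 // => r rl; rewrite hE horner_prod.
  by rewrite (big_rem (c * r)) ?map_f //= hornerXsubC subrr mul0r scale0r.
split=> //; rewrite fcalc_fpoly horner_alg_scale (horner_alg_fcalc _ ann).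
by apply: eq_fcalc => r rl; rewrite hE fpolyE // map_f.
Qed.

End ScaledCalculus.

Section EntropyFormula.
Local Open Scope complex_scope.
Variables (R : realType) (A : cstarAlgType R) (Theta : {lrmorphism A -> A}).
Hypothesis Theta_star : forall x, Theta (star x) = star (Theta x).
Hypothesis ThetaK : forall x, Theta (Theta x) = x.
Variables (phi : {scalar A}) (hphi : state phi).
Hypothesis phi_even : forall x, phi (Theta x) = phi x.
Variable ps : seq (A * A).
Let s := unpair ps.
Hypothesis hs : majorana_ext Theta s set0.
Hypothesis faith : faithful_on (region s) phi.
Let D := region_density phi s.

(** For rho = D / m the logarithm of rho is ln D - ln m. *)
Lemma vn_entropyE (m : nat) l : (0 < m)%N -> annihilates l D -> {in l, forall r, 0 < r} ->
  vn_entropy m phi (region s) = ln m%:R - complex.Re (log_mean phi l D).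
Proof.
move=> m0 ann l0.
have [sD starD' DE _ _] := @density_spec _ _ _ Theta_star ThetaK _ hphi phi_even ps hs faith.
have sub := region_subalgebra s.
have mR : (m%:R : R) != 0 by rewrite pnatr_eq0 -lt0n.
have mRi : (m%:R : R)^-1 != 0 by rewrite invr_eq0.
have mE : (m%:R : R[i])^-1 = ((m%:R : R)^-1)%:C by rewrite fmorphV rmorph_nat.
rewrite /vn_entropy -/(region_density phi s) -/D mE.
have [anns E] := fcalc_scale (fun r => (r * ln r)%:C) mRi ann.
rewrite (cfc_fcalc _ anns) E.
have L : fcalc l (fun r => ((m%:R)^-1 * r * ln ((m%:R)^-1 * r))%:C) D
    = (m%:R : R[i])^-1 *: (fcalc l (fun r => (ln r)%:C - (ln m%:R)%:C) D * D).
  rewrite -[X in _ * X](fcalc_id ann) fcalcM // fcalcZ mE; apply: eq_fcalc => r rl.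
  rewrite mulrC lnM ?posrE ?invr_gt0 ?ltr0n ?l0 // lnV ?posrE ?ltr0n //.
  by rewrite -rmorphB -!rmorphM; congr (_%:C); ring.
have sF f : region s (fcalc l f D) by exact: (csub_fcalc l f sub sD).
rewrite L (normalized_traceE Theta_star ThetaK hphi hs); last first.
  by apply: (csubZ sub); apply: (csubM sub).
rewrite tauZ mulrA mulfV ?mul1r; last by rewrite pnatr_eq0 -lt0n.
rewrite -DE //.
have Ec c : fcalc l (fun=> c) D = c%:A.
  rewrite -(horner_algC D) (horner_alg_fcalc _ ann).
  by apply: eq_bigr => r _; rewrite hornerC.
have -> : fcalc l (fun r => (ln r)%:C - (ln m%:R)%:C) D
    = fcalc l (fun r => (ln r)%:C) D + (- (ln m%:R)%:C)%:A by rewrite -Ec fcalcD.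
rewrite raddfD /= linearZ /= hphi.2 /log_mean.
case: (phi _) => u v /=; rewrite mulr1; ring.
Qed.

Lemma log_mean_real l : complex.Im (log_mean phi l D) = 0.
Proof.
have [sD starD' DE _ _] := @density_spec _ _ _ Theta_star ThetaK _ hphi phi_even ps hs faith.
have : log_mean phi l D = conjc (log_mean phi l D).
  rewrite /log_mean -(state_star hphi); congr (phi _).
  rewrite (sop_fcalc (StarOperation starK starD starZ starM) _ _ starD').
  by apply: eq_fcalc => r _; apply/esym; exact: conjc_real.
by case: (log_mean _ _ _) => u v [] h /=; lra.
Qed.

End EntropyFormula.

Section Transport.
Local Open Scope complex_scope.
Variables (R : realType) (A : cstarAlgType R) (Theta : {lrmorphism A -> A}).
Hypothesis Theta_star : forall x, Theta (star x) = star (Theta x).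
Hypothesis ThetaK : forall x, Theta (Theta x) = x.
Variables (phi : {scalar A}) (hphi : state phi).
Hypothesis phi_even : forall x, phi (Theta x) = phi x.
Variable alpha : {lrmorphism A -> A}.
Hypothesis alpha_star : forall x, alpha (star x) = star (alpha x).
Hypothesis phi_alpha : forall x, phi (alpha x) = phi x.

Lemma transport_generated s x : majorana_ext Theta s set0 ->
    majorana_ext Theta (map alpha s) set0 ->
  region (map alpha s) x <-> exists2 y, region s y & x = alpha y.
Proof.
move=> hs hs'; split; last first.
  case=> y sy ->; move: y sy.
  apply: (@cstar_generated_min _ _ _ [set y | region (map alpha s) (alpha y)]); last first.
    move=> g [gs|//]; apply: sub_cstar_generated; left; rewrite /mkset.
    exact: map_f.
  have sub := region_subalgebra (map alpha s).
  split; rewrite /mkset.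
  - by rewrite rmorph1; apply: (csub1 sub).
  - by move=> u v hu hv; rewrite rmorphD; apply: (csubD sub).
  - by move=> c u hu; rewrite linearZ /=; apply: (csubZ sub).
  - by move=> u v hu hv; rewrite rmorphM; apply: (csubM sub).
  - by move=> u hu; rewrite alpha_star; apply: (csub_star sub).
  - by apply: cstar_closed_preimage; [exact: tcont_Theta | exact: (csub_closed sub)].
elim: s hs hs' x => [|g s IH] hs hs' x.
  rewrite /region /= adjoin_nil => /(generated_scalar hphi) xE.
  exists (phi x)%:A; last by rewrite linearZ /= rmorph1.
  have sub := cstar_generated_subalgebra (A := A) set0.
  by apply: (csubZ sub); exact: (csub1 sub).
move: hs hs' => /= [_ _ hs] [mg gs hs'].
rewrite /region adjoin_cons.
move=> /(generated_decomp Theta_star ThetaK mg (majorana_ext_majoranas hs') gs).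
case=> u [v [/(IH hs hs')[u' su' ->] /(IH hs hs')[v' sv' ->] ->]].
exists (u' + v' * g); last by rewrite rmorphD rmorphM.
have sub := cstar_generated_subalgebra (A := A) (adjoin (g :: s) set0).
have inc z : cstar_generated (adjoin s set0) z -> cstar_generated (adjoin (g :: s) set0) z.
  by apply: cstar_generated_sub => y; rewrite adjoin_cons; right.
apply: (csubD sub); first exact: inc.
apply: (csubM sub); first exact: inc.
by apply: sub_cstar_generated; left; rewrite /mkset mem_head.
Qed.

(** The functional tau o alpha is a trace, so it is the trace of the first
    region. *)
Lemma transport_density ps ps' : unpair ps' = map alpha (unpair ps) ->
    majorana_ext Theta (unpair ps) set0 -> majorana_ext Theta (unpair ps') set0 ->
    faithful_on (region (unpair ps)) phi -> faithful_on (region (unpair ps')) phi ->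
  region_density phi (unpair ps') = alpha (region_density phi (unpair ps)).
Proof.
move=> ps'E hs hs' faith faith'.
have [sD _ DE _ _] := @density_spec _ _ _ Theta_star ThetaK _ hphi phi_even ps hs faith.
have hs2 : majorana_ext Theta (map alpha (unpair ps)) set0 by rewrite -ps'E.
have img y : region (unpair ps) y -> region (unpair ps') (alpha y).
  by move=> sy; rewrite ps'E; apply/(transport_generated _ hs hs2); exists y.
have sub := region_subalgebra (unpair ps).
have tauE z : region (unpair ps) z -> tau Theta phi (unpair ps') (alpha z) = tau Theta phi (unpair ps) z.
  move=> sz; apply: (tau_unique Theta_star ThetaK hphi hs (tr := fun z => tau Theta phi (unpair ps') (alpha z))) sz.
  split.
  - by move=> c x y _ _; rewrite rmorphD /= linearZ /= tauD tauZ.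
  - move=> x _; rewrite rmorphM /= alpha_star; have [] := tau_ge0 Theta_star hphi (alpha x) hs'.
    by [].
  - by rewrite rmorph1 (tau1 Theta_star hphi hs').
  - move=> x y sx sy; rewrite !rmorphM; apply: (tauC Theta_star ThetaK hphi hs').
      exact: img.
    exact: img.
apply: (density_eq Theta_star ThetaK hphi phi_even hs' faith'); first exact: img.
move=> y; rewrite ps'E => /(transport_generated _ hs hs2)[x sx ->].
rewrite phi_alpha (DE _ sx) -ps'E -rmorphM tauE //.
exact: (csubM sub).
Qed.

End Transport.

(** * The chain *)

Section Intervals.
Variable I : set int.
Implicit Types k n j : int.

(** The filter makes the list empty when n < k. *)
Definition seglist k n : seq int :=
  [seq j <- [seq k + Posz i | i <- iota 0 (absz (n - k)).+1] | (k <= j <= n) && `[<I j>]].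

Lemma mem_seglist k n j : (j \in seglist k n) = (k <= j <= n) && `[<I j>].
Proof.
rewrite mem_filter andb_idr // => /andP[/andP[kj jn] _]; apply/mapP.
by exists (absz (j - k)); [rewrite mem_iota; lia | lia].
Qed.

Lemma seglistP k n j : reflect (seg I k n j) (j \in seglist k n).
Proof. by rewrite mem_seglist; apply: (iffP andP) => -[h1 h2]; split=> //; apply/asboolP. Qed.

Lemma set_seglist k n : [set` seglist k n] = seg I k n.
Proof. by apply/seteqP; split=> j /seglistP. Qed.

Lemma seglist_uniq k n : uniq (seglist k n).
Proof. by apply: filter_uniq; rewrite map_inj_uniq ?iota_uniq // => i j /addrI []. Qed.

Lemma seg_sub k n : seg I k n `<=` I. Proof. by move=> j []. Qed.
Lemma upto_sub n : upto I n `<=` I. Proof. by move=> j []. Qed.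

Lemma seg1 n : I n -> seg I n n = [set n].
Proof.
move=> In; apply/seteqP; split=> [j [_ jn]|j /= ->]; first by apply/eqP; lia.
by split=> //; rewrite lexx.
Qed.

Hypothesis hI : is_interval I.

Lemma below_topS n : below_top I n -> I (n + 1).
Proof.
by move=> [In [m Im nm]]; apply: (hI In Im); rewrite lerDl /= -ltzD1 ltrD2r.
Qed.

End Intervals.

Section ModuleMaps.
Variables (R : realType) (A : cstarAlgType R) (Theta : {lrmorphism A -> A}).
Hypothesis Theta_star : forall x, Theta (star x) = star (Theta x).
Hypothesis ThetaK : forall x, Theta (Theta x) = x.
Local Notation Cg := (@cstar_generated R A).

(** In u + v g = u + g Theta(v) the generator g stands on the left, so a left
    module map acts on the coefficients u and Theta(v) only. *)
Lemma module_map_range s S S' (D : set A) (E : A -> A) x :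
    majorana_ext Theta s S -> Cg (adjoin s S) `<=` D -> linear_on D E ->
    (forall g x, g \in s -> D x -> E (g * x) = g * E x) ->
    (forall x, Cg S x -> Cg S' (E x)) ->
  Cg (adjoin s S) x -> Cg (adjoin s S') (E x).
Proof.
move=> + + Elin + ES; elim: s x => [|g s IH] x /=; first by rewrite !adjoin_nil => _ _ _; apply: ES.
rewrite !adjoin_cons => -[mg gs hs] sD Emod.
have inc S1 y : Cg (adjoin s S1) y -> Cg (g |` adjoin s S1) y.
  by apply: cstar_generated_sub => z; right.
have {}IH y : Cg (adjoin s S) y -> Cg (g |` adjoin s S') (E y).
  move=> Cy; apply: (inc); apply: IH => // [z /inc/sD//|h z hsn]; apply: Emod.
  by rewrite inE hsn orbT.
have ms := majorana_ext_majoranas hs.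
move=> /(generated_decomp Theta_star ThetaK mg ms gs)[u [v [Cu Cv ->]]].
have CT : Cg (adjoin s S) (Theta v) by apply: (Theta_generated Theta_star).
have DT : D (Theta v) := sD _ (inc _ _ CT).
have sub := cstar_generated_subalgebra (A := A) (g |` adjoin s S').
have Cg0 S1 : Cg (g |` S1) g by apply: sub_cstar_generated; left.
rewrite (generator_swap Theta_star mg ms gs Cv) addrC -[g * _]scale1r Elin; last 2 first.
- apply: sD; apply: (csubM (cstar_generated_subalgebra _)) => //; exact: inc.
- exact: sD _ (inc _ _ Cu).
rewrite scale1r Emod ?mem_head //.
by apply: (csubD sub); [apply: (csubM sub) => //; exact: IH | exact: IH].
Qed.

End ModuleMaps.

Section Chain.
Local Open Scope complex_scope.
Variables (R : realType) (A : cstarAlgType R).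
Variables (I : set int) (hI : is_interval I).
Variables (d : int -> nat) (a : forall j : int, 'I_(d j) -> A).
Hypothesis hA : fermion_algebra I a.
Variables (Theta : {lrmorphism A -> A}) (hTheta : parity I a Theta).
Variables (phi : {scalar A}) (hphi : state phi).
Hypothesis hfaithful : locally_faithful I a phi.
Hypothesis heven : invariant_state Theta phi.
Implicit Types (k n j : int) (L : set int).

Let car := hA.1.
Let Theta_star := parity_star hTheta.
Let ThetaK := parity_involutive hTheta hA.2.

Lemma loc_subalgebra L : cstar_subalgebra (loc a L).
Proof. exact: cstar_generated_subalgebra. Qed.

Lemma loc_sub L L' : L `<=` L' -> loc a L `<=` loc a L'.
Proof.
by move=> LL; apply: cstar_generated_sub => x [j Lj xE]; exists j => //; exact: LL.
Qed.

Lemma region_faithful js : [set` js] `<=` I -> faithful_on (region (region_list a js)) phi.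
Proof. by move=> jI; rewrite region_loc; apply: hfaithful => //; exact: finite_seq. Qed.

Section Window.
Variables (k n : int).
Hypotheses (kn : k <= n) (hn : below_top I n).
Let In : I n := hn.1.
Let In1 : I (n + 1) := below_topS hI hn.

Let js := seglist I k (n - 1).
Definition windowL := region_pairs a (seglist I k (n - 1)).
Definition windowM := region_pairs a [:: n].
Definition windowR := region_pairs a [:: n + 1].
Let sL := unpair windowL.
Let sM := unpair windowM.
Let sR := unpair windowR.

Let jsP j : j \in js -> I j /\ k <= j < n.
Proof. by move=> /seglistP[Ij h]; split=> //; lia. Qed.

Let sLMR : sL ++ (sM ++ sR) = region_list a (js ++ ([:: n] ++ [:: n + 1])).
Proof. by rewrite !region_list_cat. Qed.
Let sRLM : sR ++ (sL ++ sM) = region_list a ([:: n + 1] ++ (js ++ [:: n])).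
Proof. by rewrite !region_list_cat. Qed.
Let sLM : sL ++ sM = region_list a (js ++ [:: n]).
Proof. by rewrite region_list_cat. Qed.
Let sMR : sM ++ sR = region_list a ([:: n] ++ [:: n + 1]).
Proof. by rewrite region_list_cat. Qed.

Let inI j : j \in js ++ ([:: n] ++ [:: n + 1]) -> I j.
Proof. by rewrite mem_cat !inE => /or3P[/jsP[]|/eqP->|/eqP->]. Qed.

Lemma window_ext : majorana_ext Theta (sL ++ (sM ++ sR)) set0.
Proof.
rewrite sLMR; apply: (region_ext0 car hTheta) => [|j /inI//].
rewrite cat_uniq seglist_uniq /= andbT inE; apply/andP; split; last by lia.
by rewrite orbF; apply/norP; split; apply/negP => /jsP[_]; lia.
Qed.

Lemma window_ext' : majorana_ext Theta (sR ++ (sL ++ sM)) set0.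
Proof.
rewrite sRLM; apply: (region_ext0 car hTheta).
  rewrite cat_uniq /= cat_uniq seglist_uniq /= andbT orbF.
  apply/andP; split; last by apply/negP => /jsP[_]; lia.
  by apply/hasPn => j; rewrite mem_cat !inE => /orP[/jsP[_]|]; lia.
by move=> j jin; apply: inI; move: jin; rewrite /mkset !(mem_cat, inE) => /or3P[]->; rewrite ?orbT.
Qed.

Lemma window_faithful : faithful_on (region (sL ++ (sM ++ sR))) phi.
Proof. by rewrite sLMR; apply: region_faithful => j /inI. Qed.

Lemma window_region : region (sL ++ (sM ++ sR)) = loc a (seg I k (n + 1)).
Proof.
rewrite sLMR region_loc; congr loc; apply/seteqP; split=> j.
  rewrite /= mem_cat !inE => /or3P[/jsP[Ij]|/eqP->|/eqP->]; split=> //; lia.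
move=> [Ij h] /=; rewrite mem_cat !inE mem_seglist (asboolT Ij); lia.
Qed.

Lemma window_regionLM : region (sL ++ sM) = loc a (seg I k n).
Proof.
rewrite sLM region_loc; congr loc; apply/seteqP; split=> j.
  rewrite /= mem_cat !inE => /orP[/jsP[Ij]|/eqP->]; split=> //; lia.
move=> [Ij h] /=; rewrite mem_cat !inE mem_seglist (asboolT Ij); lia.
Qed.

Lemma window_regionMR : region (sM ++ sR) = loc a (seg I n (n + 1)).
Proof.
rewrite sMR region_loc; congr loc; apply/seteqP; split=> j.
  rewrite /= !inE => /orP[/eqP->|/eqP->]; split=> //; lia.
move=> [Ij h] /=; rewrite !inE; lia.
Qed.

Lemma window_regionM : region sM = loc a (seg I n n).
Proof.
rewrite seg1 // -[sM]/(region_list a [:: n]) region_loc; congr loc.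
by apply/seteqP; split=> j; rewrite /= inE => /eqP.
Qed.

Lemma window_density : [/\ region_density phi (sL ++ (sM ++ sR)) = density I a phi k (n + 1),
  region_density phi (sL ++ sM) = density I a phi k n,
  region_density phi (sM ++ sR) = density I a phi n (n + 1) &
  region_density phi sM = density I a phi n n].
Proof.
by rewrite /region_density /density window_region window_regionLM window_regionMR window_regionM.
Qed.

Lemma window_spectra : exists2 l : seq R, {in l, forall r, 0 < r} &
  [/\ annihilates l (density I a phi k (n + 1)), annihilates l (density I a phi k n),
      annihilates l (density I a phi n (n + 1)) & annihilates l (density I a phi n n)].
Proof.
have [l l0] := densities_spec Theta_star ThetaK hphi heven window_ext window_ext' window_faithful.
by have [-> -> -> ->] := window_density; exists l.
Qed.

End Window.

Lemma cocycleE k n l t : annihilates l (density I a phi k (n + 1)) ->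
    annihilates l (density I a phi k n) ->
  cocycle I a phi k n t = fcalc l (unit_phase t) (density I a phi k (n + 1))
    * fcalc l (unit_phase (- t)) (density I a phi k n).
Proof. by move=> h1 h2; rewrite -!cfc_fcalc. Qed.

Lemma markov_implies_cocycle : markov_state I a Theta phi ->
  forall t k n, I k -> k < n -> below_top I n ->
  even_part Theta (loc a (seg I n (n + 1))) (cocycle I a phi k n t).
Proof.
move=> [_ _ markov] t k n Ik kn hn; have kn' := ltW kn.
have [E [[Elin Ecod Ecp E1 Emod] Eeven Ephi Eloc]] := markov _ hn.
have [In In1] := (hn.1, below_topS hI hn).
have subD := loc_subalgebra (upto I (n + 1)).
have [l l0 [annM annN _ _]] := window_spectra kn' hn.
rewrite (cocycleE _ annM annN).
have [dM dN _ _] := window_density kn' hn.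
move: annM annN; rewrite -dM -dN => annM annN.
have inD : loc a (seg I k (n + 1)) `<=` loc a (upto I (n + 1)).
  by apply: loc_sub => j [Ij /andP[]].
have leftC g : g \in unpair (windowL k n) -> loc a (upto I (n - 1)) g.
  move=> gin; have : region (unpair (windowL k n)) g.
    by apply: sub_cstar_generated; left.
  rewrite /windowL region_loc set_seglist; apply: loc_sub => j [Ij /andP[]] //.
have Efix g : g \in unpair (windowL k n) -> E g = g.
  move=> /leftC Cg; rewrite -[g in LHS]mulr1 Emod // ?E1 ?mulr1 //.
  exact: (csub1 subD).
have Erange x : loc a (seg I k (n + 1)) x -> loc a (seg I k n) (E x).
  rewrite -(window_region kn' hn) -(window_regionLM kn' hn) /region !(adjoin_cat (unpair (windowL k n))).
  have [hL _] := (majorana_ext_cat _ _ _ _).1 (window_ext kn' hn).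
  have hD : cstar_generated (adjoin (unpair (windowL k n)) (adjoin (unpair (windowM n)
      ++ unpair (windowR n)) set0)) `<=` loc a (upto I (n + 1)).
    by rewrite -adjoin_cat -/(region _) (window_region kn' hn).
  apply: (module_map_range Theta_star ThetaK hL hD Elin).
    by move=> g y /leftC Cg Dy; apply: Emod.
  move=> y; rewrite -!/(region _) (window_regionMR kn' hn) (window_regionM hn) (seg1 In).
  exact: Eloc.
have [h1 h2] := @markov_cocycle _ _ _ Theta_star ThetaK _ hphi heven _ _ _
  (window_ext kn' hn) (window_ext' kn' hn) (window_faithful kn' hn) l l0 annM annN E
  ltac:(by move=> c x y; rewrite (window_region kn' hn) => /inD Dx /inD Dy; apply: Elin)
  ltac:(by move=> x; rewrite (window_region kn' hn) (window_regionLM kn' hn); exact: Erange)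
  ltac:(by move=> x; rewrite (window_region kn' hn) => /inD; exact: (cp_star subD Ecp E1))
  ltac:(by move=> x; rewrite (window_region kn' hn) => /inD; exact: (cp_schwarz hphi subD Ecp E1 Ephi))
  Efix t.
by split; first rewrite -(window_regionMR kn' hn).
Qed.

(** The algebras of the finite regions increase, so the closure of their union
    is an algebra, and it contains the generators. *)
Lemma finite_regions_dense n x : loc a (upto I n) x ->
  norm_closure [set y | exists m : nat, loc a (seg I (n - m%:Z) n) y] x.
Proof.
have inc m m' : (m <= m')%N -> loc a (seg I (n - m%:Z) n) `<=` loc a (seg I (n - m'%:Z) n).
  by move=> mm; apply: loc_sub => j [Ij h]; split=> //; lia.
have sub m := loc_subalgebra (seg I (n - m%:Z) n).
have two y z : (exists m : nat, loc a (seg I (n - m%:Z) n) y) ->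
    (exists m : nat, loc a (seg I (n - m%:Z) n) z) ->
    exists2 m : nat, loc a (seg I (n - m%:Z) n) y & loc a (seg I (n - m%:Z) n) z.
  by move=> [m hm] [m' hm']; exists (maxn m m'); [apply: inc hm | apply: inc hm'];
    rewrite ?leq_maxl ?leq_maxr.
move: x; apply: cstar_generated_min.
  apply: norm_closure_subalgebra.
  - by exists 0%N; exact: csub1.
  - by move=> y z hy hz; have [m ? ?] := two _ _ hy hz; exists m; exact: (csubD (sub m)).
  - by move=> c y [m hm]; exists m; exact: (csubZ (sub m)).
  - by move=> y z hy hz; have [m ? ?] := two _ _ hy hz; exists m; exact: (csubM (sub m)).
  - by move=> y [m hm]; exists m; exact: (csub_star (sub m)).
move=> g [j [Ij jn] [i ->]] e e0; exists (a i); last by rewrite subrr cnorm0.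
exists (absz (n - j)); apply: sub_cstar_generated; exists j; last by exists i.
by split=> //; lia.
Qed.

(** The algebra of the half-line is approximated by the finite-dimensional
    algebras of the finite regions. *)
Lemma sum_of_squares_positive n m (X : 'M[A]_m) : sum_of_squares (loc a (upto I n)) X ->
  mx_positive (loc a (upto I n)) X.
Proof.
move=> [r [Z [LZ ->]]].
apply: (sum_of_squares_is_square (phi := phi) (F := fun m => loc a (seg I (n - m%:Z) n))) => //.
- exact: loc_subalgebra.
- move=> p; rewrite -set_seglist -region_loc; apply: (generated_findim Theta_star ThetaK hphi).
    apply: (region_ext0 car hTheta); first exact: seglist_uniq.
    by rewrite set_seglist; exact: seg_sub.
  by apply: region_faithful; rewrite set_seglist; exact: seg_sub.
- by move=> p p' pp; apply: loc_sub => j [Ij h]; split=> //; lia.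
- by move=> p; apply: loc_sub => j [Ij /andP[]].
move=> x /finite_regions_dense hx e /hx[y [p Ly] xy]; by exists p; exists y.
Qed.

Lemma state_tends0 (u : nat -> A) x : tends u x -> (forall m : nat, phi (u m) = 0) -> phi x = 0.
Proof.
move=> ux u0; apply/eqP/negP => /negP nx.
have h0 : 0 < Normc.normc (phi x).
  rewrite lt_def; apply/andP; split; last by case: (phi x) => v w; exact: sqrtr_ge0.
  by apply: contra_neq nx => /Normc.eq0_normc.
have [N /(_ N (leqnn N))] := ux (Normc.normc (phi x) / 4) ltac:(by rewrite divr_gt0).
rewrite cnormB; have := state_bounded hphi (x - u N).
rewrite raddfB /= u0 subr0; lra.
Qed.

Section CocycleImpliesMarkov.
Hypothesis local_cocycle : forall t k n, I k -> k < n -> below_top I n ->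
  even_part Theta (loc a (seg I n (n + 1))) (cocycle I a phi k n t).

(** When k is not a site, k can be replaced by k + 1; when it is a site, the
    cocycles are local and ratio_localization applies. *)
Lemma cocycle_ratio_local k n l f : k <= n -> below_top I n -> {in l, forall r, 0 < r} ->
    annihilates l (density I a phi k (n + 1)) -> annihilates l (density I a phi k n) ->
    annihilates l (density I a phi n (n + 1)) -> annihilates l (density I a phi n n) ->
  ratio_calc l f (density I a phi k (n + 1)) 1 (density I a phi k n)
    = ratio_calc l f (density I a phi n (n + 1)) 1 (density I a phi n n).
Proof.
move=> kn hn l0 annM annN annBC annB.
move: {2}(absz (n - k)) (erefl (absz (n - k))) => m; elim: m k kn annM annN => [|m IH] k kn annM annN mE.
  by have -> : k = n by lia.
have [Ik|nIk] := pselect (I k); last first.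
  have E p : density I a phi k p = density I a phi (k + 1) p.
    congr adjusted_density; congr loc; apply/seteqP; split=> j [Ij h]; split=> //; last by lia.
    have : j != k by apply: contra_notN nIk => /eqP <-.
    by lia.
  by rewrite !E in annM annN *; apply: IH => //; lia.
have kn' : k < n by lia.
have [dM dN dBC dB] := window_density kn hn.
rewrite -dM -dN -dBC -dB in annM annN annBC annB *.
apply: (ratio_localization Theta_star ThetaK hphi heven (window_ext kn hn) (window_ext' kn hn)
  (window_faithful kn hn) l0 annM annN annBC annB) => t.
rewrite (ratio_phase _ l0) mulr1 dM dN -cocycleE -?dM -?dN // (window_regionMR kn hn).
by have [] := local_cocycle t Ik kn' hn.
Qed.

Lemma right_ext n L : I (n + 1) -> L `<=` I -> ~ L (n + 1) ->
  majorana_ext Theta (unpair (windowR n)) (majorana_set a L).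
Proof.
move=> In1 LI nL; apply: (region_ext car hTheta (js := [:: n + 1])) => // j; rewrite /mkset inE => /eqP -> //.
Qed.

Lemma right_adjoin n L :
  cstar_generated (adjoin (unpair (windowR n)) (majorana_set a L)) = loc a ((n + 1) |` L).
Proof.
rewrite (adjoin_region a [:: n + 1]) -loc_majorana; congr (loc _ (_ `|` _)).
by apply/seteqP; split=> j; rewrite /= inE => /eqP.
Qed.

(** The element markov_kraus of the sites n and n + 1, written without a
    choice of nodes: it does not depend on the left end of the window. *)
Definition kraus n : A := cfc (fun r => (Num.sqrt r)%:C) (density I a phi n (n + 1))
  * cfc (fun r => ((Num.sqrt r)^-1)%:C) (density I a phi n n).

Definition expectation n x : A :=
  forgets Theta (unpair (windowR n)) (star (kraus n) * x * kraus n).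

Section Expectation.
Variable n : int.
Hypothesis hn : below_top I n.
Let In : I n := hn.1.
Let In1 : I (n + 1) := below_topS hI hn.
Let w := kraus n.
Let D := loc a (upto I (n + 1)).
Let B := loc a (upto I n).
Let subD : cstar_subalgebra D := loc_subalgebra _.

Let n_not_upto : ~ upto I n (n + 1).
Proof. by case=> _; lia. Qed.

Lemma upto_succ : upto I (n + 1) = (n + 1) |` upto I n.
Proof.
apply/seteqP; split=> [j [Ij jn]|j [->|[Ij jn]]]; last 2 first.
- by split.
- by split=> //; lia.
have [->|jn'] := eqVneq j (n + 1); first by left.
by right; split=> //; lia.
Qed.

Lemma seg_succ : seg I n (n + 1) = (n + 1) |` [set n].
Proof.
apply/seteqP; split=> [j [Ij jn]|j [->|->]]; last 2 first.
- by split=> //; lia.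
- by split=> //; lia.
have [->|jn'] := eqVneq j (n + 1); first by left.
by right; apply/eqP; lia.
Qed.

Let D_adjoin : D = cstar_generated (adjoin (unpair (windowR n)) (majorana_set a (upto I n))).
Proof. by rewrite /D right_adjoin upto_succ. Qed.

Let extB : majorana_ext Theta (unpair (windowR n)) (majorana_set a (upto I n)).
Proof. by apply: right_ext => //; exact: upto_sub. Qed.

Lemma expectationE l x : annihilates l (density I a phi n (n + 1)) ->
    annihilates l (density I a phi n n) ->
  w = markov_kraus phi (windowM n) (windowR n) l /\
  expectation n x = markov_expectation Theta phi (windowM n) (windowR n) l x.
Proof.
move=> annBC annB; have [_ _ dBC dB] := window_density (lexx n) hn.
suff wE : w = markov_kraus phi (windowM n) (windowR n) l.
  by split=> //; rewrite /expectation -/w wE.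
by rewrite /markov_kraus dBC dB -!cfc_fcalc.
Qed.

Lemma kraus_spec : loc a (seg I n (n + 1)) w /\ Theta w = w.
Proof.
have nn := lexx n; have [dM dN dBC dB] := window_density nn hn.
have [l l0 [annM annN annBC annB]] := window_spectra nn hn.
have [-> _] := expectationE 1 annBC annB; split.
  rewrite -(window_regionMR nn hn).
  exact: (markov_kraus_region Theta_star ThetaK hphi heven (window_ext nn hn) (window_ext' nn hn)
    (window_faithful nn hn)).
exact: (markov_kraus_even Theta_star ThetaK hphi heven (window_ext nn hn) (window_ext' nn hn)
    (window_faithful nn hn)).
Qed.

Let Dw : D w.
Proof. by have [+ _] := kraus_spec; apply: loc_sub => j [Ij /andP[]]. Qed.
Let Dsw : D (star w) := csub_star subD Dw.

Lemma expectation1 : expectation n 1 = 1.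
Proof.
have nn := lexx n; have [dM dN dBC dB] := window_density nn hn.
have [l l0 [annM annN annBC annB]] := window_spectra nn hn.
have [_ ->] := expectationE 1 annBC annB.
rewrite -dBC in annBC; rewrite -dB in annB.
exact: (markov_expectation1 Theta_star ThetaK hphi heven (window_ext nn hn) (window_ext' nn hn)
    (window_faithful nn hn) l0 annBC annB).
Qed.

Lemma expectation_codom x : D x -> B (expectation n x).
Proof.
move=> Dx; rewrite /B (loc_majorana a (upto I n)).
apply: (forgets_generated Theta_star ThetaK extB); rewrite -D_adjoin.
exact: (csubM3 subD Dsw Dx Dw).
Qed.

Lemma expectation_local x : loc a (seg I n (n + 1)) x -> loc a [set n] (expectation n x).
Proof.
have ext1 : majorana_ext Theta (unpair (windowR n)) (majorana_set a [set n]).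
  by apply: right_ext => // [j ->//|/eqP]; lia.
move=> Sx; rewrite (loc_majorana a [set n]).
apply: (forgets_generated Theta_star ThetaK ext1); rewrite right_adjoin -seg_succ.
have sub := loc_subalgebra (seg I n (n + 1)); have [Sw _] := kraus_spec.
exact: (csubM3 sub (csub_star sub Sw) Sx Sw).
Qed.

Lemma expectation_even x : Theta (expectation n x) = expectation n (Theta x).
Proof.
have [_ tw] := kraus_spec.
rewrite /expectation (forgets_Theta _ extB) 2!rmorphM /=.
by rewrite Theta_star tw.
Qed.

(** The element kraus is even and lives on the sites n and n + 1, so the
    generators of the sites to the left commute with it. *)
Lemma kraus_commute c : loc a (upto I (n - 1)) c -> c * star w = star w * c.
Proof.
have [Sw tw] := kraus_spec; have sub := loc_subalgebra (seg I n (n + 1)).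
have Ssw := csub_star sub Sw.
have gw g v : majorana_set a (upto I (n - 1)) g -> loc a (seg I n (n + 1)) v -> Theta v = v ->
    g * v = v * g.
  move=> hg Sv tv; have mg := majorana_set_majoranas car hTheta (@upto_sub I (n - 1)) hg.
  rewrite (loc_majorana a (seg I n (n + 1))) in Sv.
  apply: (even_commute Theta_star mg (majorana_set_majoranas car hTheta (@seg_sub I n (n + 1))) _ Sv tv).
  case: hg => j [Ij jn] [i gE]; apply: (majorana_set_anticommute car Ij _ _ gE); first exact: seg_sub.
  by case=> _; lia.
rewrite (loc_majorana a (upto I (n - 1))); apply: generated_commute => g hg; apply: gw => //.
  by rewrite Theta_star tw.
by rewrite starK.
by rewrite starK.
Qed.

Lemma expectation_module c x : loc a (upto I (n - 1)) c -> D x ->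
  expectation n (c * x) = c * expectation n x.
Proof.
move=> Cc Dx; rewrite /expectation mulrA -kraus_commute // -!mulrA.
rewrite (forgetsMl Theta_star extB) ?mulrA // -(loc_majorana a (upto I n)).
by apply: loc_sub Cc => j [Ij jn]; split=> //; lia.
Qed.

Lemma expectation_linear : linear_on D (expectation n).
Proof.
move=> c x y _ _; rewrite /expectation mulrDr mulrDl forgetsD -scalerAr -scalerAl.
by rewrite forgetsZ.
Qed.

(** Conjugation maps squares to squares, and forgetting maps them to sums of
    squares. *)
Lemma expectation_cp : completely_positive D B (expectation n).
Proof.
move=> m X [Y DY ->]; apply: sum_of_squares_positive.
have -> : map_mx (expectation n) (star_mx Y *m Y)
    = map_mx (forgets Theta (unpair (windowR n))) (map_mx (fun x => star w * x * w) (star_mx Y *m Y)).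
  by rewrite -map_mx_comp.
rewrite (loc_majorana a (upto I n)); apply: (sum_of_squares_forgets Theta_star ThetaK extB).
rewrite -D_adjoin; exists 1%N, (fun=> map_mx (fun y => y * w) Y); split.
  by move=> _ i j; rewrite mxE; apply: (csubM subD).
rewrite big_ord1; apply/matrixP => i j; rewrite !mxE mulr_sumr mulr_suml.
by apply: eq_bigr => p _; move: (w) => v; rewrite !mxE starM !mulrA.
Qed.

Lemma tcont_expectation : tcont (expectation n).
Proof.
move=> u x ux; apply: (tcont_forgets Theta_star); apply: tendsMr; exact: tendsMl.
Qed.

(** On a finite window [k, n + 1] this is markov_expectation_phi, because the
    expectation is the same for all k; the finite windows are dense. *)
Lemma expectation_state x : D x -> phi (expectation n x) = phi x.
Proof.
move=> /finite_regions_dense/tends_approx[u hu ux].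
suff : phi (expectation n x - x) = 0 by move/eqP; rewrite raddfB /= subr_eq0 => /eqP.
have ux' : tends (fun m => expectation n (u m) - u m) (expectation n x - x).
  apply: tendsD; first exact: tcont_expectation.
  by have := tendsZ (-1) ux; rewrite scaleN1r; congr tends; apply: funext => m; rewrite scaleN1r.
apply: (state_tends0 ux') => m; rewrite raddfB /=; apply/eqP; rewrite subr_eq0; apply/eqP.
(* The window has to contain the site n. *)
have [p Lp] := hu m; pose k := Num.min n (n + 1 - p%:Z).
have kn : k <= n by rewrite /k ge_min lexx.
have Lu : loc a (seg I k (n + 1)) (u m).
  by apply: loc_sub Lp => j [Ij h]; split=> //; rewrite /k; lia.
have [dM dN dBC dB] := window_density kn hn.
have [l l0 [annM annN annBC annB]] := window_spectra kn hn.
have [_ ->] := expectationE (u m) annBC annB.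
have loc_ratio f := cocycle_ratio_local f kn hn l0 annM annN annBC annB.
rewrite -dM -dN -dBC -dB in annM annN annBC annB loc_ratio.
apply: (markov_expectation_phi Theta_star ThetaK hphi heven (window_ext kn hn) (window_ext' kn hn)
    (window_faithful kn hn) l0 annM annN loc_ratio).
by rewrite (window_region kn hn).
Qed.

End Expectation.

Lemma cocycle_implies_markov : markov_state I a Theta phi.
Proof.
split=> // n hn; exists (expectation n); split.
- split.
  + exact: expectation_linear.
  + exact: expectation_codom.
  + exact: expectation_cp.
  + exact: expectation1.
  + exact: expectation_module.
- by move=> x _; rewrite expectation_even.
- exact: expectation_state.
- exact: expectation_local.
Qed.

End CocycleImpliesMarkov.

Section Entropy.

Lemma region_seglist k n : region (region_list a (seglist I k n)) = loc a (seg I k n).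
Proof. by rewrite region_loc set_seglist. Qed.

Lemma seglist_ext k n : majorana_ext Theta (region_list a (seglist I k n)) set0.
Proof.
by apply: (region_ext0 car hTheta (seglist_uniq _ _ _)); rewrite set_seglist; exact: seg_sub.
Qed.

Lemma seglist_faithful k n : faithful_on (region (region_list a (seglist I k n))) phi.
Proof. by apply: region_faithful; rewrite set_seglist; exact: seg_sub. Qed.

Lemma density_seglist k n :
  density I a phi k n = region_density phi (unpair (region_pairs a (seglist I k n))).
Proof. by rewrite /region_density -/(region_list a _) region_seglist. Qed.

Lemma density_spectrum k n : exists2 l : seq R, {in l, forall r, 0 < r} &
  annihilates l (density I a phi k n).
Proof.
rewrite density_seglist.
have [_ _ _ _ [l ann l0]] := density_spec Theta_star ThetaK hphi heven
  (ps := region_pairs a (seglist I k n)) (seglist_ext k n) (@seglist_faithful k n).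
by exists l.
Qed.

Definition mode_number k n : nat := (\sum_(j <- seglist I k n) d j)%N.

Lemma mode_number_succ k n : k <= n -> I (n + 1) ->
  mode_number k (n + 1) = (mode_number k n + d (n + 1))%N.
Proof.
move=> kn In1; rewrite /mode_number addnC -(big_cons _ _ (n + 1) _ xpredT d).
apply: perm_big; apply: uniq_perm; first exact: seglist_uniq.
  rewrite /= seglist_uniq andbT mem_seglist; lia.
move=> j; rewrite inE !mem_seglist.
have [->|jn] := eqVneq j (n + 1); first by rewrite (asboolT In1) /= andbT; lia.
by case: asboolP => _; rewrite ?andbF //=; lia.
Qed.

Lemma local_entropyE k n l : annihilates l (density I a phi k n) -> {in l, forall r, 0 < r} ->
  local_entropy I a phi k n
    = (mode_number k n)%:R * ln 2 - complex.Re (log_mean phi l (density I a phi k n)).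
Proof.
move=> ann l0; rewrite /local_entropy -set_seglist -fsbig_seq ?seglist_uniq //=.
rewrite -region_loc density_seglist.
have m0 : (0 < 2 ^ mode_number k n)%N by rewrite expn_gt0.
rewrite density_seglist in ann *.
rewrite (vn_entropyE Theta_star ThetaK hphi heven (seglist_ext k n) (@seglist_faithful k n) m0 ann l0).
by rewrite natrX lnXn ?ltr0n // mulr_natl.
Qed.

Lemma log_mean_density k n l :
  log_mean phi l (density I a phi k n) = (complex.Re (log_mean phi l (density I a phi k n)))%:C.
Proof.
have := log_mean_real Theta_star ThetaK hphi heven (ps := region_pairs a (seglist I k n))
  (seglist_ext k n) (@seglist_faithful k n) l.
by rewrite -density_seglist; case: (log_mean _ _ _) => u v /= ->.
Qed.

(** The terms ln(2^N) of the entropies cancel, since both differences add the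
    single site n + 1. *)
Lemma entropy_increment k n l : k <= n -> below_top I n -> {in l, forall r, 0 < r} ->
    annihilates l (density I a phi k (n + 1)) -> annihilates l (density I a phi k n) ->
    annihilates l (density I a phi n (n + 1)) -> annihilates l (density I a phi n n) ->
  local_entropy I a phi k (n + 1) - local_entropy I a phi k n
    = local_entropy I a phi n (n + 1) - local_entropy I a phi n n <->
  log_mean phi l (density I a phi k (n + 1)) - log_mean phi l (density I a phi k n)
    = log_mean phi l (density I a phi n (n + 1)) - log_mean phi l (density I a phi n n).
Proof.
move=> kn hn l0 h1 h2 h3 h4.
rewrite (local_entropyE h1 l0) (local_entropyE h2 l0) (local_entropyE h3 l0) (local_entropyE h4 l0).
have In1 := below_topS hI hn.
rewrite (mode_number_succ kn In1) (mode_number_succ (lexx n) In1) !natrD.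
rewrite (log_mean_density k (n + 1)) (log_mean_density k n).
rewrite (log_mean_density n (n + 1)) (log_mean_density n n) /= -!rmorphB.
split=> [h|/(@complexI R) h]; last by rewrite !mulrDl; move: h; lra.
by congr (_%:C); move: h; rewrite !mulrDl; lra.
Qed.

Lemma entropy_implies_cocycle k n t : k <= n -> below_top I n ->
    local_entropy I a phi k (n + 1) - local_entropy I a phi k n
      = local_entropy I a phi n (n + 1) - local_entropy I a phi n n ->
  even_part Theta (loc a (seg I n (n + 1))) (cocycle I a phi k n t).
Proof.
move=> kn hn; have [dM dN dBC dB] := window_density kn hn.
have [l l0 [annM annN annBC annB]] := window_spectra kn hn.
move=> /(entropy_increment kn hn l0 annM annN annBC annB).
rewrite (cocycleE _ annM annN) => hS.
rewrite -dM -dN -dBC -dB in annM annN annBC annB hS *.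
have := entropy_cocycle Theta_star ThetaK hphi heven (window_ext kn hn) (window_ext' kn hn)
  (window_faithful kn hn) l0 annM annN annBC annB hS t.
rewrite !(ratio_phase _ l0) !mulr1 => ->.
have [BD _ tD _] := DBC_spec Theta_star ThetaK hphi heven (window_ext kn hn) (window_faithful kn hn).
have [BB _ tB _] := DB_spec Theta_star ThetaK hphi heven (window_ext' kn hn) (window_faithful kn hn).
split; last by rewrite rmorphM /= !lrmorph_fcalc tD tB.
rewrite -(window_regionMR kn hn).
have sub := region_subalgebra (unpair (windowM n) ++ unpair (windowR n)).
apply: (csubM sub); apply: (csub_fcalc _ _ sub) => //.
by apply: region_sub BB => x; rewrite mem_cat => ->.
Qed.

Lemma cocycle_implies_entropy k n :
    (forall t k n, I k -> k < n -> below_top I n ->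
      even_part Theta (loc a (seg I n (n + 1))) (cocycle I a phi k n t)) ->
    k <= n -> below_top I n ->
  local_entropy I a phi k (n + 1) - local_entropy I a phi k n
    = local_entropy I a phi n (n + 1) - local_entropy I a phi n n.
Proof.
move=> local_cocycle kn hn; have [dM dN dBC dB] := window_density kn hn.
have [l l0 [annM annN annBC annB]] := window_spectra kn hn.
apply/(entropy_increment kn hn l0 annM annN annBC annB).
have loc_ratio f := cocycle_ratio_local local_cocycle f kn hn l0 annM annN annBC annB.
rewrite -dM -dN -dBC -dB in annM annN annBC annB loc_ratio *.
exact: (ratio_local_entropy l0 annM annN annBC annB).
Qed.

End Entropy.

End Chain.

(** * Translation invariant states *)

Section Translation.
Local Open Scope complex_scope.
Variables (R : realType) (A : cstarAlgType R) (d0 : nat).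
Local Notation I := (setT : set int).
Variable a : forall j : int, 'I_d0 -> A.
Hypothesis hA : fermion_algebra (d := fun=> d0) I a.
Variables (Theta : {lrmorphism A -> A}) (hTheta : parity (d := fun=> d0) I a Theta).
Variables (phi : {scalar A}) (hphi : state phi).
Hypothesis hfaithful : locally_faithful (d := fun=> d0) I a phi.
Hypothesis heven : invariant_state Theta phi.
Variables (alpha : {lrmorphism A -> A}).
Hypothesis halpha : site_shift (d := fun=> d0) a alpha.
Hypothesis phi_alpha : invariant_state alpha phi.
Implicit Types k n j : int.
Local Notation d := (fun=> d0).
Local Notation local_entropy := (local_entropy (d := d) I a phi).
Local Notation density := (density (d := d) I a phi).
Local Notation region_list := (region_list (d := d) a).

Let alpha_star x : alpha (star x) = star (alpha x). Proof. exact: halpha.1.2. Qed.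

Lemma shift_region_list js :
  region_list [seq j + 1 | j <- js] = map alpha (region_list js).
Proof.
elim: js => [//|j js IH].
rewrite -cat1s map_cat !region_list_cat map_cat IH; congr (_ ++ _).
rewrite /region_list /region_pairs /= !cats0 /unpair map_flatten -!map_comp; congr flatten.
apply: eq_map => i /=.
have ha : alpha (a j i) = a (j + 1) i by apply: (halpha.2 j i i).
by rewrite /maj1 /maj2 rmorphD linearZ /= rmorphB /= alpha_star ha.
Qed.

Let loc_shift k n : region (region_list [seq j + 1 | j <- seglist I k n])
  = loc (d := d) a (seg I (k + 1) (n + 1)).
Proof.
rewrite region_loc; congr loc; apply/seteqP; split=> j.
  by move=> /mapP[i /seglistP[_ h] ->]; split=> //; lia.
move=> [_ h]; apply/mapP; exists (j - 1); last by rewrite subrK.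
by apply/seglistP; split=> //; lia.
Qed.

Lemma density_shift k n : density (k + 1) (n + 1)
  = alpha (density k n).
Proof.
rewrite [in RHS]density_seglist /density -loc_shift.
set js := [seq j + 1 | j <- _].
have ujs : uniq js by rewrite map_inj_uniq ?seglist_uniq // => x y /addIr.
apply: (transport_density (parity_star hTheta) (parity_involutive hTheta hA.2) hphi heven
  alpha_star phi_alpha (ps := region_pairs (d := d) a (seglist I k n))
  (ps' := region_pairs (d := d) a js)).
- exact: shift_region_list.
- exact: (seglist_ext hA hTheta).
- exact: (region_ext0 hA.1 hTheta).
- exact: (seglist_faithful hfaithful).
- exact: (region_faithful hfaithful).
Qed.

Lemma local_entropy_shift k n : local_entropy (k + 1) (n + 1)
  = local_entropy k n.
Proof.
have [l l0 ann] := density_spectrum hA hTheta hphi hfaithful heven k n.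
have ann' : annihilates l (density (k + 1) (n + 1)).
  by rewrite density_shift; apply: lrmorph_annihilates.
rewrite (local_entropyE hA hTheta hphi hfaithful heven ann l0).
rewrite (local_entropyE hA hTheta hphi hfaithful heven ann' l0).
rewrite density_shift /log_mean -lrmorph_fcalc phi_alpha; congr (_%:R * _ - _).
rewrite /mode_number -[RHS](big_map (fun j => j + 1) xpredT (fun=> d0)).
apply: perm_big; apply: uniq_perm; first exact: seglist_uniq.
  by rewrite map_inj_uniq ?seglist_uniq // => x y /addIr.
move=> j; rewrite -[j in RHS](subrK 1) (mem_map (f := fun x : int => x + 1)) => [|x y /addIr //].
by rewrite !mem_seglist !asboolT // !andbT; lia.
Qed.

Lemma local_entropy_translate k n :
  local_entropy k n = local_entropy 0 (n - k).
Proof.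
have shift (m : nat) p q : local_entropy (p + m%:Z) (q + m%:Z)
    = local_entropy p q.
  elim: m => [|m IH]; first by rewrite !addr0.
  by rewrite -addn1 PoszD !addrA local_entropy_shift.
have [k0|k0] := leP 0 k.
  have kE : k = 0 + (absz k)%:Z by rewrite add0r gez0_abs.
  have nE : n = n - k + (absz k)%:Z by rewrite gez0_abs // subrK.
  by rewrite {1}kE {1}nE shift.
have kE : k + (absz k)%:Z = 0 by rewrite ltz0_abs // subrr.
have nE : n - k = n + (absz k)%:Z by rewrite ltz0_abs.
by rewrite nE -[LHS](shift (absz k)) kE.
Qed.

(** By translation, the increment of the entropy from the site n to the sites
    n and n + 1 does not depend on n. *)
Lemma cocycle_iff_entropy :
  (forall (t : R) k n, I k -> k < n -> below_top I n ->
    even_part Theta (loc (d := d) a (seg I n (n + 1)))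
      (cocycle (d := d) I a phi k n t)) <->
  (forall n, 1 <= n ->
    local_entropy 0 (n + 1) - local_entropy 0 n
      = local_entropy 0 1 - local_entropy 0 0).
Proof.
have intT : is_interval I by [].
have top n : below_top I n by split=> //; exists (n + 1) => //; rewrite ltzD1.
split=> [h n n1|h t k n _ kn _].
  have n0 : 0 <= n by apply: le_trans n1.
  rewrite (cocycle_implies_entropy intT hA hTheta hphi hfaithful heven h n0 (top n)).
  rewrite (local_entropy_translate n (n + 1)) (local_entropy_translate n n).
  by rewrite [n + 1 - n]addrAC !subrr add0r.
apply: (entropy_implies_cocycle intT hA hTheta hphi hfaithful heven t (ltW kn) (top n)).
rewrite (local_entropy_translate k (n + 1)) (local_entropy_translate k n).
rewrite (local_entropy_translate n (n + 1)) (local_entropy_translate n n).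
have n1 : 1 <= n - k by rewrite -gtz0_ge1 subr_gt0.
have := h _ n1; rewrite [n + 1 - n]addrAC !subrr add0r => <-.
by rewrite addrAC.
Qed.

End Translation.

Theorem theorem4p1 (R : realType) (A : cstarAlgType R)
  (I : set int) (hI : is_interval I) (hI0 : I !=set0)
  (d : int -> nat) (a : forall j : int, 'I_(d j) -> A)
  (hA : fermion_algebra I a)
  (Theta : {lrmorphism A -> A}) (hTheta : parity I a Theta)
  (phi : {scalar A}) (hphi : state phi)
  (hfaithful : locally_faithful I a phi) (heven : invariant_state Theta phi) :
  let assertion_i := markov_state I a Theta phi in
  let assertion_ii := forall (t : R) (k n : int),
    I k -> k < n -> below_top I n ->
    even_part Theta (loc a (seg I n (n + 1))) (cocycle I a phi k n t) in
  let assertion_iii := forall n : int, 1 <= n ->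
    local_entropy I a phi 0 (n + 1) - local_entropy I a phi 0 n
      = local_entropy I a phi 0 1 - local_entropy I a phi 0 0 in
  (assertion_i <-> assertion_ii) /\
  (forall d0 : nat, I = setT -> (forall j, d j = d0) ->
   forall alpha : {lrmorphism A -> A}, site_shift a alpha ->
   invariant_state alpha phi ->
   (assertion_i <-> assertion_iii) /\ (assertion_ii <-> assertion_iii)).
Proof.
move=> assertion_i assertion_ii assertion_iii.
have i_ii : assertion_i <-> assertion_ii.
  split; first exact: markov_implies_cocycle.
  exact: cocycle_implies_markov.
split=> // d0 IT dE alpha halpha phi_alpha.
have ii_iii : assertion_ii <-> assertion_iii.
  have {}dE : d = fun=> d0 by apply: funext.
  rewrite /assertion_ii /assertion_iii.
  subst I d; exact: (cocycle_iff_entropy hA hTheta hphi hfaithful heven halpha phi_alpha).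
by split=> //; apply: (iff_trans i_ii).
Qed.
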